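(* Let $X_0$ and $X_1$ be homogeneous Banach spaces on $\mathbb{T}$. Then, whenever $0<\theta<1$ and $1\leq q<\infty$, the real interpolation space $(X_0,X_1)_{\theta,q}$ and the complex interpolation space $[X_0,X_1]_{\theta}$ are homogeneous Banach spaces on $\mathbb{T}$ up to equivalence of norms; that is, each of them is a linear subspace of $L^1(\mathbb{T})$ that becomes a homogeneous Banach space on $\mathbb{T}$ when its norm is replaced with a certain equivalent norm.
   Context: $\mathbb{T}$ is the additive quotient group $\mathbb{R}/2\pi\mathbb{Z}$. $L^1(\mathbb{T})$ is the complex Banach space of complex-valued Lebesgue-integrable functions on $\mathbb{T}$ with norm $\|f\|_{L^1(\mathbb{T})}:=\frac{1}{2\pi}\int_{-\pi}^{\pi}|f(s)|\,ds$. A complex Banach space $X$ with norm $\|\cdot\|$ is called homogeneous on $\mathbb{T}$ if $X$ is a linear subspace of $L^1(\mathbb{T})$ and: (i) $\|f\|_{L^1(\mathbb{T})}\leq\|f\|$ whenever $f\in X$; (ii) $f(\cdot+a)\in X$ and $\|f(\cdot+a)\|=\|f\|$ whenever $f\in X$ and $a\in\mathbb{T}$; (iii) $\|f(\cdot+b)-f(\cdot+a)\|\to 0$ as $b\to a$ whenever $f\in X$ and $a\in\mathbb{T}$. Both $X_0$ and $X_1$ are continuously embedded in $L^1(\mathbb{T})$, so they form an interpolation couple, with $X_0+X_1\subset L^1(\mathbb{T})$. The interpolation spaces are the standard ones (up to equivalence of norms). Real method: $(X_0,X_1)_{\theta,q}$ consists of all $f\in X_0+X_1$ with finite norm $\left(\int_0^\infty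 (t^{-\theta}K(t,f))^q\,\frac{dt}{t}\right)^{1/q}$, where $K(t,f):=\inf\{\|f_0\|_{X_0}+t\|f_1\|_{X_1}: f=f_0+f_1,\ f_j\in X_j\}$. Complex (Calderón) method: $[X_0,X_1]_\theta$ consists of all $f=F(\theta)$, where $F$ is a bounded continuous function on the strip $0\le \operatorname{Re} z\le 1$ with values in $X_0+X_1$, analytic in the interior of the strip, such that $t\mapsto F(j+it)$ is a bounded continuous function from $\mathbb{R}$ to $X_j$ for $j=0,1$; its norm is the infimum of $\max_{j=0,1}\sup_{t\in\mathbb{R}}\|F(j+it)\|_{X_j}$ over all such $F$ with $F(\theta)=f$. *)

(* Defs.v *)
From HB Require Import structures.
From mathcomp Require Import all_boot all_order all_algebra.
From mathcomp Require Import generic_quotient ring_quotient.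
From mathcomp Require Import all_classical all_reals all_analysis measurable_realfun.
From mathcomp Require Import complex.
From mathcomp Require Import lra.

Set Implicit Arguments.
Unset Strict Implicit.
Unset Printing Implicit Defensive.

Import Order.TTheory GRing.Theory Num.Theory numFieldNormedType.Exports.

Local Open Scope classical_set_scope.
Local Open Scope ring_scope.
Local Open Scope complex_scope.
Local Open Scope quotient_scope.

(* The usual topology and normed-space structure of the complex numbers; the
   library attaches them to R[i]^o only. *)
HB.instance Definition _ (R : realType) := NormedModule.copy R[i] R[i]^o.

Section translation.
Variable R : realType.
Local Notation mu := (@lebesgue_measure R).
Local Notation RM := (measurableTypeR R).

Lemma measurable_shift (a : R) : measurable_fun setT ((fun x => x + a) : RM -> RM).
Proof. exact: measurable_funD. Qed.

Lemma preimage_shift_itv (a x y : R) b c :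
  (fun t : R => t + a) @^-1` [set` Interval (BSide b x) (BSide c y)] =
  [set` Interval (BSide b (x - a)) (BSide c (y - a))].
Proof.
apply/seteqP; split => t /=; rewrite !in_itv/=;
  by case: b; case: c; rewrite /= ?lerBlDr ?lerBrDr ?ltrBlDr ?ltrBrDr.
Qed.

Lemma lebesgue_shift a (A : set RM) : measurable A ->
  pushforward mu ((fun x => x + a) : RM -> RM) A = mu A.
Proof.
move=> mA; apply/esym.
pose m := [the {measure set RM -> \bar R} of
  pushforward mu ((fun x => x + a) : RM -> RM)].
apply: (@lebesgue_measure_unique R (m (measurable_shift a))) => //= _ [[x y]] _ <-.
rewrite /m/= /pushforward preimage_shift_itv !lebesgue_measure_itv/= !lte_fin.
by rewrite ltrD2r -!EFinB opprB addrA subrK.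
Qed.

Lemma integrable_shift a (D : set RM) (g : RM -> \bar R) : measurable D ->
  mu.-integrable D g ->
  mu.-integrable ((fun x => x + a) @^-1` D) (fun x => g (x + a)).
Proof.
move=> mD /integrableP[mg ig].
have mpD : measurable ((fun x : RM => x + a) @^-1` D).
  by rewrite -[X in measurable X]setTI; exact: measurable_shift.
have mgs : measurable_fun ((fun x : RM => x + a) @^-1` D) (fun x => g (x + a)).
  apply: (@measurable_comp _ _ _ _ _ _ D g _ (fun x : RM => x + a)) => //.
    by move=> _ [x + <-].
  apply: (@measurable_funS _ _ _ _ setT) => //; exact: measurable_shift.
apply/integrableP; split=> //.
rewrite -(@ge0_integral_pushforward _ _ _ _ R _ (measurable_shift a) mu D
  (abse \o g)) //; last 2 first.
- exact: measurableT_comp.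
- by move=> y _; rewrite /= abse_ge0.
rewrite (eq_measure_integral mu)//  => [|mf A mA _]; [exact: measurable_shift|exact: lebesgue_shift].
Qed.

Lemma integrable_union (A B : set RM) (g : RM -> \bar R) :
  measurable A -> measurable B ->
  mu.-integrable A g -> mu.-integrable B g -> mu.-integrable (A `|` B) g.
Proof.
move=> mA mB /integrableP[mgA iA] /integrableP[mgB iB].
have mgAB : measurable_fun (A `|` B) g by exact/measurable_funU.
apply/integrableP; split=> //.
have -> : A `|` B = A `|` (B `\` A).
  by apply/seteqP; split => x /=; case: (pselect (A x)); tauto.
rewrite ge0_integral_setU//.
- apply: lte_add_pinfty => //; apply: le_lt_trans iB.
  apply: ge0_subset_integral => //; first exact: measurableD.
  exact: measurableT_comp.
- exact: measurableD.
- apply: measurableT_comp => //; apply: measurable_funS mgAB.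
    exact: measurableU.
  by move=> x [Ax|[Bx _]]; [left|right].
- by apply/disj_set2P; rewrite setDE setICA setICr setI0.
Qed.

Lemma periodic_integrable_shift (g : R -> R) (a : R) :
  (forall x, g (x + 2 * pi) = g x) ->
  mu.-integrable `[- pi, pi]%classic (EFin \o g) ->
  mu.-integrable `[- pi, pi]%classic (EFin \o (fun x => g (x + a))).
Proof.
move=> pg ig.
have pg' x : g (x + - (2 * pi)) = g x by rewrite -{2}(subrK (2 * pi) x) pg.
have pi0 : 0 < pi :> R := pi_gt0 R.
have ign n : mu.-integrable
   `[- pi - 2 * pi * n%:R, pi + 2 * pi * n%:R]%classic (EFin \o g).
  elim: n => [|n ih]; first by rewrite mulr0 subr0 addr0.
  have i1 := integrable_shift (2 * pi) (measurable_itv _) ih.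
  have i2 := integrable_shift (- (2 * pi)) (measurable_itv _) ih.
  rewrite /= in i1 i2.
  rewrite (funext (fun x => congr1 EFin (pg x))) in i1.
  rewrite (funext (fun x => congr1 EFin (pg' x))) in i2.
  rewrite !preimage_shift_itv in i1 i2.
  have i3 := integrable_union (measurable_itv _)
    (measurableU _ _ (measurable_itv _) (measurable_itv _)) i1
    (integrable_union (measurable_itv _) (measurable_itv _) ih i2).
  apply: integrableS i3 => //.
    by apply: measurableU => //; apply: measurableU.
  move=> x /=; rewrite !in_itv/= -natr1 => /andP[x1 x2].
  have n0 : 0 <= pi * n%:R :> R by rewrite mulr_ge0// ltW.
  case: (leP x (- pi - 2 * pi * n%:R)) => x3; [left|right].
    by apply/andP; split; lra.
  case: (leP x (pi + 2 * pi * n%:R)) => x4; [left|right].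
    by apply/andP; split; lra.
  by apply/andP; split; lra.
have [n an] : exists n, `|a| <= pi * n%:R.
  exists (Num.bound (`|a| / pi)); rewrite mulrC -ler_pdivrMr//.
  by apply/ltW/archi_boundP; rewrite divr_ge0// ltW.
have := integrable_shift a (measurable_itv _) (ign n).
rewrite preimage_shift_itv; apply: integrableS => //.
move=> x /=; rewrite !in_itv/= => /andP[x1 x2].
by have := ler_norm a; have := ler_norm (- a); rewrite normrN => *;
  apply/andP; split; lra.
Qed.
End translation.

(* Functions on T = R/2piZ are represented by 2pi-periodic functions on R. *)
Section L1_functions.
Variable R : realType.
Local Notation mu := (@lebesgue_measure R).
Local Notation RM := (measurableTypeR R).
Local Notation period := (`[- pi, pi]%classic : set R).

Definition L1_periodic_prop (f : R -> R[i]) : Prop :=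
  [/\ forall x, f (x + 2 * pi) = f x,
      mu.-integrable period (EFin \o (fun x => complex.Re (f x)))
    & mu.-integrable period (EFin \o (fun x => complex.Im (f x)))].

Definition L1_periodic : {pred (R -> R[i])} :=
  fun f => `[< L1_periodic_prop f >].

Lemma L1_periodicP f : reflect (L1_periodic_prop f) (f \in L1_periodic).
Proof. exact: asboolP. Qed.

Lemma L1_periodic_submod_closed : submod_closed L1_periodic.
Proof.
have mp : measurable (period : set (measurableTypeR R)) by [].
split.
  apply/L1_periodicP; split => //.
  - by apply: (@eq_integrable _ _ _ mu _ mp (cst 0%E)) => //; exact: integrable0.
  - by apply: (@eq_integrable _ _ _ mu _ mp (cst 0%E)) => //; exact: integrable0.
move=> [a b] f g /L1_periodicP[pf rf jf] /L1_periodicP[pg rg jg].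
apply/L1_periodicP; split.
- by move=> x; rewrite !fctE pf pg.
- apply: (@eq_integrable _ _ _ mu _ mp ((fun x => a%:E * (complex.Re (f x))%:E) \-
     (fun x => b%:E * (complex.Im (f x))%:E) \+
     (fun x => (complex.Re (g x))%:E))%E).
    move=> x _; rewrite !fctE/=.
    by case: (f x) => ? ?; case: (g x).
  apply: integrableD => //; apply: integrableB => //; exact: integrableZl.
- apply: (@eq_integrable _ _ _ mu _ mp ((fun x => a%:E * (complex.Im (f x))%:E) \+
     (fun x => b%:E * (complex.Re (f x))%:E) \+
     (fun x => (complex.Im (g x))%:E))%E).
    move=> x _; rewrite !fctE/=.
    by case: (f x) => ? ?; case: (g x).
  by apply: integrableD => //; apply: integrableD => //; exact: integrableZl.
Qed.

HB.instance Definition _ :=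
  GRing.isSubmodClosed.Build R[i] (R -> R[i]) L1_periodic
    L1_periodic_submod_closed.

Record L1fun := MkL1fun { L1val :> R -> R[i] ; _ : L1val \in L1_periodic }.

HB.instance Definition _ := [isSub for L1val].
HB.instance Definition _ := gen_eqMixin L1fun.
HB.instance Definition _ := [Choice of L1fun by <:].
HB.instance Definition _ := [SubChoice_isSubLmodule of L1fun by <:].

Lemma L1valZ (c : R[i]) (f : L1fun) x : (c *: f) x = c * f x.
Proof. by []. Qed.

Lemma L1valD (f g : L1fun) x : (f + g) x = f x + g x.
Proof. by []. Qed.

Lemma L1valB (f g : L1fun) x : (f - g) x = f x - g x.
Proof. by []. Qed.

Definition ae_null : {pred L1fun} :=
  fun f => `[< {ae mu, forall x, f x = 0} >].

Lemma ae_nullP (f : L1fun) : reflect {ae mu, forall x, f x = 0} (f \in ae_null).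
Proof. exact: asboolP. Qed.

Lemma ae_null_submod_closed : submod_closed ae_null.
Proof.
split; first by apply/ae_nullP; apply: aeW.
move=> a f g /ae_nullP f0 /ae_nullP g0; apply/ae_nullP.
apply: (@filterS2 _ _ (ae_filter_ringOfSetsType mu) _ _ _ _ f0 g0) => x fx gx.
by rewrite L1valD L1valZ fx gx mulr0 addr0.
Qed.

HB.instance Definition _ :=
  GRing.isSubmodClosed.Build R[i] L1fun ae_null ae_null_submod_closed.

(* L^1(T). Measurability on R is Borel measurability here; every
   Lebesgue-measurable function is a.e. equal to a Borel one, so the a.e.
   classes are the usual ones. *)
Definition L1T : Type := Quotient.quot ae_null.

HB.instance Definition _ := GRing.Zmodule.on L1T.
HB.instance Definition _ := ZmodQuotient.on L1T.

Definition L1class : L1fun -> L1T := \pi.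

Lemma L1classK (f : L1T) : L1class (repr f) = f.
Proof. exact: reprK. Qed.

Definition L1T_scale (c : R[i]) (f : L1T) : L1T := L1class (c *: repr f).

Lemma L1T_eqP (f g : L1fun) :
  reflect {ae mu, forall x, f x = g x} (L1class f == L1class g).
Proof.
have -> : (L1class f == L1class g) = (f - g \in ae_null).
  by rewrite Quotient.idealrBE.
apply: (iffP (ae_nullP _)); apply: (@filterS _ _ (ae_filter_ringOfSetsType mu)) => x.
  by move/eqP; rewrite L1valB subr_eq0 => /eqP.
by move=> e; rewrite L1valB e subrr.
Qed.

Lemma L1T_repr (f : L1fun) : {ae mu, forall x, repr (L1class f) x = f x}.
Proof. by apply/L1T_eqP; rewrite L1classK. Qed.

Lemma L1T_piZ c f : L1class (c *: f) = L1T_scale c (L1class f).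
Proof.
apply/eqP/L1T_eqP; have := L1T_repr f.
apply: (@filterS _ _ (ae_filter_ringOfSetsType mu)) => x e.
by rewrite !L1valZ e.
Qed.

Lemma L1T_piD f g : L1class (f + g) = L1class f + L1class g.
Proof. exact: pi_addr. Qed.

Lemma L1T_scalerA a b f : L1T_scale a (L1T_scale b f) = L1T_scale (a * b) f.
Proof. by rewrite -[f]L1classK -(L1T_piZ b) -!L1T_piZ scalerA. Qed.

Lemma L1T_scale1r : left_id 1 L1T_scale.
Proof. by move=> f; rewrite -[f]L1classK -L1T_piZ scale1r. Qed.

Lemma L1T_scalerDr : right_distributive L1T_scale +%R.
Proof.
by move=> c f g; rewrite -[f]L1classK -[g]L1classK -L1T_piD -!L1T_piZ -L1T_piD
  scalerDr.
Qed.

Lemma L1T_scalerDl f : {morph L1T_scale^~ f : a b / a + b}.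
Proof. by move=> a b; rewrite -[f]L1classK -!L1T_piZ -L1T_piD scalerDl. Qed.

HB.instance Definition _ := GRing.Zmodule_isLmodule.Build R[i] L1T
  L1T_scalerA L1T_scale1r L1T_scalerDr L1T_scalerDl.

Definition L1T_norm (f : L1T) : R :=
  (2 * pi)^-1 * \int[mu]_(s in `[- pi, pi]) Normc.normc (repr f s).

Lemma ae_shift (P : R -> Prop) a :
  {ae mu, forall x, P x} -> {ae mu, forall x, P (x + a)}.
Proof.
move=> [N [mN N0 PN]]; exists ((fun x => x + a) @^-1` N); split.
- by rewrite -[X in measurable X]setTI; exact: measurable_shift.
- by rewrite -[LHS]/(pushforward mu ((fun x => x + a) : RM -> RM) N)
    lebesgue_shift.
- by move=> x Px; exact: PN.
Qed.

Lemma L1_periodic_shift (f : L1fun) a : (fun x => f (x + a)) \in L1_periodic.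
Proof.
case: f => f /= /L1_periodicP[pf rf jf]; apply/L1_periodicP; split.
- by move=> x; rewrite -addrAC pf.
- by apply: (@periodic_integrable_shift R (fun x => complex.Re (f x))) => // x;
    rewrite pf.
- by apply: (@periodic_integrable_shift R (fun x => complex.Im (f x))) => // x;
    rewrite pf.
Qed.

(* f(. + a); a real number a stands for its class in R/2piZ. *)
Definition L1fun_shift (a : R) (f : L1fun) : L1fun :=
  MkL1fun (L1_periodic_shift f a).

Definition translate (a : R) (f : L1T) : L1T := L1class (L1fun_shift a (repr f)).

Lemma translate_pi a (f : L1fun) :
  translate a (L1class f) = L1class (L1fun_shift a f).
Proof. exact/eqP/L1T_eqP/(ae_shift a (L1T_repr f)). Qed.

Lemma measurable_normc (f : L1fun) :
  measurable_fun period (fun x => Normc.normc (f x)).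
Proof.
case: f => f /= /L1_periodicP[_ /measurable_int/measurable_EFinP rf
  /measurable_int/measurable_EFinP jf].
rewrite (_ : (fun x => _) =
  fun x => Num.sqrt (complex.Re (f x) ^+ 2 + complex.Im (f x) ^+ 2)).
  apply: (@measurableT_comp _ _ _ _ _ _ (@Num.sqrt R : RM -> RM)).
    by apply: continuous_measurable_fun; exact: sqrt_continuous.
  by apply: measurable_funD; apply: measurable_funX.
by apply/funext => x; case: (f x).
Qed.

Lemma L1T_norm_pi (f : L1fun) :
  L1T_norm (L1class f) =
  (2 * pi)^-1 * \int[mu]_(s in `[- pi, pi]) Normc.normc (f s).
Proof.
congr (_ * fine _); apply: ae_eq_integral => //.
- by apply/measurable_EFinP; apply: measurable_normc.
- by apply/measurable_EFinP; apply: measurable_normc.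
have := L1T_repr f.
by apply: (@filterS _ _ (ae_filter_ringOfSetsType mu)) => x /= -> _.
Qed.

End L1_functions.

Arguments L1T_norm {R}.
Arguments translate {R}.

(* A subspace of L^1(T) with a norm of its own; the values of nrm outside the
   carrier are irrelevant. *)
Record nspace (R : realType) := NSpace {
  carrier :> L1T R -> Prop ;
  nrm : L1T R -> R }.

Section homogeneous_spaces.
Variable R : realType.
Implicit Types X : nspace R.

(* Nonnegativity of the norm follows from nrmD and nrmZ. *)
Record banach_subspace X : Prop := {
  carrier0 : X 0 ;
  carrierD : forall f g, X f -> X g -> X (f + g) ;
  carrierZ : forall (c : R[i]) f, X f -> X (c *: f) ;
  nrm_eq0 : forall f, X f -> nrm X f = 0 -> f = 0 ;
  nrmD : forall f g, X f -> X g -> nrm X (f + g) <= nrm X f + nrm X g ;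
  nrmZ : forall (c : R[i]) f, X f -> nrm X (c *: f) = Normc.normc c * nrm X f ;
  nrm_complete : forall u : nat -> L1T R, (forall n, X (u n)) ->
    (forall e : R, 0 < e -> \forall m & n \near \oo, nrm X (u m - u n) < e) ->
    exists2 f, X f & nrm X (u n - f) @[n --> \oo] --> (0 : R) }.

Record homogeneous X : Prop := {
  homogeneous_banach : banach_subspace X ;
  homogeneous_L1 : forall f, X f -> L1T_norm f <= nrm X f ;
  homogeneous_translate : forall f (a : R), X f ->
    X (translate a f) /\ nrm X (translate a f) = nrm X f ;
  homogeneous_continuous : forall f (a : R), X f ->
    nrm X (translate b f - translate a f) @[b --> a] --> (0 : R) }.

Definition homogeneous_up_to_equivalence X : Prop :=
  exists N : L1T R -> R,
    homogeneous (NSpace X N) /\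
    exists c C : R, [/\ 0 < c, 0 < C &
      forall f, X f -> c * nrm X f <= N f /\ N f <= C * nrm X f].

End homogeneous_spaces.

Section interpolation.
Variable R : realType.
Implicit Types (X Y : nspace R) (f : L1T R).

Definition Kfunctional X0 X1 (t : R) f : R :=
  inf [set r | exists f0 f1, [/\ X0 f0, X1 f1, f = f0 + f1 &
                              r = nrm X0 f0 + t * nrm X1 f1]].

(* The norm of X0 + X1 is K(1, .). *)
Definition sum_space X0 X1 : nspace R :=
  NSpace [set f | exists f0 f1, [/\ X0 f0, X1 f1 & f = f0 + f1]]
         (Kfunctional X0 X1 1).

Definition real_integral X0 X1 (theta q : R) f : \bar R :=
  (\int[@lebesgue_measure R]_(t in `]0%R, +oo[)
     ((t `^ (- theta) * Kfunctional X0 X1 t f) `^ q / t)%:E)%E.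

Definition real_interpolation X0 X1 (theta q : R) : nspace R :=
  NSpace [set f | sum_space X0 X1 f /\ (real_integral X0 X1 theta q f < +oo)%E]
         (fun f => fine (real_integral X0 X1 theta q f) `^ q^-1).

Definition bounded_continuous_in Y {T : topologicalType} (A : set T)
    (g : T -> L1T R) : Prop :=
  [/\ forall x, A x -> Y (g x),
      exists M : R, forall x, A x -> nrm Y (g x) <= M &
      forall x, A x ->
        nrm Y (g y - g x) @[y --> within A (nbhs x)] --> (0 : R)].

Definition strip : set R[i] := [set z | 0 <= complex.Re z <= 1].
Definition open_strip : set R[i] := [set z | 0 < complex.Re z < 1].

(* Complex differentiability at every point, in the norm of Y. *)
Definition analytic_in Y (A : set R[i]) (F : R[i] -> L1T R) : Prop :=
  forall z, A z -> exists2 D, Y D &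
    nrm Y ((w - z)^-1 *: (F w - F z) - D) @[w --> z^'] --> (0 : R).

Record calderon X0 X1 (F : R[i] -> L1T R) : Prop := {
  calderon_strip : bounded_continuous_in (sum_space X0 X1) strip F ;
  calderon_analytic : analytic_in (sum_space X0 X1) open_strip F ;
  calderon_line0 :
    bounded_continuous_in X0 [set: R] (fun t : R => F (0 +i* t)) ;
  calderon_line1 :
    bounded_continuous_in X1 [set: R] (fun t : R => F (1 +i* t)) }.

Definition calderon_norm X0 X1 (F : R[i] -> L1T R) : R :=
  Num.max (sup (range (fun t : R => nrm X0 (F (0 +i* t)))))
          (sup (range (fun t : R => nrm X1 (F (1 +i* t))))).

Definition complex_interpolation X0 X1 (theta : R) : nspace R :=
  NSpace [set f | exists2 F, calderon X0 X1 F & F theta%:C = f]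
         (fun f => inf [set calderon_norm X0 X1 F | F in
                          [set F | calderon X0 X1 F /\ F theta%:C = f]]).

End interpolation.

(* Main.v *)
(* Translations act isometrically and strongly continuously on X_0 and X_1, hence
   preserve K(t, .) and the Calderon norm; this gives condition (ii) for both
   interpolation spaces. Both embed in X_0 + X_1, whose norm K(1, .) dominates the
   L^1 norm.

   Real method. The norm is the L^q norm of t^(-theta - 1/q) K(t, f), so it is
   subadditive by Minkowski's inequality; completeness follows from that of
   X_0 + X_1 by Fatou's lemma, and continuity of translations from the pointwise
   convergence K(t, f(. + b) - f(. + a)) -> 0, dominated by K(t, 2 f).

   Complex method. The embedding in X_0 + X_1, and the uniform convergence on the
   strip of a series that converges on the boundary lines, rest on the maximum
   principle for functions analytic in X_0 + X_1 (complex differentiability at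
   each point is all that is assumed). It is obtained without vector-valued
   integrals: Goursat's bisection argument is carried out on midpoint Riemann
   sums and applied to F(z + exp zeta), which yields a discrete mean value
   inequality on circles. The maximum principle for difference quotients gives
   Cauchy's estimate, hence the analyticity of the sum of the series. If
   f = F(theta), then f(. + b) - f(. + a) is the value at theta of
   (1 + theta) / (1 + z) * (F(z)(. + b) - F(z)(. + a)), which is small on the
   boundary: near infinity because of the first factor, and on compact sets
   because translations are equicontinuous. *)
Require Import Defs.
From mathcomp Require Import all_boot all_order all_algebra.
From mathcomp Require Import all_classical all_reals all_analysis measurable_realfun.
From mathcomp Require Import complex.
From mathcomp Require Import ring lra zify.

Set Implicit Arguments.
Unset Strict Implicit.
Unset Printing Implicit Defensive.

Import Order.TTheory GRing.Theory Num.Theory numFieldNormedType.Exports.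
Import Normc.

Local Open Scope classical_set_scope.
Local Open Scope ring_scope.
Local Open Scope complex_scope.

(** Completeness is tested throughout on series whose terms are bounded by K 2^-k, with the explicit
    remainder 2 K 2^-n ([geometric_complete]). In this form near-optimal decompositions or
    competitors can be chosen term by term, and remainders can be compared in different norms. A
    limit found in X_0 or X_1 and a limit found in X_0 + X_1 are identified in L^1(T), which all
    these norms control.

    The Cauchy theory works in a module with a seminorm on a subspace. Midpoint sums suit it because
    the two facts behind Goursat's argument hold for them without error: the sum around a
    parallelogram vanishes for affine functions, and doubling the number of nodes splits it exactly
    along a bisection. The maximum principle tolerates one exceptional point at which only
    continuity is known, so it applies to a difference quotient completed by the derivative.

    The equivalent norm is a constant multiple of the given one: the factor 2^(theta + 1/q) for the
    real method and 1 for the complex method make it dominate the L^1 norm. *)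

Section complex_modulus.
Variable R : realType.
Implicit Types (z w : R[i]) (x : R).

Lemma normc_ge0 z : 0 <= normc z.
Proof. by case: z => a b; exact: sqrtr_ge0. Qed.

Lemma normcD z w : normc (z + w) <= normc z + normc w.
Proof. exact: (@le_normcD R z w). Qed.

Lemma normcN z : normc (- z) = normc z.
Proof. exact: (@complex.normcN R z). Qed.

Lemma normcB z w : normc (z - w) = normc (w - z).
Proof. by rewrite -normcN opprB. Qed.

Lemma normcBD z w u : normc (z - w) <= normc (z - u) + normc (u - w).
Proof. by rewrite -[z - w](subrKA u); exact: normcD. Qed.

Lemma normc_real x : normc x%:C = `|x|.
Proof. by rewrite /= expr0n/= addr0 sqrtr_sqr. Qed.

Lemma normc_Im x : normc (0 +i* x) = `|x|.
Proof. by rewrite /= expr0n/= add0r sqrtr_sqr. Qed.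

Lemma normc_nat n : normc n%:R = n%:R :> R.
Proof.
by rewrite -[n%:R in LHS](rmorph_nat (real_complex R)) normc_real normr_nat.
Qed.

Lemma normc_le_ReIm z : normc z <= `|complex.Re z| + `|complex.Im z|.
Proof.
have -> : z = (complex.Re z)%:C + (0 +i* complex.Im z).
  by case: z => a b; apply/eqP; rewrite eq_complex /= addr0 add0r !eqxx.
by apply: le_trans (normcD _ _) _; rewrite normc_real normc_Im /= addr0 add0r.
Qed.

Lemma normRe_le z : `|complex.Re z| <= normc z.
Proof.
by case: z => a b /=; rewrite -sqrtr_sqr ler_sqrt ?lerDl ?sqr_ge0// addr_ge0 ?sqr_ge0.
Qed.

Lemma normIm_le z : `|complex.Im z| <= normc z.
Proof.
by case: z => a b /=; rewrite -sqrtr_sqr ler_sqrt ?lerDr ?sqr_ge0// addr_ge0 ?sqr_ge0.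
Qed.

Lemma normc_eq0 z : (normc z == 0) = (z == 0).
Proof.
by apply/eqP/eqP => [/eq0_normc//|->]; rewrite normc0.
Qed.

Lemma normc_gt0 z : (0 < normc z) = (z != 0).
Proof. by rewrite lt_def normc_eq0 normc_ge0 andbT. Qed.

Lemma nbhs_normcP (z : R[i]) (P : set R[i]) :
  nbhs z P <-> exists2 d : R, 0 < d & forall w, normc (w - z) < d -> P w.
Proof.
have bE (d : R) w : ball z d%:C w = (normc (w - z) < d) :> Prop.
  rewrite -ball_normE /ball_/=.
  by rewrite -[X in X < _]/((normc (z - w))%:C) ltcR normcB.
split=> [/nbhs_ballP[e /= e0 zP]|[d d0 dP]]; last first.
  apply/nbhs_ballP; exists d%:C; first by rewrite /= ltcR.
  by move=> w; rewrite bE; exact: dP.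
have [d d0 de] : exists2 d : R, 0 < d & d%:C = e.
  case: e e0 {zP} => a b /=; rewrite ltcE /= => /andP[/eqP -> a0].
  by exists a.
by exists d => // w dw; apply: zP; rewrite -de bE.
Qed.

End complex_modulus.

(** * Subspaces with a seminorm *)

Section seminormed_spaces.
Variables (R : realType) (V : lmodType R[i]).

(** The common shape of X_0, X_1, X_0 + X_1 with any K(t, .), both interpolation spaces and L^1(T).
    The values of [p] outside [C] are arbitrary, which is why every estimate below carries
    membership side conditions. *)
Record seminormed (C : V -> Prop) (p : V -> R) : Prop := Seminormed {
  sn_carrier0 : C 0 ;
  sn_carrierD : forall f g, C f -> C g -> C (f + g) ;
  sn_carrierZ : forall (c : R[i]) f, C f -> C (c *: f) ;
  snD : forall f g, C f -> C g -> p (f + g) <= p f + p g ;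
  snZ : forall (c : R[i]) f, C f -> p (c *: f) = normc c * p f }.

Variables (C : V -> Prop) (p : V -> R).
Hypothesis Cp : seminormed C p.

Let C0 := sn_carrier0 Cp.
Let CD := sn_carrierD Cp.
Let CZ := sn_carrierZ Cp.

Lemma sn_carrierN f : C f -> C (- f).
Proof. by rewrite -scaleN1r; exact: CZ. Qed.

Lemma sn_carrierB f g : C f -> C g -> C (f - g).
Proof. by move=> ? ?; apply: CD => //; exact: sn_carrierN. Qed.

Lemma sn0 : p 0 = 0.
Proof. by rewrite -(scale0r (0 : V)) (snZ Cp) // normc0 mul0r. Qed.

Lemma snN f : C f -> p (- f) = p f.
Proof. by move=> Cf; rewrite -scaleN1r (snZ Cp)// normcN normc1 mul1r. Qed.

Lemma snB f g : C f -> C g -> p (f - g) <= p f + p g.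
Proof.
by move=> Cf Cg; rewrite -(snN Cg); apply: (snD Cp) => //; exact: sn_carrierN.
Qed.

Lemma snBC f g : C f -> C g -> p (f - g) = p (g - f).
Proof. by move=> Cf Cg; rewrite -[RHS]snN ?opprB//; exact: sn_carrierB. Qed.

Lemma snBD g f h : C f -> C g -> C h -> p (f - h) <= p (f - g) + p (g - h).
Proof.
by move=> Cf Cg Ch; rewrite -[f - h](subrKA g); apply: (snD Cp); exact: sn_carrierB.
Qed.

Lemma sn_ge0 f : C f -> 0 <= p f.
Proof.
move=> Cf; have := snB Cf Cf; rewrite subrr sn0; lra.
Qed.

Lemma sn_leB f g : C f -> C g -> p f <= p g + p (f - g).
Proof.
by move=> Cf Cg; rewrite -{1}(subrK g f) addrC; apply: (snD Cp) => //; exact: sn_carrierB.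
Qed.

Lemma sn_carrier_sum (I : Type) (r : seq I) (P : pred I) (F : I -> V) :
  (forall i, P i -> C (F i)) -> C (\sum_(i <- r | P i) F i).
Proof. by move=> CF; apply: (big_ind C). Qed.

Lemma sn_sum (I : Type) (r : seq I) (P : pred I) (F : I -> V) :
  (forall i, P i -> C (F i)) ->
  p (\sum_(i <- r | P i) F i) <= \sum_(i <- r | P i) p (F i).
Proof.
move=> CF; suff [] : C (\sum_(i <- r | P i) F i) /\
  p (\sum_(i <- r | P i) F i) <= \sum_(i <- r | P i) p (F i) by [].
apply: (big_ind2 (fun f x => C f /\ p f <= x)); first by rewrite sn0.
  move=> f x g y [Cf fx] [Cg gy]; split; first exact: CD.
  by apply: le_trans (snD Cp Cf Cg) _; exact: lerD.
by move=> i Pi; split => //; exact: CF.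
Qed.

End seminormed_spaces.
(** * Cauchy theory for functions with values in a seminormed space *)

Section goursat.
Variables (R : realType) (V : lmodType R[i]).
Implicit Types (G H : R[i] -> V) (z w s : R[i]).

Definition midpt n (j : nat) : R := (j%:R + 2^-1) / n%:R.

(* Midpoint Riemann sum of the integral of G over the segment [z, z + s];
   the midpoint rule is exact on affine functions. *)
Definition midsum G n z s : V :=
  \sum_(j < n) (s / n%:R) *: G (z + s * (midpt n j)%:C).

(** Riemann sum for the boundary integral over the parallelogram spanned by [s] and [s'] at [z]:
    bottom, right, minus top, minus left. *)
Definition circulation G n z s s' : V :=
  midsum G n z s + midsum G n (z + s) s'
  - midsum G n (z + s') s - midsum G n z s'.

Lemma midpt_itv n (j : 'I_n) : 0 <= midpt n j <= 1.
Proof.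
have n0 : 0 < n%:R :> R by rewrite ltr0n (leq_ltn_trans _ (ltn_ord j)).
rewrite /midpt divr_ge0 ?addr_ge0 ?invr_ge0//= ler_pdivrMr// mul1r.
have : j.+1%:R <= n%:R :> R by rewrite ler_nat.
rewrite -natr1; lra.
Qed.

Lemma midptE n j : (midpt n j)%:C = (j%:R + 2^-1) / n%:R.
Proof. by rewrite /midpt !(rmorphM, rmorphD, rmorph_nat, fmorphV). Qed.

Lemma midsumD G H n z s :
  midsum (fun w => G w + H w) n z s = midsum G n z s + midsum H n z s.
Proof. by rewrite /midsum -big_split; apply: eq_bigr => j _; rewrite scalerDr. Qed.

(** The nodes of the doubled sum are exactly the nodes of the two half segments, so there is no
    error term. *)
Lemma midsum_double G n z s :
  midsum G (n + n) z s = midsum G n z (s / 2) + midsum G n (z + s / 2) (s / 2).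
Proof.
have [->|n0] := posnP n; first by rewrite /midsum !big_ord0 addr0.
have n0' : n%:R != 0 :> R[i] by rewrite pnatr_eq0 -lt0n.
have nn0 : n%:R + n%:R != 0 :> R[i] by rewrite -mulr2n mulrn_eq0.
rewrite {1}/midsum big_split_ord /=; congr (_ + _); apply: eq_bigr => j _.
  rewrite !midptE natrD; congr (_ *: G _); first by field; rewrite n0' nn0.
  by field; rewrite n0' nn0.
rewrite !midptE !natrD; congr (_ *: G _); first by field; rewrite n0' nn0.
by field; rewrite n0' nn0.
Qed.

(** Two cells side by side: the common edge [m] is the right side of the first and the left side of
    the second. In [subr_glueV] the common edge [h] is the top of the lower cell and the bottom of
    the upper one. *)
Lemma subr_glueH (U : zmodType) (a m h d a' b h' : U) :
  (a + m - h - d) + (a' + b - h' - m) = a + a' + b - (h + h') - d.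
Proof.
by rewrite [LHS](AC (4*4) ((1*5)*6*(3*7)*4*(2*8)))/= subrr addr0 -opprD.
Qed.

Lemma subr_glueV (U : zmodType) (a b h d b' c d' : U) :
  (a + b - h - d) + (h + b' - c - d') = a + (b + b') - c - (d + d').
Proof.
by rewrite [LHS](AC (4*4) (1*(2*6)*7*(4*8)*(3*5)))/= addNr addr0 -opprD.
Qed.

(** Bisection into four cells. Each side of the large parallelogram splits by [midsum_double], and
    the inner edges cancel in pairs. *)
Lemma circulation_double G n z s s' :
  circulation G (n + n) z s s' =
  circulation G n z (s / 2) (s' / 2) +
  circulation G n (z + s / 2) (s / 2) (s' / 2) +
  (circulation G n (z + s' / 2) (s / 2) (s' / 2) +
   circulation G n (z + s / 2 + s' / 2) (s / 2) (s' / 2)).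
Proof.
rewrite /circulation !midsum_double.
have -> : z + s' + s / 2 = z + s / 2 + s' / 2 + s' / 2 by field.
have -> : z + s + s' / 2 = z + s / 2 + s' / 2 + s / 2 by field.
have -> : z + s' / 2 + s / 2 = z + s / 2 + s' / 2 by ring.
have -> : z + s / 2 + s / 2 = z + s by field.
have -> : z + s' / 2 + s' / 2 = z + s' by field.
by rewrite !subr_glueH subr_glueV.
Qed.

(** The nodes (j + 1/2) / n have mean exactly 1/2, whatever n is; the right-hand side is the true
    integral. *)
Lemma midsum_affine n z s (A B : V) : (0 < n)%N ->
  midsum (fun w => A + w *: B) n z s = s *: A + (s * z + s ^+ 2 / 2) *: B.
Proof.
move=> n0; have n0' : n%:R != 0 :> R[i] by rewrite pnatr_eq0 -lt0n.
have sj : \sum_(j < n) j%:R = n%:R * (n%:R - 1) / 2 :> R[i].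
  elim: (n) => [|k ih]; first by rewrite big_ord0 !mul0r.
  by rewrite big_ord_recr /= ih -natr1; field.
rewrite midsumD; congr (_ + _).
  by rewrite /midsum -scaler_suml sumr_const card_ord -(mulr_natr (s / _)) divfK.
rewrite /midsum; under eq_bigr do rewrite scalerA.
rewrite -scaler_suml; congr (_ *: _).
under eq_bigr do rewrite midptE.
rewrite -mulr_sumr big_split /= sumr_const card_ord -mulr_sumr -mulr_suml.
rewrite big_split /= sj !sumr_const card_ord.
rewrite -(mulr_natr z) -(mulr_natr 2^-1).
by field.
Qed.

Lemma circulation_affine n z s s' (A B : V) : (0 < n)%N ->
  circulation (fun w => A + w *: B) n z s s' = 0.
Proof.
move=> n0; rewrite /circulation !midsum_affine//.
have lD (x y x' y' : R[i]) : (x *: A + y *: B) + (x' *: A + y' *: B) =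
  (x + x') *: A + (y + y') *: B by rewrite addrACA -!scalerDl.
have lB (x y x' y' : R[i]) : (x *: A + y *: B) - (x' *: A + y' *: B) =
  (x - x') *: A + (y - y') *: B by rewrite opprD -!scaleNr lD.
rewrite lD !lB.
have -> : s + s' - s - s' = 0 by ring.
rewrite (_ : _ - (s' * z + _) = 0) ?scale0r ?addr0//.
by field.
Qed.

Lemma circulationD G H n z s s' :
  circulation (fun w => G w + H w) n z s s' =
  circulation G n z s s' + circulation H n z s s'.
Proof.
rewrite /circulation !midsumD !opprD [LHS](AC (2*2*2*2) ((1*3*5*7)*(2*4*6*8)))/=.
by [].
Qed.

Variables (C : V -> Prop) (p : V -> R).
Hypothesis Cp : seminormed C p.

Lemma midsum_carrier H n z s : (forall w, C (H w)) -> C (midsum H n z s).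
Proof.
by move=> CH; apply: (sn_carrier_sum Cp) => j _; apply: (sn_carrierZ Cp).
Qed.

Lemma circulation_carrier H n z s s' :
  (forall w, C (H w)) -> C (circulation H n z s s').
Proof.
move=> CH; have CM := fun z s => @midsum_carrier H n z s CH.
by do ![apply: (sn_carrierB Cp) => //]; exact: (sn_carrierD Cp).
Qed.

Lemma midsum_le H n z s K : (0 < n)%N -> (forall w, C (H w)) ->
  (forall t : R, 0 <= t <= 1 -> p (H (z + s * t%:C)) <= K) ->
  p (midsum H n z s) <= normc s * K.
Proof.
move=> n0 CH HK; apply: le_trans (sn_sum Cp _ _) _.
  by move=> j _; apply: (sn_carrierZ Cp).
have n0' : n%:R != 0 :> R by rewrite pnatr_eq0 -lt0n.
apply: (@le_trans _ _ (\sum_(j < n) normc s / n%:R * K)).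
  apply: ler_sum => j _; rewrite (snZ Cp)// normcM normcV normc_nat.
  by rewrite ler_wpM2l ?divr_ge0 ?normc_ge0// HK// midpt_itv.
by rewrite sumr_const card_ord -(mulr_natr (_ * _)) mulrAC divfK.
Qed.

Lemma circulation_le H n z s s' K : (0 < n)%N -> (forall w, C (H w)) ->
  (forall w, normc (w - z) <= normc s + normc s' -> p (H w) <= K) ->
  p (circulation H n z s s') <= 2 * (normc s + normc s') * K.
Proof.
move=> n0 CH HK; have CM := fun z s => @midsum_carrier H n z s CH.
have tle (t : R) (u : R[i]) : 0 <= t <= 1 -> normc (u * t%:C) <= normc u.
  move=> /andP[t0 t1]; rewrite normcM normc_real ger0_norm//.
  by rewrite ler_piMr ?normc_ge0.
have zk u : z + u - z = u by rewrite addrAC subrr add0r.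
have s0 := normc_ge0 s; have s'0 := normc_ge0 s'.
have b1 : p (midsum H n z s) <= normc s * K.
  apply: midsum_le => // t /tle ts; apply: HK.
  by rewrite zk; apply: le_trans (ts _) _; rewrite lerDl.
have b2 : p (midsum H n (z + s) s') <= normc s' * K.
  apply: midsum_le => // t /tle ts; apply: HK.
  rewrite -(addrA z) zk; apply: le_trans (normcD _ _) _.
  by rewrite lerD2l.
have b3 : p (midsum H n (z + s') s) <= normc s * K.
  apply: midsum_le => // t /tle ts; apply: HK.
  rewrite -(addrA z) zk addrC; apply: le_trans (normcD _ _) _.
  by rewrite lerD2r.
have b4 : p (midsum H n z s') <= normc s' * K.
  apply: midsum_le => // t /tle ts; apply: HK.
  by rewrite zk; apply: le_trans (ts _) _; rewrite lerDr.
rewrite /circulation.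
have := snB Cp (sn_carrierB Cp (sn_carrierD Cp (CM z s) (CM (z + s) s'))
  (CM (z + s') s)) (CM z s').
have := snB Cp (sn_carrierD Cp (CM z s) (CM (z + s) s')) (CM (z + s') s).
have := snD Cp (CM z s) (CM (z + s) s').
lra.
Qed.

(** The affine part has circulation exactly 0, so only the deviation from it counts. This takes the
    place of the primitive of an affine function in Goursat's argument. *)
Lemma circulation_near_affine G n z s s' A B K : (0 < n)%N ->
  (forall w, C (G w)) -> C A -> C B ->
  (forall w, normc (w - z) <= normc s + normc s' ->
    p (G w - (A + w *: B)) <= K) ->
  p (circulation G n z s s') <= 2 * (normc s + normc s') * K.
Proof.
move=> n0 CG CA CB GK.
have -> : G = fun w => (A + w *: B) + (G w - (A + w *: B)).
  by apply/funext => w; rewrite addrC subrK.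
rewrite circulationD circulation_affine// add0r; apply: circulation_le => // w.
apply: (sn_carrierB Cp) => //; apply: (sn_carrierD Cp) => //.
exact: (sn_carrierZ Cp).
Qed.
End goursat.

(** The increment form avoids division, hence includes w = z and combines directly with the triangle
    inequality. *)
Definition has_cderiv (R : realType) (V : lmodType R[i]) (p : V -> R)
    (F : R[i] -> V) (z : R[i]) (D : V) : Prop :=
  forall e : R, 0 < e -> exists2 d : R, 0 < d & forall w,
    normc (w - z) < d -> p (F w - F z - (w - z) *: D) <= e * normc (w - z).

Lemma nested_dyadic (R : realType) (x : nat -> R) :
  (forall m, x m <= x m.+1 /\ x m.+1 + 2^-1 ^+ m.+1 <= x m + 2^-1 ^+ m) ->
  exists l, forall m, x m <= l <= x m + 2^-1 ^+ m.
Proof.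
move=> hx.
have xi : {homo x : n m / (n <= m)%N >-> n <= m}.
  by apply/nondecreasing_seqP => m; have [] := hx m.
have xd : {homo (fun m => x m + 2^-1 ^+ m) : n m / (n <= m)%N >-> n >= m}.
  by apply/nonincreasing_seqP => m; have [] := hx m.
have xx m n : x m <= x n + 2^-1 ^+ n.
  case: (leqP m n) => [mn|/ltnW nm].
    by apply: le_trans (xi _ _ mn) _; rewrite lerDl exprn_ge0.
  by apply: le_trans (xd _ _ nm); rewrite lerDl exprn_ge0.
exists (sup (range x)) => m; apply/andP; split.
  apply: ub_le_sup; last by exists m.
  by exists (x m + 2^-1 ^+ m) => _ [n _ <-].
apply: ge_sup; first by exists (x 0); exists 0.
by move=> _ [n _ <-].
Qed.

Section goursat_theorem.
Variables (R : realType) (V : lmodType R[i]).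
Variables (C : V -> Prop) (p : V -> R).
Hypothesis Cp : seminormed C p.

(** If the claim failed, bisection would give a nested sequence of cells on which the bound e / 4^m
    also fails. Near their common point G is affine up to a small multiple of the cell diameter, and
    [circulation_near_affine] gives that bound for every number of nodes, a contradiction. *)
Theorem goursat (G : R[i] -> V) z s s' :
  (forall w, C (G w)) ->
  (forall x y : R, 0 <= x <= 1 -> 0 <= y <= 1 ->
    exists2 D, C D & has_cderiv p G (z + s * x%:C + s' * y%:C) D) ->
  forall e : R, 0 < e -> exists k0, forall k, (k0 <= k)%N ->
    p (circulation G (2 ^ k) z s s') <= e.
Proof.
move=> CG dG e e0.
pose L := normc s + normc s'.
have L0 : 0 <= L by rewrite addr_ge0 ?normc_ge0.
(* Cells are indexed by the coordinates of their corner in the unit square; a cell of level m has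
   sides s / 2^m and s' / 2^m. *)
pose pt (xy : R * R) := z + s * xy.1%:C + s' * xy.2%:C.
pose circ k m xy := circulation G (2 ^ k) (pt xy) (s / 2 ^+ m) (s' / 2 ^+ m).
(* Smallness is required for all large k only; the threshold may depend on the cell, since at most
   four cells are combined at a time. *)
pose small m xy := exists k0, forall k, (k0 <= k)%N ->
  p (circ k m xy) <= e * 4^-1 ^+ m.
pose child m (xy : R * R) (ab : bool * bool) : R * R :=
  (xy.1 + ab.1%:R * 2^-1 ^+ m.+1, xy.2 + ab.2%:R * 2^-1 ^+ m.+1).
have Ccirc k m xy : C (circ k m xy) by exact: (circulation_carrier Cp).
have small_step m xy : (forall ab, small m.+1 (child m xy ab)) -> small m xy.
  move=> sm.
  have [k1 h1] := sm (false, false); have [k2 h2] := sm (true, false).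
  have [k3 h3] := sm (false, true); have [k4 h4] := sm (true, true).
  (* The successor pays for the bisection: 2^(k+1) nodes per side of the parent are 2^k nodes per
     side of each child. *)
  exists (k1 + k2 + k3 + k4).+1 => -[//|k]; rewrite ltnS => hk.
  have {}h1 : _ <= _ := h1 k ltac:(lia); have {}h2 : _ <= _ := h2 k ltac:(lia).
  have {}h3 : _ <= _ := h3 k ltac:(lia); have {}h4 : _ <= _ := h4 k ltac:(lia).
  have -> : circ k.+1 m xy = circ k m.+1 (child m xy (false, false)) +
      circ k m.+1 (child m xy (true, false)) +
      (circ k m.+1 (child m xy (false, true)) +
       circ k m.+1 (child m xy (true, true))).
    rewrite /circ expnS mul2n -addnn circulation_double.
    have t0 n : 2 ^+ n != 0 :> R[i] by rewrite expf_neq0// pnatr_eq0.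
    have sE (u : R[i]) : u / 2 ^+ m / 2 = u / 2 ^+ m.+1.
      by rewrite -mulrA -invfM exprSr.
    rewrite !sE.
    have cE (u : R[i]) (x : R) : u * (x + 2^-1 ^+ m.+1)%:C = u * x%:C + u / 2 ^+ m.+1.
      by rewrite rmorphD mulrDr /= rmorphXn fmorphV rmorph_nat exprVn.
    rewrite /child /pt /= !mul0r !addr0 !mul1r !cE.
    by congr (circulation _ _ _ _ _ + _ + (_ + _)); congr circulation; ring.
  have -> : e * 4^-1 ^+ m = 4 * (e * 4^-1 ^+ m.+1).
    by rewrite exprS; field.
  have := snD Cp (sn_carrierD Cp (Ccirc k m.+1 (child m xy (false, false)))
      (Ccirc k m.+1 (child m xy (true, false))))
    (sn_carrierD Cp (Ccirc k m.+1 (child m xy (false, true)))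
      (Ccirc k m.+1 (child m xy (true, true)))).
  have := snD Cp (Ccirc k m.+1 (child m xy (false, false)))
      (Ccirc k m.+1 (child m xy (true, false))).
  have := snD Cp (Ccirc k m.+1 (child m xy (false, true)))
      (Ccirc k m.+1 (child m xy (true, true))).
  lra.
apply: contrapT => nsmall.
have nsmall0 : ~ small 0%N (0, 0).
  move=> [k0 hk0]; apply: nsmall; exists k0 => k /hk0.
  by rewrite /circ /pt /= !mulr0 !addr0 !expr0 !divr1 mulr1.
have [next nextP] : {f : nat * (R * R) -> bool * bool &
    forall q, ~ small q.1 q.2 -> ~ small q.1.+1 (child q.1 q.2 (f q))}.
  apply: (@choice _ _ (fun q ab => ~ small q.1 q.2 -> ~ small q.1.+1 (child q.1 q.2 ab))).
  move=> [m xy] /=; have [sm|nsm] := pselect (small m xy).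
    by exists (true, true).
  have [ab ?] : exists ab, ~ small m.+1 (child m xy ab).
    by apply/existsNP => h; apply: nsm; exact: small_step.
  by exists ab.
pose u := fix u m := if m is m'.+1 then child m' (u m') (next (m', u m'))
                     else (0, 0).
have nu m : ~ small m (u m).
  by elim: m => [//|m ih]; exact: (nextP (m, u m)).
have bstep (b : bool) (x : R) m : x <= x + b%:R * 2^-1 ^+ m.+1 /\
    x + b%:R * 2^-1 ^+ m.+1 + 2^-1 ^+ m.+1 <= x + 2^-1 ^+ m.
  have h0 : 0 <= 2^-1 ^+ m :> R by rewrite exprn_ge0.
  by rewrite exprS; case: b; rewrite ?mul1r ?mul0r; split; lra.
have [x xP] : exists l, forall m, (u m).1 <= l <= (u m).1 + 2^-1 ^+ m.
  by apply: nested_dyadic => m; exact: bstep.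
have [y yP] : exists l, forall m, (u m).2 <= l <= (u m).2 + 2^-1 ^+ m.
  by apply: nested_dyadic => m; exact: bstep.
have [D CD hD] : exists2 D, C D & has_cderiv p G (z + s * x%:C + s' * y%:C) D.
  by apply: dG; [have := xP 0%N|have := yP 0%N]; rewrite /= add0r expr0.
set c := z + _ + _ in hD.
(* The points that matter for a cell of level m lie within 2 L / 2^m of [c], and its perimeter is at
   most 2 L / 2^m. With slope e1 the circulation is at most 4 L^2 e1 / 4^m, which this e1 makes at
   most e / 4^m; the 1 covers L = 0. *)
have [|d d0 dP] := hD (e / (4 * (L ^+ 2 + 1))).
  by rewrite divr_gt0// mulr_gt0// ltr_pwDr// sqr_ge0.
have [m md] : exists m, 2 * L * 2^-1 ^+ m < d.
  have [m hm] : exists m, (2 * L + 1) / d < m%:R.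
    by exists (Num.bound ((2 * L + 1) / d)); apply: archi_boundP; rewrite divr_ge0 ?ltW//; lra.
  exists m; rewrite exprVn ltr_pdivrMr ?exprn_gt0//.
  have h2 : m%:R <= 2 ^+ m :> R by rewrite -natrX ler_nat ltnW// ltn_expl.
  have : d * m%:R <= d * 2 ^+ m by rewrite ler_pM2l.
  by move: hm; rewrite ltr_pdivrMr//; lra.
apply: (nu m); exists 0%N => k _; rewrite /circ.
have nm (v : R[i]) : normc (v / 2 ^+ m) = normc v * 2^-1 ^+ m.
  by rewrite normcM normcV -natrX normc_nat natrX exprVn.
pose K := e / (4 * (L ^+ 2 + 1)) * (2 * L * 2^-1 ^+ m).
apply: (@le_trans _ _ (2 * (normc (s / 2 ^+ m) + normc (s' / 2 ^+ m)) * K)).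
  apply: (circulation_near_affine (A := G c - c *: D) (B := D) Cp) => //.
  - by rewrite expn_gt0.
  - by apply: (sn_carrierB Cp) => //; exact: (sn_carrierZ Cp).
  move=> w; rewrite !nm -mulrDl -/L => wL.
  have wc : normc (w - c) <= 2 * L * 2^-1 ^+ m.
    apply: le_trans (normcBD _ _ (pt (u m))) _.
    have -> : pt (u m) - c = s * ((u m).1 - x)%:C + s' * ((u m).2 - y)%:C.
      by rewrite /pt /c !rmorphB; ring.
    have := normcD (s * ((u m).1 - x)%:C) (s' * ((u m).2 - y)%:C).
    have hb (v : R[i]) (a b : R) : a <= b <= a + 2^-1 ^+ m ->
        normc (v * (a - b)%:C) <= normc v * 2^-1 ^+ m.
      move=> /andP[ab ba]; rewrite normcM normc_real ler_wpM2l ?normc_ge0//.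
      by rewrite ler0_norm; lra.
    have := hb s _ _ (xP m); have := hb s' _ _ (yP m).
    rewrite /L in wL *; lra.
  rewrite (_ : G w - _ = G w - G c - (w - c) *: D); last first.
    rewrite scalerBl opprD opprB !opprD opprK !addrA [RHS]addrAC.
    by congr (_ - _); rewrite addrAC.
  apply: le_trans (dP _ (le_lt_trans wc md)) _.
  by rewrite ler_wpM2l// divr_ge0 ?ltW// mulr_gt0// ltr_pwDr// sqr_ge0.
rewrite !nm -mulrDl -/L /K.
have -> : 4^-1 ^+ m = 2^-1 ^+ m * 2^-1 ^+ m :> R.
  by rewrite -exprMn; congr (_ ^+ m); field.
rewrite (_ : 2 * _ * _ = e * (2^-1 ^+ m * 2^-1 ^+ m) * (L ^+ 2 / (L ^+ 2 + 1))); last first.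
  by field; rewrite gt_eqF// ltr_pwDr// sqr_ge0.
rewrite ler_piMr// ?mulr_ge0 ?exprn_ge0 ?(ltW e0)//.
by rewrite ler_pdivrMr ?mul1r ?lerDl// ltr_pwDr// sqr_ge0.
Qed.

End goursat_theorem.

(** * The complex exponential *)

Section complex_exponential.
Variable R : realType.
Implicit Types (z w : R[i]).

Definition cexp z : R[i] :=
  (expR (complex.Re z) * cos (complex.Im z)) +i* (expR (complex.Re z) * sin (complex.Im z)).

Lemma cexpD z w : cexp (z + w) = cexp z * cexp w.
Proof.
case: z w => a b [c d]; rewrite /cexp /= expRD cosD sinD.
by apply/eqP; rewrite eq_complex /=; apply/andP; split; apply/eqP; ring.
Qed.

Lemma normc_cexp z : normc (cexp z) = expR (complex.Re z).
Proof.
rewrite /cexp /= !exprMn -mulrDr cos2Dsin2 mulr1 sqrtr_sqr ger0_norm// expR_ge0.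
Qed.

Lemma cexp_pi : cexp (0 +i* pi) = -1.
Proof.
by apply/eqP; rewrite /cexp eq_complex /= expR0 cospi sinpi mulr0 mul1r oppr0 !eqxx.
Qed.

Lemma cexp_periodic z : cexp (z + (0 +i* (2 * pi))) = cexp z.
Proof.
rewrite (_ : 0 +i* (2 * pi) = (0 +i* pi) + (0 +i* pi)).
  by rewrite !cexpD cexp_pi mulrNN mulr1 mulr1.
by apply/eqP; rewrite eq_complex /= addr0 mulr_natl mulr2n !eqxx.
Qed.

Lemma is_derive_near (f : R -> R) (x d : R) : is_derive x 1 f d ->
  forall e, 0 < e -> exists2 dl : R, 0 < dl & forall h, `|h| < dl ->
    `|f (x + h) - f x - h * d| <= e * `|h|.
Proof.
move=> [fx fd] e e0.
have : h^-1 *: (f (h *: 1 + x) - f x) @[h --> 0^'] --> d.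
  by rewrite -fd; exact: fx.
move/cvgrPdist_le => /(_ _ e0); rewrite near_withinE => /nbhs_ballP[dl /= dl0 H].
exists dl => // h hdl; have [->|h0] := eqVneq h 0.
  by rewrite addr0 subrr mul0r subr0 normr0 mulr0.
have := H h; rewrite -ball_normE /= sub0r normrN => /(_ hdl h0).
rewrite [X in X -> _]/= /GRing.scale /= mulr1 (addrC h) => He.
have -> : f (x + h) - f x - h * d = - (h * (d - h^-1 * (f (x + h) - f x))).
  by field.
by rewrite normrN normrM mulrC ler_wpM2r.
Qed.

Definition has_scalar_cderiv (g : R[i] -> R[i]) z (d : R[i]) : Prop :=
  forall e : R, 0 < e -> exists2 dl : R, 0 < dl & forall w,
    normc (w - z) < dl -> normc (g w - g z - (w - z) * d) <= e * normc (w - z).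

Lemma has_scalar_cderiv_lipschitz g z d : has_scalar_cderiv g z d ->
  exists2 dl : R, 0 < dl & forall w, normc (w - z) < dl ->
    normc (g w - g z) <= (normc d + 1) * normc (w - z).
Proof.
move=> /(_ 1 ltr01)[dl dl0 hd]; exists dl => // w /hd {}hd.
have := normcD (g w - g z - (w - z) * d) ((w - z) * d); rewrite subrK normcM.
lra.
Qed.

Lemma cexp0_near (e : R) : 0 < e -> exists2 d : R, 0 < d & forall h,
  normc h < d -> normc (cexp h - 1 - h) <= e * normc h.
Proof.
(* With N the modulus of h, the four error terms below are at most n N, 3 n N, 3 n N and 2 n N, in
   all 9 n N; n <= 1 gives the bound 3 for [expR x]. *)
move=> e0; have [n [n0 n1 ne]] : exists n, [/\ 0 < n, n <= 1 & n <= e / 20].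
  by exists (Num.min 1 (e / 20)); rewrite lt_min ltr01/= !ge_min !lexx orbT divr_gt0.
have [d1 d10 h1] := is_derive_near (is_derive_expR (0 : R)) n0.
have [d2 d20 h2] := is_derive_near (is_derive_cos (0 : R)) n0.
have [d3 d30 h3] := is_derive_near (is_derive_sin (0 : R)) n0.
exists (Num.min (Num.min d1 d2) (Num.min d3 n)); first by rewrite !lt_min d10 d20 d30 n0.
move=> [x y] hd; move: (hd); rewrite !lt_min => /andP[/andP[hd1 hd2] /andP[hd3 hdn]].
set N := normc _ in hd hd1 hd2 hd3 hdn *.
have xN : `|x| <= N := normRe_le (x +i* y).
have yN : `|y| <= N := normIm_le (x +i* y).
have {h1} := h1 x (le_lt_trans xN hd1); have {h2} := h2 y (le_lt_trans yN hd2).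
have {h3} := h3 y (le_lt_trans yN hd3).
rewrite !add0r expR0 cos0 sin0 oppr0 mulr0 !mulr1 !addr0 subr0 => h3 h2 h1.
apply: le_trans (normc_le_ReIm _) _; rewrite /cexp /=.
have N0 : 0 <= N := normc_ge0 _.
have ex1 : `|expR x - 1| <= 2 * N.
  have := ler_normD (expR x - 1 - x) x; rewrite subrK => /le_trans; apply.
  have : n * `|x| <= 1 * `|x| by rewrite ler_wpM2r.
  lra.
have ex : `|expR x| <= 3.
  have := ler_normD (expR x - 1) 1; rewrite subrK normr1 => /le_trans; apply.
  lra.
have nN : 0 <= n * N by rewrite mulr_ge0// ltW.
have nx : n * `|x| <= n * N by rewrite ler_wpM2l// ltW.
have ny : n * `|y| <= n * N by rewrite ler_wpM2l// ltW.
have A1 : `|expR x * (cos y - 1)| <= 3 * (n * N).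
  by rewrite normrM ler_pM//; lra.
have A2 : `|expR x * (sin y - y)| <= 3 * (n * N).
  by rewrite normrM ler_pM//; lra.
have A3 : `|(expR x - 1) * y| <= 2 * N * n.
  by rewrite normrM ler_pM//; lra.
have -> : expR x * cos y - 1 - x = (expR x - 1 - x) + expR x * (cos y - 1) by ring.
rewrite oppr0 addr0.
have -> : expR x * sin y - y = expR x * (sin y - y) + (expR x - 1) * y by ring.
have := ler_normD (expR x - 1 - x) (expR x * (cos y - 1)).
have := ler_normD (expR x * (sin y - y)) ((expR x - 1) * y).
have : n * N <= e / 20 * N by rewrite ler_wpM2r.
lra.
Qed.

(** The functional equation carries the expansion at 0 to every point. *)
Lemma has_scalar_cderiv_cexp z : has_scalar_cderiv cexp z (cexp z).
Proof.
move=> e e0; have [|d d0 hd] := @cexp0_near (e / normc (cexp z)).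
  by rewrite divr_gt0// normc_cexp expR_gt0.
exists d => // w /hd {}hd.
rewrite (_ : _ - _ = cexp z * (cexp (w - z) - 1 - (w - z))); last first.
  have -> : cexp w = cexp z * cexp (w - z) by rewrite -cexpD addrC subrK.
  by ring.
rewrite normcM; apply: le_trans (ler_wpM2l (normc_ge0 _) hd) _.
by rewrite mulrA (mulrC _ (e / _)) divfK// normc_cexp gt_eqF// expR_gt0.
Qed.

End complex_exponential.

(** * Rules of complex differentiation *)

Section complex_derivation_rules.
Variables (R : realType) (V : lmodType R[i]).
Variables (C : V -> Prop) (p : V -> R).
Hypothesis Cp : seminormed C p.
Implicit Types (F : R[i] -> V) (z w : R[i]).

Lemma has_cderiv_near_eq F F' z D (r : R) : 0 < r ->
  (forall w, normc (w - z) < r -> F w = F' w) ->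
  has_cderiv p F z D -> has_cderiv p F' z D.
Proof.
move=> r0 FF' hF e /hF[d d0 hd]; exists (Num.min d r).
  by rewrite lt_min d0.
move=> w; rewrite lt_min => /andP[wd wr].
rewrite -(FF' w)// -(FF' z); first exact: hd.
by rewrite subrr normc0.
Qed.

Lemma has_cderiv_lipschitz F z D : (forall w, C (F w)) -> C D ->
  has_cderiv p F z D -> exists2 d : R, 0 < d & forall w,
    normc (w - z) < d -> p (F w - F z) <= (p D + 1) * normc (w - z).
Proof.
move=> CF CD /(_ 1 ltr01)[d d0 hd]; exists d => // w /hd {}hd.
have CB : C (F w - F z) by exact: (sn_carrierB Cp).
have CZ : C ((w - z) *: D) by exact: (sn_carrierZ Cp).
have := sn_leB Cp CB CZ; rewrite (snZ Cp)//.
set a := p (F w - F z); set b := p (_ - _) in hd *; lra.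
Qed.

Lemma has_cderiv_comp F (g : R[i] -> R[i]) z D d : (forall w, C (F w)) -> C D ->
  has_cderiv p F (g z) D -> has_scalar_cderiv g z d ->
  has_cderiv p (fun w => F (g w)) z (d *: D).
Proof.
move=> CF CD hF hg e e0.
have pD0 := sn_ge0 Cp CD; have nd0 := normc_ge0 d.
pose e1 := e / (2 * (normc d + 1)).
pose e2 := Num.min 1 (e / (2 * (p D + 1))).
have e10 : 0 < e1 by rewrite divr_gt0// mulr_gt0//; lra.
have e20 : 0 < e2 by rewrite lt_min ltr01/= divr_gt0// mulr_gt0//; lra.
have [d1 d10 h1] := hF _ e10; have [d2 d20 h2] := hg _ e20.
have [d3 d30 h3] := has_scalar_cderiv_lipschitz hg.
exists (Num.min (Num.min d2 d3) (d1 / (normc d + 1))).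
  by rewrite !lt_min d20 d30 divr_gt0//; lra.
move=> w; rewrite !lt_min => /andP[/andP[/h2 wd2 /h3 gN]].
rewrite ltr_pdivlMr; last lra.
set N := normc (w - z) in wd2 gN * => wd1.
have N0 : 0 <= N := normc_ge0 _.
have gd1 : normc (g w - g z) < d1 by apply: le_lt_trans gN _; rewrite mulrC.
have {}h1 := h1 _ gd1.
rewrite (_ : _ - _ = (F (g w) - F (g z) - (g w - g z) *: D) +
   (g w - g z - (w - z) *: d) *: D); last first.
  by rewrite [X in _ = _ + X]scalerBl addrA subrK scalerA.
apply: le_trans (snD Cp _ _) _.
- by apply: (sn_carrierB Cp); [exact: (sn_carrierB Cp)|exact: (sn_carrierZ Cp)].
- exact: (sn_carrierZ Cp).
rewrite (snZ Cp)//.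
have : e1 * normc (g w - g z) <= e / 2 * N.
  apply: (@le_trans _ _ (e1 * ((normc d + 1) * N))); first by rewrite ler_wpM2l// ltW.
  rewrite mulrA ler_wpM2r// /e1 invfM mulrA divfK//; lra.
have : normc (g w - g z - (w - z) *: d) * p D <= e / 2 * N.
  apply: (@le_trans _ _ (e2 * N * p D)); first by rewrite ler_wpM2r.
  rewrite mulrAC ler_wpM2r//.
  apply: (@le_trans _ _ (e / (2 * (p D + 1)) * p D)).
    by rewrite ler_wpM2r// ge_min lexx orbT.
  rewrite invfM mulrA -mulrA ler_piMr//; first lra.
  by rewrite mulrC ler_pdivrMr; lra.
lra.
Qed.

Lemma has_cderivZ F (g : R[i] -> R[i]) z D d : (forall w, C (F w)) -> C D ->
  has_cderiv p F z D -> has_scalar_cderiv g z d ->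
  has_cderiv p (fun w => g w *: F w) z (g z *: D + d *: F z).
Proof.
move=> CF CD hF hg e e0.
have pD0 := sn_ge0 Cp CD; have nd0 := normc_ge0 d; have ng0 := normc_ge0 (g z).
have pF0 := sn_ge0 Cp (CF z).
(* Each of the three error terms of the product rule receives e / 3; the added 1 allows a factor to
   vanish. *)
have quo (x : R) : 0 <= x -> 0 < e / (3 * (x + 1)) /\ e / (3 * (x + 1)) * (x + 1) = e / 3.
  move=> x0; split; first by rewrite divr_gt0// mulr_gt0//; lra.
  by rewrite invfM mulrA divfK//; lra.
have [e10 e1E] := quo _ ng0; have [e20 e2E] := quo _ pF0; have [e30 e3E] := quo _ pD0.
set e1 := e / _ in e10 e1E; set e2 := e / _ in e20 e2E; set e3 := e / _ in e30 e3E.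
have [d1 d10 h1] := hF _ e10; have [d2 d20 h2] := hg _ e20.
have [d3 d30 h3] := has_scalar_cderiv_lipschitz hg.
have [m [m0 m1 me]] : exists m, [/\ 0 < m, m <= 1 & m <= e3].
  by exists (Num.min 1 e3); rewrite lt_min ltr01/= !ge_min !lexx orbT.
exists (Num.min (Num.min d1 d2) (Num.min d3 (m / (normc d + 1)))).
  by rewrite !lt_min d10 d20 d30 divr_gt0//; lra.
move=> w; rewrite !lt_min => /andP[/andP[/h1 {}h1 /h2 {}h2] /andP[/h3 {}h3]].
rewrite ltr_pdivlMr; last lra.
set N := normc (w - z) in h1 h2 h3 * => wm.
have N0 : 0 <= N := normc_ge0 _.
have {h3}gm : normc (g w - g z) <= m by lra.
have gw : normc (g w) <= normc (g z) + 1.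
  have := normcD (g w - g z) (g z); rewrite subrK; lra.
rewrite (_ : _ - _ = g w *: (F w - F z - (w - z) *: D) +
   ((g w - g z) * (w - z)) *: D + (g w - g z - (w - z) * d) *: F z); last first.
  rewrite scalerDr !scalerBr !scalerA opprD -!(@scaleNr _ V) addrACA -scalerDl.
  rewrite [RHS](AC 5 (1*(3*4)*(2*5)))/= -!scalerDl.
  by congr (_ + _ *: _ + _ *: _); ring.
have C1 : C (g w *: (F w - F z - (w - z) *: D)).
  apply: (sn_carrierZ Cp); apply: (sn_carrierB Cp); first exact: (sn_carrierB Cp).
  exact: (sn_carrierZ Cp).
have C2 : C (((g w - g z) * (w - z)) *: D) by exact: (sn_carrierZ Cp).
have C3 : C ((g w - g z - (w - z) * d) *: F z) by exact: (sn_carrierZ Cp).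
apply: le_trans (snD Cp (sn_carrierD Cp C1 C2) C3) _.
have := snD Cp C1 C2; rewrite !(snZ Cp)//; last first.
  by apply: (sn_carrierB Cp); [exact: (sn_carrierB Cp)|exact: (sn_carrierZ Cp)].
rewrite normcM -/N.
have T1 : normc (g w) * p (F w - F z - (w - z) *: D) <= e / 3 * N.
  rewrite -e1E mulrAC mulrC.
  apply: ler_pM => //; last exact: normc_ge0.
  by apply: (sn_ge0 Cp); apply: (sn_carrierB Cp); [exact: (sn_carrierB Cp)|exact: (sn_carrierZ Cp)].
have T2 : normc (g w - g z) * N * p D <= e / 3 * N.
  rewrite mulrAC ler_wpM2r// -e3E; apply: ler_pM; rewrite ?normc_ge0//; lra.
have T3 : normc (g w - g z - (w - z) * d) * p (F z) <= e / 3 * N.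
  rewrite -e2E mulrAC; apply: ler_pM; rewrite ?normc_ge0//; lra.
lra.
Qed.

Lemma has_cderivD F G z D D' : (forall w, C (F w)) -> (forall w, C (G w)) ->
  C D -> C D' -> has_cderiv p F z D -> has_cderiv p G z D' ->
  has_cderiv p (fun w => F w + G w) z (D + D').
Proof.
move=> CF CG CD CD' hF hG e e0; have e20 : 0 < e / 2 by rewrite divr_gt0.
have [d1 d10 h1] := hF _ e20; have [d2 d20 h2] := hG _ e20.
exists (Num.min d1 d2); first by rewrite lt_min d10.
move=> w; rewrite lt_min => /andP[/h1 {}h1 /h2 {}h2].
have CB H E : (forall w, C (H w)) -> C E -> C (H w - H z - (w - z) *: E).
  move=> CH CE; apply: (sn_carrierB Cp); first exact: (sn_carrierB Cp).
  exact: (sn_carrierZ Cp).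
rewrite scalerDr !opprD [_ + _ in X in X <= _](AC (2*2*2) ((1*3*5)*(2*4*6)))/=.
apply: le_trans (snD Cp (CB _ _ CF CD) (CB _ _ CG CD')) _.
by set N := normc _ in h1 h2 *; lra.
Qed.

(** Reciprocals of affine functions furnish every nonconstant multiplier below: 1 / (1 + eps z) on
    the strip, 1 / (w - z) in difference quotients, and (1 + theta) / (1 + z) for the continuity of
    translations. *)
Lemma has_scalar_cderivV (a b z : R[i]) : a * z + b != 0 ->
  has_scalar_cderiv (fun w => (a * w + b)^-1) z (- (a / (a * z + b) ^+ 2)).
Proof.
set v := a * z + b => v0 e e0.
have nv0 : 0 < normc v by rewrite normc_gt0.
have na0 := normc_ge0 a.
(* The error equals (u - v)^2 / (u v^2) with u - v = a (w - z), and the first radius below ensures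
   that u has modulus at least half that of v. *)
pose k := 2 * normc a ^+ 2 / normc v ^+ 3.
have k0 : 0 <= k by rewrite divr_ge0 ?mulr_ge0 ?exprn_ge0 ?normc_ge0.
exists (Num.min (normc v / (2 * (normc a + 1))) (e / (k + 1))).
  by rewrite lt_min !divr_gt0// ?mulr_gt0//; lra.
move=> w; rewrite lt_min ltr_pdivlMr; last by rewrite mulr_gt0//; lra.
rewrite ltr_pdivlMr; last lra.
set N := normc (w - z) => /andP[wv wk].
have N0 : 0 <= N := normc_ge0 _.
rewrite -/v; set u := a * w + b.
have uv : u - v = a * (w - z) by rewrite /u /v; ring.
have nuv : normc (u - v) = normc a * N by rewrite uv normcM.
have u2 : normc v / 2 <= normc u.
  by have := normcD (v - u) u; rewrite subrK normcB nuv; lra.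
have nu0 : 0 < normc u by lra.
have u0 : u != 0 by rewrite -normc_gt0.
rewrite (_ : _ - _ = (u - v) ^+ 2 / (u * v ^+ 2)); last first.
  have -> : (w - z) * - (a / v ^+ 2) = - ((u - v) / v ^+ 2) by rewrite uv; ring.
  by field; rewrite u0 v0.
rewrite expr2 !normcM normcV !normcM !nuv.
apply: (@le_trans _ _ (k * N * N)); last by rewrite ler_wpM2r//; nra.
rewrite ler_pdivrMr ?mulr_gt0//.
rewrite (_ : k * N * N * _ = (normc a * N) ^+ 2 * (2 * normc u / normc v)); last first.
  by rewrite /k; field; rewrite gt_eqF.
by rewrite -expr2 ler_peMr ?sqr_ge0// ler_pdivlMr//; lra.
Qed.

End complex_derivation_rules.

(** * Discrete mean values on circles *)

(** The nodes sit at odd multiples of pi / n, as the exponential images of the midpoint nodes on a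
    vertical segment of length 2 pi. *)
Definition circle_pt (R : realType) (n j : nat) : R[i] :=
  cexp (0 +i* (2 * pi * midpt R n j)).

Section mean_value.
Variables (R : realType) (V : lmodType R[i]).
Variables (C : V -> Prop) (p : V -> R).
Hypothesis Cp : seminormed C p.

(* Goursat's theorem for G(zeta) = F(z + exp zeta), on a rectangle of height
   2 pi: the horizontal sides cancel by periodicity, hence the mean of F over
   circles around z does not depend on the radius. *)
Lemma mean_value_le (F : R[i] -> V) (z : R[i]) (r rho : R) :
  (forall w, C (F w)) ->
  (forall w, 0 < normc (w - z) < r -> exists2 D, C D & has_cderiv p F w D) ->
  (forall e : R, 0 < e -> exists2 d : R, 0 < d & forall w,
     normc (w - z) < d -> p (F w - F z) <= e) ->
  0 < rho < r -> forall e : R, 0 < e -> exists k0, forall k, (k0 <= k)%N ->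
  p (F z) <=
    (2 ^ k)%:R^-1 * \sum_(j < 2 ^ k) p (F (z + rho%:C * circle_pt R (2 ^ k) j)) + e.
Proof.
move=> CF dF cF /andP[rho0 rhor] e e0.
have [d d0 hd] := cF (e / 2) ltac:(by rewrite divr_gt0).
(* The left side of the rectangle is mapped to a circle so small that F is within e / 2 of F z on
   it, the right side to the circle of radius rho. The minimum ensures a <= b, so all of the
   rectangle is mapped into the punctured disc of radius r. *)
pose a := ln (Num.min rho (d / 2)); pose b := ln rho.
have m0 : 0 < Num.min rho (d / 2) by rewrite lt_min rho0 divr_gt0.
have ad : expR a < d by rewrite lnK// gt_min; apply/orP; right; lra.
pose G zt := F (z + cexp zt).
have CG zt : C (G zt) by exact: CF.
pose s : R[i] := (b - a)%:C; pose s' : R[i] := 0 +i* (2 * pi).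
have pi1 : 1 <= 2 * pi :> R by have := pi_ge2 R; lra.
have ns' : normc s' = 2 * pi by rewrite normc_Im ger0_norm//; lra.
have ab : a <= b by rewrite ler_ln// ge_min lexx.
have dG x y : 0 <= x <= 1 -> 0 <= y <= 1 ->
    exists2 D, C D & has_cderiv p G (a%:C + s * x%:C + s' * y%:C) D.
  move=> /andP[x0 x1] _; set zt := (_ + _ + _).
  have ztb : complex.Re zt <= b.
    by rewrite /zt /s /s' /= !(mulr0, mul0r, subr0, addr0); nra.
  have [|D CD hD] := dF (z + cexp zt).
    rewrite addrAC subrr add0r normc_cexp expR_gt0/=; apply: le_lt_trans rhor.
    by rewrite -(lnK rho0) ler_expR.
  have hz : has_scalar_cderiv (fun w => z + cexp w) zt (cexp zt).
    move=> e1 /(has_scalar_cderiv_cexp zt)[dl dl0 hdl]; exists dl => // w /hdl.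
    by rewrite (_ : z + cexp w - _ = cexp w - cexp zt)// opprD addrACA subrr add0r.
  exists (cexp zt *: D); first exact: (sn_carrierZ Cp).
  exact: (has_cderiv_comp (g := fun w => z + cexp w) Cp CF CD hD hz).
have [k0 hk0] := goursat Cp CG dG (e := e / 2) ltac:(by rewrite divr_gt0).
exists k0 => k /hk0; set n := (2 ^ k)%N.
have n0 : (0 < n)%N by rewrite expn_gt0.
have Gper zt : G (zt + s') = G zt by rewrite /G cexp_periodic.
have -> : circulation G n a%:C s s' = midsum G n b%:C s' - midsum G n a%:C s'.
  rewrite /circulation.
  have -> : midsum G n (a%:C + s') s = midsum G n a%:C s.
    by apply: eq_bigr => j _; rewrite addrAC Gper.
  have -> : a%:C + s = b%:C by rewrite /s -rmorphD /= addrC subrK.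
  by congr (_ - _); rewrite addrAC subrr add0r.
move=> hk.
have Cm zt u H : (forall w, C (H w)) -> C (midsum H n zt u).
  exact: (midsum_carrier Cp).
pose H zt := G zt - F z.
have CH zt : C (H zt) by exact: (sn_carrierB Cp).
have Ea : midsum G n a%:C s' = s' *: F z + midsum H n a%:C s'.
  have -> : s' *: F z = midsum (fun w => F z + w *: 0) n a%:C s'.
    by rewrite midsum_affine// scaler0 addr0.
  rewrite -midsumD; congr midsum; apply/funext => w.
  by rewrite /H scaler0 addr0 addrC subrK.
have hH : p (midsum H n a%:C s') <= 2 * pi * (e / 2).
  rewrite -ns'; apply: (midsum_le Cp) => // t _; apply: hd.
  rewrite addrAC subrr add0r normc_cexp /s' /= !(mulr0, mul0r, subr0, addr0).
  exact: ad.
have hb : p (midsum G n b%:C s') <= 2 * pi * (n%:R^-1 *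
    \sum_(j < n) p (F (z + rho%:C * circle_pt R n j))).
  apply: le_trans (sn_sum Cp _ _) _; first by move=> j _; exact: (sn_carrierZ Cp).
  rewrite !mulr_sumr; apply: ler_sum => j _; rewrite (snZ Cp)//.
  rewrite normcM ns' normcV normc_nat mulrA /G cexpD.
  rewrite (_ : cexp b%:C = rho%:C).
    rewrite (_ : s' * _ = 0 +i* (2 * pi * midpt R n j))//.
    by apply/eqP; rewrite eq_complex /=; apply/andP; split; apply/eqP; ring.
  by rewrite /cexp /= cos0 sin0 mulr0 mulr1 lnK.
have h1 : s' *: F z = midsum G n b%:C s' - (midsum G n b%:C s' - midsum G n a%:C s')
    - midsum H n a%:C s'.
  by rewrite opprB [X in _ = X - _]addrC subrK Ea addrK.
(* Goursat's theorem costs e / 2 and the small circle 2 pi e / 2; together this is at most 2 pi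
   e. *)
have : 2 * pi * p (F z) <= 2 * pi * (n%:R^-1 *
    \sum_(j < n) p (F (z + rho%:C * circle_pt R n j))) + e / 2 + 2 * pi * (e / 2).
  rewrite -{1}ns' -(snZ Cp)// h1.
  apply: le_trans (snB Cp _ (Cm _ _ _ CH)) _.
    by apply: (sn_carrierB Cp); [|apply: (sn_carrierB Cp)]; exact: Cm.
  apply: lerD => //; apply: le_trans (snB Cp (Cm _ _ _ CG) _) _.
    by apply: (sn_carrierB Cp); exact: Cm.
  exact: lerD.
set S := n%:R^-1 * _ => hS.
have : 2 * pi * p (F z) <= 2 * pi * (S + e).
  apply: le_trans hS _; nra.
by rewrite ler_pM2l//; lra.
Qed.

End mean_value.

Section circle_sums.
Variable R : realType.

Lemma circle_pt_antipodal m (j : nat) : (0 < m)%N ->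
  circle_pt R (m + m) (m + j) = - circle_pt R (m + m) j.
Proof.
move=> m0; have m0' : m%:R != 0 :> R by rewrite pnatr_eq0 -lt0n.
have mm0 : m%:R + m%:R != 0 :> R by rewrite -mulr2n mulrn_eq0.
rewrite /circle_pt -mulN1r -cexp_pi -cexpD; congr cexp.
apply/eqP; rewrite eq_complex /= addr0 eqxx /=; apply/eqP.
by rewrite /midpt !natrD; field.
Qed.

(** An even number of nodes cancels in antipodal pairs. *)
Lemma circle_pt_sum m : \sum_(j < m + m) circle_pt R (m + m) j = 0.
Proof.
have [->|m0] := posnP m; first by rewrite big_ord0.
rewrite big_split_ord /= -big_split /=; apply: big1 => j _.
by rewrite circle_pt_antipodal// subrr.
Qed.

Definition sqnormc (z : R[i]) : R := complex.Re z ^+ 2 + complex.Im z ^+ 2.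

(** The cross terms are linear in the nodes and sum to 0. The gain rho^2 over the value at the
    centre is the strict subharmonicity that the maximum principle exploits. *)
Lemma sqnormc_circle_sum m (z : R[i]) (rho : R) :
  \sum_(j < m + m) sqnormc (z + rho%:C * circle_pt R (m + m) j) =
  (m + m)%:R * (sqnormc z + rho ^+ 2).
Proof.
have ReD (x y : R[i]) : complex.Re (x + y) = complex.Re x + complex.Re y.
  by case: x => ? ?; case: y.
have ImD (x y : R[i]) : complex.Im (x + y) = complex.Im x + complex.Im y.
  by case: x => ? ?; case: y.
have s0 := circle_pt_sum m.
have re0 : \sum_(j < m + m) complex.Re (circle_pt R (m + m) j) = 0.
  by rewrite -(big_morph _ ReD (erefl : complex.Re (0 : R[i]) = 0)) s0.
have im0 : \sum_(j < m + m) complex.Im (circle_pt R (m + m) j) = 0.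
  by rewrite -(big_morph _ ImD (erefl : complex.Im (0 : R[i]) = 0)) s0.
transitivity (\sum_(j < m + m) (sqnormc z + rho ^+ 2 +
   (2 * rho * complex.Re z * complex.Re (circle_pt R (m + m) j) +
    2 * rho * complex.Im z * complex.Im (circle_pt R (m + m) j)))).
  apply: eq_bigr => j _; rewrite /sqnormc ReD ImD /circle_pt /cexp /= expR0.
  have := cos2Dsin2 (2 * pi * midpt R (m + m) j).
  set c := cos _; set s := sin _ => cs.
  rewrite (_ : rho ^+ 2 = rho ^+ 2 * (c ^+ 2 + s ^+ 2)); last by rewrite cs mulr1.
  by ring.
have lin : \sum_(j < m + m)
    (2 * rho * complex.Re z * complex.Re (circle_pt R (m + m) j) +
     2 * rho * complex.Im z * complex.Im (circle_pt R (m + m) j)) = 0.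
  transitivity (
    2 * rho * complex.Re z * (\sum_(j < m + m) complex.Re (circle_pt R (m + m) j)) +
    2 * rho * complex.Im z * (\sum_(j < m + m) complex.Im (circle_pt R (m + m) j))).
    by rewrite !mulr_sumr -big_split.
  by rewrite re0 im0 !mulr0 addr0.
transitivity (\sum_(j < m + m) (sqnormc z + rho ^+ 2) + 0).
  by rewrite big_split; congr (_ + _).
by rewrite addr0 sumr_const card_ord -[LHS]mulr_natl.
Qed.

End circle_sums.

(** * The maximum principle on rectangles *)

Section maximum_principle.
Variables (R : realType) (V : lmodType R[i]).
Variables (C : V -> Prop) (p : V -> R).
Hypothesis Cp : seminormed C p.
Variables (a b c d : R).

Definition rectangle : set R[i] :=
  [set z | a <= complex.Re z <= b /\ c <= complex.Im z <= d].

Definition open_rectangle : set R[i] :=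
  [set z | a < complex.Re z < b /\ c < complex.Im z < d].

(* At an interior maximum of p (F w) + eta |w|^2 the mean value inequality
   fails, since |w|^2 is strictly subharmonic. *)
Lemma perturbed_maximum (F : R[i] -> V) (M : R) (z0 : R[i]) :
  (forall w, C (F w)) ->
  (forall z, rectangle z -> forall e : R, 0 < e -> exists2 dl : R, 0 < dl &
    forall w, rectangle w -> normc (w - z) < dl -> p (F w - F z) <= e) ->
  (forall z, open_rectangle z -> z != z0 ->
    exists2 D, C D & has_cderiv p F z D) ->
  (forall z, rectangle z -> ~ open_rectangle z -> p (F z) <= M) ->
  forall eta : R, 0 < eta -> forall z, rectangle z ->
  exists2 z1, rectangle z1 & p (F z) + eta * sqnormc z <= M + eta * sqnormc z1.
Proof.
move=> CF cF dF bF eta eta0 z rz.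
pose v z := p (F z) + eta * sqnormc z.
pose K : set (R * R) := `[a, b]%classic `*` `[c, d]%classic.
have KP xy : K xy <-> rectangle (xy.1 +i* xy.2).
  by rewrite /K /rectangle /= !in_itv.
have [z1 rz1 vmax] : exists2 z1, rectangle z1 & forall w, rectangle w -> v w <= v z1.
  have [|||xy] := @compact_EVT_max _ R (fun xy : R * R => v (xy.1 +i* xy.2)) K.
  - by exists (complex.Re z, complex.Im z); apply/KP; case: (z) rz.
  - by apply: compact_setX; exact: segment_compact.
  - apply/subspace_continuousP => -[x y] Kxy; apply/cvgrPdist_le => e e0.
    have rxy : rectangle (x +i* y) by exact/(KP (x, y)).
    have [dl dl0 hdl] := cF _ rxy (e / 2) ltac:(by rewrite divr_gt0).
    have cq : (fun xy : R * R => eta * (xy.1 ^+ 2 + xy.2 ^+ 2)) @ (x, y) -->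
        eta * (x ^+ 2 + y ^+ 2).
      apply: cvgM; first exact: cvg_cst.
      by apply: cvgD; [apply: (cvgM cvg_fst cvg_fst)|apply: (cvgM cvg_snd cvg_snd)].
    move/cvgrPdist_le : cq => /(_ (e / 2) ltac:(by rewrite divr_gt0)) cq.
    have dl20 : 0 < dl / 2 by rewrite divr_gt0.
    have /cvgrPdist_lt/(_ _ dl20) cx : fst @ (x, y) --> x by exact: cvg_fst.
    have /cvgrPdist_lt/(_ _ dl20) cy : snd @ (x, y) --> y by exact: cvg_snd.
    rewrite near_withinE; near=> w => Kw.
    have rw : rectangle (w.1 +i* w.2) by exact/KP.
    change (is_true (`|(p (F (x +i* y)) + eta * (x ^+ 2 + y ^+ 2))
      - (p (F (w.1 +i* w.2)) + eta * (w.1 ^+ 2 + w.2 ^+ 2))| <= e)).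
    have h1 : `|eta * (x ^+ 2 + y ^+ 2) - eta * (w.1 ^+ 2 + w.2 ^+ 2)| <= e / 2.
      by near: w.
    have wd : normc ((w.1 +i* w.2) - (x +i* y)) < dl.
      apply: le_lt_trans (normc_le_ReIm _) _ => /=.
      have : `|x - w.1| < dl / 2 by near: w.
      have : `|y - w.2| < dl / 2 by near: w.
      by rewrite (distrC x) (distrC y); lra.
    have := hdl _ rw wd.
    have := sn_leB Cp (CF (w.1 +i* w.2)) (CF (x +i* y)).
    have := sn_leB Cp (CF (x +i* y)) (CF (w.1 +i* w.2)).
    rewrite (snBC Cp (CF (x +i* y)))//.
    move: h1; rewrite !ler_norml => /andP[h1 h2] h3 h4 h5.
    by apply/andP; split; lra.
  rewrite inE => /KP rxy xymax; exists (xy.1 +i* xy.2) => // -[x y] rw.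
  by apply: (xymax (x, y)); rewrite inE; apply/KP.
exists z1 => //; apply: le_trans (vmax _ rz) _; rewrite /v lerD2r.
have [|iz1] := pselect (open_rectangle z1); last exact: bF.
case: z1 rz1 vmax => x1 y1 rz1 vmax [/= /andP[ax xb] /andP[cy yd]].
exfalso; set z1 := x1 +i* y1 in rz1 vmax.
have [r [r0 rO rz0]] : exists r, [/\ 0 < r,
    forall w, normc (w - z1) < r -> open_rectangle w &
    forall w, 0 < normc (w - z1) < r -> w != z0].
  (* The disc must avoid [z0] except possibly at its centre: [mean_value_le] asks for
     differentiability in the punctured disc and for continuity at the centre, so z1 = z0 is
     allowed. *)
  pose r0 := if z0 == z1 then 1 else normc (z0 - z1).
  have r00 : 0 < r0.
    by rewrite /r0; case: eqVneq => // z01; rewrite normc_gt0 subr_eq0.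
  exists (Num.min r0 (Num.min (Num.min (x1 - a) (b - x1)) (Num.min (y1 - c) (d - y1)))).
  split.
  - by rewrite !lt_min r00 !subr_gt0 ax xb cy yd.
  - move=> [x y] wz; have xw := normRe_le ((x +i* y) - z1).
    have yw := normIm_le ((x +i* y) - z1).
    move: wz xw yw; set N := normc _; rewrite !lt_min => /andP[_ /andP[/andP[w1 w2] /andP[w3 w4]]].
    rewrite /= !ler_norml => /andP[x2 x3] /andP[y2 y3].
    by split => /=; apply/andP; split; lra.
  - move=> w /andP[w0]; rewrite lt_min => /andP[wr _].
    apply/eqP => wz0; move: wr; rewrite /r0 wz0; case: eqVneq => [e|_].
      by move: w0; rewrite wz0 e subrr normc0 ltxx.
    by rewrite ltxx.
have Orect w : open_rectangle w -> rectangle w.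
  by move=> [/andP[? ?] /andP[? ?]]; split; apply/andP; split; exact: ltW.
pose rho := r / 2.
have rho0 : 0 < rho by rewrite divr_gt0.
have rhor : rho < r by rewrite /rho; lra.
have dFz w : 0 < normc (w - z1) < r -> exists2 D, C D & has_cderiv p F w D.
  by move=> wr; apply: dF; [apply: rO; case/andP: wr|exact: rz0].
have cFz e : 0 < e -> exists2 dl : R, 0 < dl &
    forall w, normc (w - z1) < dl -> p (F w - F z1) <= e.
  move=> /(cF _ rz1)[dl dl0 hdl]; exists (Num.min dl r); first by rewrite lt_min dl0.
  by move=> w; rewrite lt_min => /andP[wd wr]; apply: hdl => //; exact/Orect/rO.
have e0 : 0 < eta * rho ^+ 2 / 2 by rewrite divr_gt0// mulr_gt0// exprn_gt0.
have rho0r : 0 < rho < r by rewrite rho0.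
(* Taking k0 + 1 makes the number of nodes even. Maximality of [v] at z1 bounds the mean by p (F z1)
   - eta rho^2, and the slack eta rho^2 / 2 cannot make up for the loss. *)
have [k0 /(_ k0.+1 (leqnSn _))] := mean_value_le Cp CF dFz cFz rho0r e0.
set n := (2 ^ k0.+1)%N; set S := \sum_(_ < _) _.
have n0 : 0 < n%:R :> R by rewrite ltr0n expn_gt0.
have nE : n = (2 ^ k0 + 2 ^ k0)%N by rewrite /n expnS mul2n addnn.
have hS : S <= n%:R * (p (F z1) - eta * rho ^+ 2).
  apply: (@le_trans _ _ (\sum_(j < n) (v z1 -
      eta * sqnormc (z1 + rho%:C * circle_pt R n j)))).
    apply: ler_sum => j _; rewrite lerBrDr; apply: vmax; apply/Orect/rO.
    rewrite addrAC subrr add0r normcM normc_real gtr0_norm//.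
    by rewrite /circle_pt normc_cexp expR0 mulr1.
  rewrite sumrB sumr_const card_ord -mulr_sumr nE sqnormc_circle_sum -nE.
  rewrite -(mulr_natl (v z1)) /v; lra.
have : n%:R^-1 * S <= p (F z1) - eta * rho ^+ 2 by rewrite mulrC ler_pdivrMr// mulrC.
have : 0 < eta * rho ^+ 2 by rewrite mulr_gt0// exprn_gt0.
lra.
Unshelve. all: by end_near. Qed.

(** Let eta tend to 0 in [perturbed_maximum], the squared modulus being bounded on the rectangle.
    The exceptional point [z0] is there for difference quotients, which are known to be merely
    continuous at their base point. *)
Theorem maximum_principle (F : R[i] -> V) (M : R) (z0 : R[i]) :
  (forall w, C (F w)) ->
  (forall z, rectangle z -> forall e : R, 0 < e -> exists2 dl : R, 0 < dl &
    forall w, rectangle w -> normc (w - z) < dl -> p (F w - F z) <= e) ->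
  (forall z, open_rectangle z -> z != z0 ->
    exists2 D, C D & has_cderiv p F z D) ->
  (forall z, rectangle z -> ~ open_rectangle z -> p (F z) <= M) ->
  forall z, rectangle z -> p (F z) <= M.
Proof.
move=> CF cF dF bF z rz; apply/ler_addgt0Pr => e e0.
pose B := (`|a| + `|b|) ^+ 2 + (`|c| + `|d|) ^+ 2.
have B0 : 0 <= B by rewrite addr_ge0 ?sqr_ge0.
have eta0 : 0 < e / (B + 1) by rewrite divr_gt0//; lra.
have [z1 rz1 hz1] := perturbed_maximum CF cF dF bF eta0 rz.
have sq (x y t : R) : x <= t <= y -> t ^+ 2 <= (`|x| + `|y|) ^+ 2.
  move=> /andP[xt ty]; rewrite -(real_normK (num_real t)) ler_sqr ?nnegrE ?addr_ge0//.
  rewrite ler_norml; have := ler_norm (- x); have := ler_norm y.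
  by have := normr_ge0 x; have := normr_ge0 y; rewrite normrN; move=> *; apply/andP; split; lra.
have q1 : sqnormc z1 <= B by case: rz1 => /sq ? /sq ?; exact: lerD.
have q0 : 0 <= e / (B + 1) * sqnormc z by rewrite mulr_ge0 ?(ltW eta0)// addr_ge0 ?sqr_ge0.
have : e / (B + 1) * sqnormc z1 <= e.
  rewrite mulrAC ler_pdivrMr; last lra.
  by rewrite ler_pM2l//; lra.
lra.
Qed.

End maximum_principle.

(** * Maximum principle on the strip and Cauchy's estimate *)

Section strip_and_cauchy_estimates.
Variables (R : realType) (V : lmodType R[i]).
Variables (C : V -> Prop) (p : V -> R).
Hypothesis Cp : seminormed C p.

Lemma sn_scaleB (k l : R[i]) (f g : V) : C f -> C g ->
  p (k *: f - l *: g) <= normc k * p (f - g) + normc (k - l) * p g.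
Proof.
move=> Cf Cg.
have -> : k *: f - l *: g = k *: (f - g) + (k - l) *: g.
  by rewrite scalerBr scalerBl addrA subrK.
have CB : C (f - g) by exact: (sn_carrierB Cp).
apply: le_trans (snD Cp _ _) _; [exact: (sn_carrierZ Cp)..|].
by rewrite !(snZ Cp).
Qed.

(* The maximum principle is applied to F(z) / (1 + eps z), which tends to 0 at
   the ends of the strip. *)
Theorem strip_maximum_principle (F : R[i] -> V) (M B : R) :
  (forall w, C (F w)) ->
  (forall z, strip z -> forall e : R, 0 < e -> exists2 dl : R, 0 < dl &
    forall w, strip w -> normc (w - z) < dl -> p (F w - F z) <= e) ->
  (forall z, open_strip z -> exists2 D, C D & has_cderiv p F z D) ->
  (forall z, strip z -> p (F z) <= B) ->
  (forall t : R, p (F (0 +i* t)) <= M) ->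
  (forall t : R, p (F (1 +i* t)) <= M) ->
  forall z, strip z -> p (F z) <= M.
Proof.
move=> CF cF dF BF M0 M1 z sz; apply/ler_addgt0Pr => dlt dlt0.
have M_ge0 : 0 <= M by apply: (le_trans _ (M0 0)); exact: (sn_ge0 Cp).
have nz0 := normc_ge0 z.
(* M may be 0, while M' can be divided by. The choice of [eps] gives eps (|z| + 1) M' = dlt / 2, so
   removing the damping factor at z costs at most another dlt / 2. *)
pose M' := M + dlt / 2; have M'0 : 0 < M' by rewrite /M'; lra.
pose eps := dlt / (2 * (normc z + 1) * M').
have eps0 : 0 < eps by rewrite divr_gt0// !mulr_gt0//; lra.
have B0 : 0 <= B by apply: (le_trans _ (BF _ sz)); exact: (sn_ge0 Cp).
(* High enough for z to lie in the rectangle, and for B <= M' eps T, which bounds the damped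
   function by M' on the horizontal sides. *)
pose T := `|complex.Im z| + B / (eps * M') + 1.
have q0 : 0 <= B / (eps * M') by rewrite divr_ge0// mulr_ge0// ltW.
have T0 : 0 < T by rewrite /T; have := normr_ge0 (complex.Im z); lra.
pose g (w : R[i]) := (eps%:C * w + 1)^-1.
pose G w := g w *: F w.
have CG w : C (G w) by exact: (sn_carrierZ Cp).
have ge1 w : strip w -> 1 <= normc (eps%:C * w + 1).
  move=> /andP[w0 w1]; apply: (le_trans _ (normRe_le _)).
  have -> : complex.Re (eps%:C * w + 1) = eps * complex.Re w + 1.
    by case: (w) => x y /=; rewrite mul0r subr0.
  have h : 0 <= eps * complex.Re w by rewrite mulr_ge0// ltW.
  by rewrite ger0_norm; lra.
have gne0 w : strip w -> eps%:C * w + 1 != 0.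
  by move=> /ge1 w1; rewrite -normc_gt0; lra.
have g1 w : strip w -> normc (g w) <= 1.
  by move=> /ge1 w1; rewrite normcV invf_le1//; lra.
have GF w : strip w -> p (G w) <= p (F w).
  by move=> /g1 w1; rewrite (snZ Cp)// ler_piMl// (sn_ge0 Cp).
have rs w : rectangle 0 1 (- T) T w -> strip w by case.
have or w : open_rectangle 0 1 (- T) T w -> open_strip w by case.
have so (w : R[i]) : open_strip w -> strip w.
  by move=> /andP[? ?]; apply/andP; split; exact: ltW.
have GM : p (G z) <= M'.
  (* The point -1 lies outside the rectangle: there is no exceptional point here. *)
  apply: (maximum_principle (a := 0) (b := 1) (c := - T) (d := T) Cp (z0 := - 1) CG).
  - move=> w /rs sw e e0.
    have pw0 := sn_ge0 Cp (CF w).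
    have [d1 d10 h1] := cF _ sw (e / 2) ltac:(by rewrite divr_gt0).
    have [d2 d20 h2] := has_scalar_cderiv_lipschitz (has_scalar_cderivV (gne0 _ sw)).
    set L := normc _ + 1 in h2; have L0 : 0 < L by rewrite /L ltr_wpDl// normc_ge0.
    exists (Num.min (Num.min d1 d2) (e / (2 * L * (p (F w) + 1)))).
      by rewrite !lt_min d10 d20 divr_gt0// !mulr_gt0//; lra.
    move=> u /rs su; rewrite !lt_min => /andP[/andP[/h1 {}h1 /h2 {}h2] h3].
    have {}h1 := h1 su.
    apply: le_trans (sn_scaleB _ _ (CF u) (CF w)) _.
    have : normc (g u) * p (F u - F w) <= 1 * (e / 2).
      apply: ler_pM => //; [exact: normc_ge0| |exact: g1].
      by apply: (sn_ge0 Cp); exact: (sn_carrierB Cp).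
    have : normc (g u - g w) * p (F w) <= e / 2.
      apply: (@le_trans _ _ (L * normc (u - w) * (p (F w) + 1))).
        by apply: ler_pM => //; [exact: normc_ge0|lra].
      move: h3; rewrite ltr_pdivlMr; last by rewrite !mulr_gt0//; lra.
      lra.
    lra.
  - move=> w /or ow _; have [D CD hD] := dF _ ow.
    have hg := has_scalar_cderivV (gne0 _ (so _ ow)).
    exists (g w *: D + - (eps%:C / (eps%:C * w + 1) ^+ 2) *: F w); last first.
      exact: (has_cderivZ Cp CF CD hD hg).
    by apply: (sn_carrierD Cp); exact: (sn_carrierZ Cp).
  - move=> [x y] rw; have sw := rs _ rw; case: rw => /= /andP[x0 x1] /andP[y0 y1] orw.
    have [->|xn0] := eqVneq x 0.
      apply: le_trans (GF _ _) _; first by rewrite /strip /= lexx ler01.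
      by apply: le_trans (M0 _) _; rewrite /M'; lra.
    have [->|xn1] := eqVneq x 1.
      apply: le_trans (GF _ _) _; first by rewrite /strip /= lexx ler01.
      by apply: le_trans (M1 _) _; rewrite /M'; lra.
    have yT : `|y| = T.
      apply/eqP; rewrite eq_le ler_norml y0 y1 /= leNgt; apply/negP.
      rewrite ltr_norml => /andP[y2 y3]; apply: orw; split => /=.
        by rewrite !lt_neqAle eq_sym xn0 x0 xn1.
      by rewrite y2.
    rewrite (snZ Cp)// normcV mulrC ler_pdivrMr; last by apply: lt_le_trans (ge1 _ sw).
    apply: le_trans (BF _ sw) _.
    have h : eps * T <= normc (eps%:C * (x +i* y) + 1).
      apply: (le_trans _ (normIm_le _)) => /=.
      by rewrite mul0r addr0 addr0 normrM yT gtr0_norm.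
    apply: (@le_trans _ _ (M' * (eps * T))); last by rewrite ler_pM2l.
    have : eps * M' * (B / (eps * M')) = B by rewrite mulrC divfK// gt_eqF// mulr_gt0.
    have : 0 <= eps * M' * (`|complex.Im z| + 1).
      by apply: mulr_ge0; [rewrite mulr_ge0 ?ltW|rewrite addr_ge0].
    by rewrite /T; lra.
  - split => //; rewrite -ler_norml /T; lra.
move: GM; rewrite (snZ Cp)// normcV mulrC ler_pdivrMr; last first.
  by apply: lt_le_trans (ge1 _ sz).
move=> /le_trans; apply.
apply: (@le_trans _ _ (M' * (eps * normc z + 1))).
  rewrite ler_pM2l//; apply: le_trans (normcD _ _) _.
  by rewrite normcM normc_real normc1 gtr0_norm.
have : eps * (normc z + 1) * M' = dlt / 2.
  by rewrite /eps; field; rewrite !gt_eqF//; lra.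
have : 0 <= eps * M' by rewrite mulr_ge0 ?ltW.
rewrite /M'; lra.
Qed.

(** The difference quotient, completed by D at z, obeys the maximum principle on the square of
    half-side r with z as exceptional point. On the boundary the numerator is at most 2 B and the
    denominator at least r. The value at z bounds the derivative, the other values bound the
    increments. *)
Theorem difference_quotient_le (F : R[i] -> V) (z : R[i]) (D : V) (r B : R) :
  (forall w, C (F w)) -> 0 < r -> C D -> has_cderiv p F z D ->
  (forall w, `|complex.Re (w - z)| <= r -> `|complex.Im (w - z)| <= r ->
    p (F w) <= B /\ exists2 D, C D & has_cderiv p F w D) ->
  p D <= 2 * B / r /\
  forall w, normc (w - z) < r -> p (F w - F z) <= 2 * B / r * normc (w - z).
Proof.
move=> CF r0 CD hD hF.
(* Written as the reciprocal of a w + b to match [has_scalar_cderivV]. *)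
pose g (w : R[i]) := (1 * w + - z)^-1.
have gE w : g w = (w - z)^-1 by rewrite /g mul1r.
pose G w := if w == z then D else g w *: (F w - F z).
have CB w : C (F w - F z) by exact: (sn_carrierB Cp).
have CG w : C (G w) by rewrite /G; case: ifP => // _; exact: (sn_carrierZ Cp).
have [Bz _] : p (F z) <= B /\ exists2 D, C D & has_cderiv p F z D.
  by apply: hF; rewrite subrr /= normr0 ltW.
have B0 : 0 <= B by apply: (le_trans _ Bz); exact: (sn_ge0 Cp).
pose a := complex.Re z - r; pose b := complex.Re z + r.
pose c := complex.Im z - r; pose d := complex.Im z + r.
have rP w : rectangle a b c d w <-> `|complex.Re (w - z)| <= r /\ `|complex.Im (w - z)| <= r.
  rewrite /rectangle /a /b /c /d /=; case: (w) (z) => x y [x' y'] /=.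
  by rewrite !ler_distl.
have oP w : `|complex.Re (w - z)| < r -> `|complex.Im (w - z)| < r ->
    open_rectangle a b c d w.
  rewrite /open_rectangle /a /b /c /d /=; case: (w) (z) => x y [x' y'] /=.
  by rewrite !ltr_distl.
have nr w : normc (w - z) < r -> rectangle a b c d w.
  by move=> wr; apply/rP; split; apply: le_trans (ltW wr); [exact: normRe_le|exact: normIm_le].
have dG w : rectangle a b c d w -> w != z -> exists2 D, C D & has_cderiv p G w D.
  move=> /rP[w1 w2] wz; have [_ [E CE hE]] := hF w w1 w2.
  have wz0 : 1 * w + - z != 0 by rewrite mul1r subr_eq0.
  have hg := has_scalar_cderivV wz0.
  have hE' : has_cderiv p (fun u => F u - F z) w E.
    move=> e /hE[dl dl0 hdl]; exists dl => // u /hdl.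
    by rewrite (_ : F u - F z - _ = F u - F w)// opprB addrA subrK.
  exists (g w *: E + - (1 / (1 * w + - z) ^+ 2) *: (F w - F z)).
    by apply: (sn_carrierD Cp); exact: (sn_carrierZ Cp).
  apply: (has_cderiv_near_eq (r := normc (w - z)) _ _ (has_cderivZ Cp CB CE hE' hg)).
    by rewrite normc_gt0 subr_eq0.
  move=> u uw; rewrite /G; case: eqVneq => // uz.
  by move: uw; rewrite uz normcB ltxx.
have cG w : rectangle a b c d w -> forall e : R, 0 < e -> exists2 dl : R, 0 < dl &
    forall u, rectangle a b c d u -> normc (u - w) < dl -> p (G u - G w) <= e.
  move=> rw e e0; have [->|wz] := eqVneq w z.
    have [dl dl0 hdl] := hD _ e0; exists dl => // u _ /hdl ud.
    rewrite /G eqxx; case: eqVneq => [_|uz]; first by rewrite subrr (sn0 Cp) ltW.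
    have uz0 : 0 < normc (u - z) by rewrite normc_gt0 subr_eq0.
    rewrite -(ler_pM2l uz0) -(snZ Cp); last first.
      by apply: (sn_carrierB Cp) => //; exact: (sn_carrierZ Cp).
    by rewrite scalerBr scalerA gE divff ?subr_eq0// scale1r mulrC.
  have [E CE hE] := dG _ rw wz.
  have [dl dl0 hdl] := has_cderiv_lipschitz Cp CG CE hE.
  have pE0 := sn_ge0 Cp CE.
  exists (Num.min dl (e / (p E + 1))); first by rewrite lt_min dl0 divr_gt0//; lra.
  move=> u _; rewrite lt_min => /andP[/hdl ud]; rewrite ltr_pdivlMr; last lra.
  by rewrite mulrC => /ltW; exact: le_trans.
have bG w : rectangle a b c d w -> ~ open_rectangle a b c d w -> p (G w) <= 2 * B / r.
  move=> rw orw; have [w1 w2] := (rP _).1 rw; have [Bw _] := hF _ w1 w2.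
  have wr : r <= normc (w - z).
    rewrite leNgt; apply/negP => wr; apply: orw.
    by apply: oP; [exact: le_lt_trans (normRe_le _) wr|exact: le_lt_trans (normIm_le _) wr].
  have wz : w != z by rewrite -subr_eq0 -normc_gt0; exact: lt_le_trans wr.
  rewrite /G (negbTE wz) (snZ Cp)// gE normcV mulrC.
  apply: ler_pM.
  - exact: (sn_ge0 Cp).
  - by rewrite invr_ge0 normc_ge0.
  - by apply: le_trans (snB Cp (CF _) (CF _)) _; lra.
  - by rewrite lef_pV2 ?posrE//; exact: lt_le_trans wr.
have MG w : rectangle a b c d w -> p (G w) <= 2 * B / r.
  apply: (maximum_principle Cp CG cG _ bG (z0 := z)) => u [/andP[? ?] /andP[? ?]].
  by apply: dG; split; apply/andP; split; exact: ltW.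
have := MG z; rewrite {1}/G eqxx => MD; split.
  by apply: MD; apply: nr; rewrite subrr normc0.
move=> w wr; have [->|wz] := eqVneq w z; first by rewrite !subrr (sn0 Cp) normc0 mulr0.
have := MG w (nr _ wr); rewrite /G (negbTE wz) (snZ Cp)// gE normcV mulrC ler_pdivrMr//.
by rewrite normc_gt0 subr_eq0.
Qed.

End strip_and_cauchy_estimates.

(** * The norm of L^1(T) and the K-functional *)

Section L1_norm.
Variable R : realType.
Local Notation mu := (@lebesgue_measure R).
Local Notation period := (`[- pi, pi]%classic : set R).
Implicit Types f g : L1T R.

Lemma L1T_ind (P : L1T R -> Prop) :
  (forall f : L1fun R, P (L1class f)) -> forall f, P f.
Proof. by move=> Pf f; rewrite -[f]L1classK. Qed.

Lemma translateD a f g : translate a (f + g) = translate a f + translate a g.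
Proof.
elim/L1T_ind: f => f; elim/L1T_ind: g => g.
rewrite -L1T_piD !translate_pi -L1T_piD; congr L1class.
exact/val_inj.
Qed.

Lemma translateZ a (c : R[i]) f : translate a (c *: f) = c *: translate a f.
Proof.
elim/L1T_ind: f => f; rewrite -[c *: L1class f]L1T_piZ !translate_pi.
by rewrite -[RHS]L1T_piZ; congr L1class; exact/val_inj.
Qed.

Lemma translateN a f : translate a (- f) = - translate a f.
Proof. by rewrite -scaleN1r translateZ scaleN1r. Qed.

Lemma translateB a f g : translate a (f - g) = translate a f - translate a g.
Proof. by rewrite translateD translateN. Qed.

Lemma integrable_normc (f : L1fun R) :
  mu.-integrable period (EFin \o (fun s => normc (f s))).
Proof.
have mp : measurable (period : set (measurableTypeR R)) by [].
have mf := measurable_normc f; case: f mf => f /= /L1_periodicP[_ rf jf] mf.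
apply: (@le_integrable _ _ _ mu _ mp _ (fun s => `|(complex.Re (f s))%:E| + `|(complex.Im (f s))%:E|)%E).
- exact/measurable_EFinP.
- move=> s _ /=; rewrite lee_fin ger0_norm ?normc_ge0// ger0_norm ?addr_ge0//.
  exact: normc_le_ReIm.
- by apply: integrableD => //; exact: integrable_abse.
Qed.

Lemma L1T_norm_seminormed : seminormed (fun _ : L1T R => True) L1T_norm.
Proof.
have mp : measurable (period : set (measurableTypeR R)) by [].
split=> //.
- move=> f g _ _; elim/L1T_ind: f => f; elim/L1T_ind: g => g.
  rewrite -L1T_piD !L1T_norm_pi -mulrDr -RintegralD//; [|exact: integrable_normc..].
  rewrite ler_pM2l ?invr_gt0 ?mulr_gt0 ?pi_gt0//; apply: le_Rintegral => //.
  + exact: integrable_normc.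
  + apply: (@eq_integrable _ _ _ mu _ mp ((EFin \o (fun s => normc (f s))) \+
      (EFin \o (fun s => normc (g s))))%E) => //.
    by apply: integrableD => //; exact: integrable_normc.
  + by move=> s _; exact: normcD.
- move=> c f _; elim/L1T_ind: f => f.
  rewrite -[c *: L1class f]L1T_piZ !L1T_norm_pi [RHS]mulrCA -[X in _ = _ * X]RintegralZl//; last exact: integrable_normc.
  by congr (_ * _); apply: eq_Rintegral => s _; rewrite L1valZ normcM.
Qed.

(** The integral sees one period, whereas equality in [L1T] is almost everywhere on the whole line;
    periodicity bridges the gap by countably many translates of the exceptional null set. *)
Lemma L1T_norm_eq0 f : L1T_norm f = 0 -> f = 0.
Proof.
have mp : measurable (period : set (measurableTypeR R)) by [].
elim/L1T_ind: f => f; rewrite L1T_norm_pi => /eqP.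
rewrite mulf_eq0 invr_eq0 mulf_eq0 pnatr_eq0 /= gt_eqF ?pi_gt0//= => /eqP i0.
have ei0 : (\int[mu]_(s in period) `|(normc (f s))%:E| = 0)%E.
  have := integrable_normc f => /integrable_fin_num fi.
  transitivity (\int[mu]_(s in period) (normc (f s))%:E)%E.
    by apply: eq_integral => s _ /=; rewrite ger0_norm ?normc_ge0.
  by rewrite -[LHS]fineK ?fi// [fine _](i0).
have mf : measurable_fun (period : set (measurableTypeR R)) (EFin \o (fun s => normc (f s))).
  by apply/measurable_EFinP; exact: measurable_normc.
have [/(_ ei0) h _] := ae_eq_integral_abs mu mp mf.
have fper (n : nat) x : f (x + n%:R * (2 * pi)) = f x.
  have /L1_periodicP[pf _ _] := valP f.
  elim: n => [|n ih]; first by rewrite mul0r addr0.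
  by rewrite -natr1 mulrDl mul1r addrA -[LHS]/(val f _) pf.
have f0 : {ae mu, forall x, period x -> f x = 0}.
  apply: (@filterS _ _ (ae_filter_ringOfSetsType mu) _ _ _ h) => x + px.
  by move=> /(_ px)[/eq0_normc].
have shift0 (s : R) : {ae mu, forall x n, period (x + s * (n%:R * (2 * pi))) ->
    f (x + s * (n%:R * (2 * pi))) = 0}.
  apply: ae_foralln => n.
  exact: (@ae_shift _ (fun x => period x -> f x = 0) (s * (n%:R * (2 * pi))) f0).
have <- : L1class 0 = 0 :> L1T R.
  by apply: (addrI (L1class 0)); rewrite -L1T_piD !addr0.
apply/eqP/L1T_eqP.
apply: (@filterS2 _ _ (ae_filter_ringOfSetsType mu) _ _ _ _ (shift0 1) (shift0 (-1))).
move=> x xp xm; transitivity (0 : R[i]); last by [].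
(* The index of the period of x: x - 2 pi k lies in [-pi, pi). The sign of k decides which of the
   two families of translates applies. *)
pose k := Num.floor ((x + pi) / (2 * pi)).
have pi0 : 0 < 2 * pi :> R by rewrite mulr_gt0 ?pi_gt0.
have /andP[] := floor_itv ((x + pi) / (2 * pi)).
rewrite -/k intrD ler_pdivlMr// ltr_pdivrMr// mulrDl mul1r => kx xk.
have [n [kn|kn]] : exists n : nat, k = n%:Z \/ k = - n%:Z.
  by exists `|k|%N; case: (intP k) => [|n|n]; [left|left|right].
- rewrite -[x](subrK (n%:R * (2 * pi))) fper -mulN1r; apply: xm => /=.
  by rewrite kn -pmulrn in kx xk; rewrite in_itv/= mulN1r; apply/andP; split; lra.
- rewrite -(fper n) -[n%:R * _]mul1r; apply: xp => /=.
  by rewrite kn mulrNz -pmulrn in kx xk; rewrite in_itv/= mul1r; apply/andP; split; lra.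
Qed.

End L1_norm.

(** * Completeness through geometric series *)

Section geometric_series.
Variables (R : realType) (V : lmodType R[i]).
Variables (C : V -> Prop) (p : V -> R).
Hypothesis Cp : seminormed C p.

(** Equivalent to completeness by the two lemmas at the end of this section. The remainder 2 K 2^-n
    is the sum of the bounds K 2^-k over k >= n. *)
Definition geometric_complete : Prop :=
  forall (a : nat -> V) (K : R), 0 < K -> (forall k, C (a k)) ->
    (forall k, p (a k) <= K * 2^-1 ^+ k) ->
  exists2 s, C s & forall n, p (s - \sum_(k < n) a k) <= 2 * K * 2^-1 ^+ n.

Lemma cvg0_nonneg (T : Type) (F : set_system T) {FF : Filter F} (h : T -> R) :
  (\forall x \near F, 0 <= h x) ->
  (h x @[x --> F] --> 0) <-> (forall e : R, 0 < e -> \forall x \near F, h x <= e).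
Proof.
move=> h0; split=> [/cvgr0Pnorm_le H e /H|H].
  by apply: filterS2 h0 => x x0; rewrite ger0_norm.
apply/cvgr0Pnorm_le => e /H.
by apply: filterS2 h0 => x x0; rewrite ger0_norm.
Qed.

(** The subtracted remainder makes the induction on m close, since K 2^-k = 2 K 2^-k - 2 K
    2^-(k+1). *)
Lemma geometric_tail (a : nat -> V) (K : R) n m : (forall k, C (a k)) ->
  (forall k, p (a k) <= K * 2^-1 ^+ k) ->
  p (\sum_(k < n + m) a k - \sum_(k < n) a k) <=
    2 * K * 2^-1 ^+ n - 2 * K * 2^-1 ^+ (n + m).
Proof.
move=> Ca pa; elim: m => [|m ih]; first by rewrite addn0 !subrr (sn0 Cp).
have CS k : C (\sum_(k < k) a k) by exact: (sn_carrier_sum Cp).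
rewrite addnS big_ord_recr /= addrAC.
apply: le_trans (snD Cp (sn_carrierB Cp (CS _) (CS _)) (Ca _)) _.
have := pa (n + m)%N; rewrite exprS; lra.
Qed.

Lemma half_expr_lt (e : R) : 0 < e -> exists n, 2^-1 ^+ n < e.
Proof.
move=> e0; have [n hn] : exists n : nat, e^-1 < n%:R.
  by exists (Num.bound e^-1); apply: archi_boundP; rewrite invr_ge0 ltW.
exists n; rewrite exprVn invf_plt ?posrE ?exprn_gt0//.
by apply: (lt_le_trans hn); rewrite -natrX ler_nat ltnW// ltn_expl.
Qed.

Lemma half_expr_le m n : (m <= n)%N -> 2^-1 ^+ n <= 2^-1 ^+ m :> R.
Proof. by move=> mn; rewrite ler_wiXn2l//; lra. Qed.

(** Any constant K' in the remainder improves to 2 K: compare with a partial sum far out, whose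
    distance to s is negligible, and bound the rest by [geometric_tail]. Near-optimal choices may
    thus waste constant factors. *)
Lemma geometric_completeI :
  (forall (a : nat -> V) (K : R), 0 < K -> (forall k, C (a k)) ->
    (forall k, p (a k) <= K * 2^-1 ^+ k) ->
    exists2 s, C s & exists K' : R,
      forall n, p (s - \sum_(k < n) a k) <= K' * 2^-1 ^+ n) ->
  geometric_complete.
Proof.
move=> H a K K0 Ca pa; have [s Cs [K' hs]] := H a K K0 Ca pa.
have CS k : C (\sum_(k < k) a k) by exact: (sn_carrier_sum Cp).
have K'0 : 0 <= K'.
  by have := hs 0%N; rewrite expr0 mulr1; apply: le_trans; apply: (sn_ge0 Cp); exact: (sn_carrierB Cp).
exists s => // n; apply/ler_addgt0Pr => e e0.
have [|m hm] := @half_expr_lt (e / (K' + 1)); first by rewrite divr_gt0//; lra.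
have := snBD Cp Cs (CS (n + m)%N) (CS n).
have := hs (n + m)%N; have := geometric_tail n m Ca pa.
have : K' * 2^-1 ^+ (n + m) <= e.
  apply: (@le_trans _ _ ((K' + 1) * 2^-1 ^+ m)).
    by apply: ler_pM => //; [lra|exact/half_expr_le/leq_addl].
  by rewrite mulrC -ler_pdivlMr ?ltW//; lra.
have : 0 <= 2 * K * 2^-1 ^+ (n + m) by rewrite !mulr_ge0 ?exprn_ge0 ?ltW.
lra.
Qed.

Lemma cauchy_geometric_complete :
  (forall u : nat -> V, (forall n, C (u n)) ->
    (forall e : R, 0 < e -> \forall m & n \near \oo, p (u m - u n) < e) ->
    exists2 f, C f & p (u n - f) @[n --> \oo] --> (0 : R)) ->
  geometric_complete.
Proof.
move=> cplt a K K0 Ca pa.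
pose S n := \sum_(k < n) a k.
have CS k : C (S k) by exact: (sn_carrier_sum Cp).
have h0 n : 0 <= 2 * K * 2^-1 ^+ n by rewrite !mulr_ge0 ?exprn_ge0 ?ltW.
have tail m n : (n <= m)%N -> p (S m - S n) <= 2 * K * 2^-1 ^+ n.
  move=> /subnKC <-; apply: le_trans (geometric_tail _ _ Ca pa) _.
  by rewrite lerBlDr lerDl.
have [|s Cs hs] := cplt S CS.
  move=> e e0; have [N hN] := half_expr_lt (divr_gt0 e0 (mulr_gt0 (@ltr0n R 2) K0)).
  have N0 : nbhs \oo (fun n => (N <= n)%N) by exists N.
  exists ([set n | (N <= n)%N], [set n | (N <= n)%N]) => //= -[m n] [/= Nm Nn].
  have eN : 2 * K * 2^-1 ^+ N < e.
    by move: hN; rewrite ltr_pdivlMr ?mulr_gt0// mulrC.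
  have key k l : (N <= k)%N -> (k <= l)%N -> p (S l - S k) < e.
    move=> Nk kl; apply: le_lt_trans (tail _ _ kl) _; apply: le_lt_trans eN.
    by rewrite ler_wpM2l ?half_expr_le// mulr_ge0 ?ltW.
  by case: (leqP n m) => [|/ltnW] mn; [|rewrite (snBC Cp)//]; exact: key.
exists s => // n; apply/ler_addgt0Pr => e e0.
have pos : \forall n \near \oo, 0 <= p (S n - s).
  by apply: nearW => k; apply: (sn_ge0 Cp); exact: (sn_carrierB Cp).
have [N _ hN] := (cvg0_nonneg pos).1 hs e e0.
have := snBD Cp Cs (CS (maxn N n)) (CS n).
have := hN _ (leq_maxl N n); have := tail _ _ (leq_maxr N n).
rewrite (snBC Cp (CS _) Cs) -/(S n); lra.
Qed.

(** A subsequence with increments at most 2^-k telescopes to a geometric series; the Cauchy property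
    carries its limit over to the whole sequence. *)
Lemma geometric_complete_cauchy : geometric_complete ->
  forall u : nat -> V, (forall n, C (u n)) ->
    (forall e : R, 0 < e -> \forall m & n \near \oo, p (u m - u n) < e) ->
    exists2 f, C f & p (u n - f) @[n --> \oo] --> (0 : R).
Proof.
move=> gc u Cu hu.
have {hu}hu k : exists N, forall m n, (N <= m)%N -> (N <= n)%N ->
    p (u m - u n) <= 2^-1 ^+ k.
  have [|[A B] /= [[N1 _ h1] [N2 _ h2]] AB] := hu (2^-1 ^+ k); first by rewrite exprn_gt0.
  exists (maxn N1 N2) => m n; rewrite !geq_max => /andP[m1 _] /andP[_ n2].
  by apply: ltW; apply: (AB (m, n)); split => /=; [exact: h1|exact: h2].
have [phi hphi] := choice hu.
(* Running maximum of the thresholds, so that N k and N (k + 1) are both beyond [phi k]. *)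
pose N := fix N k := if k is k'.+1 then maxn (phi k) (N k') else phi 0%N.
have phiN k : (phi k <= N k)%N by case: k => //= k; rewrite leq_maxl.
have NS k : (phi k <= N k.+1)%N by rewrite (leq_trans (phiN k))//= leq_maxr.
have CB m n : C (u m - u n) by exact: (sn_carrierB Cp).
have [||s Cs hs] := gc (fun k => u (N k.+1) - u (N k)) 1 ltr01.
- by move=> k; exact: CB.
- by move=> k; rewrite mul1r; exact: hphi.
have tele n : \sum_(k < n) (u (N k.+1) - u (N k)) = u (N n) - u (N 0%N).
  elim: n => [|n ih]; first by rewrite big_ord0 subrr.
  by rewrite big_ord_recr /= ih addrC subrKA.
have Cf : C (s + u (N 0%N)) by exact: (sn_carrierD Cp).
exists (s + u (N 0%N)) => //.
apply/cvg0_nonneg; first by apply: nearW => k; apply: (sn_ge0 Cp); exact: (sn_carrierB Cp).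
(* The Cauchy property contributes 2^-n and the remainder of the series 2 * 2^-n. *)
move=> e e0; have [n hn] := half_expr_lt (divr_gt0 e0 (@ltr0n R 3)).
exists (phi n) => // m /= nm.
have := snBD Cp (Cu m) (Cu (N n)) Cf.
have := hphi _ _ _ nm (phiN n).
have := hs n; rewrite tele opprB addrA -(snBC Cp _ Cf)// mulr1.
move: hn; rewrite ltr_pdivlMr//; lra.
Qed.

End geometric_series.

Section subspaces_of_L1.
Variable R : realType.
Implicit Types (X : nspace R) (f g : L1T R).

Lemma banach_seminormed X : banach_subspace X -> seminormed X (nrm X).
Proof. by case. Qed.

Lemma banach_geometric X : banach_subspace X -> geometric_complete X (nrm X).
Proof.
move=> bX; apply: (cauchy_geometric_complete (banach_seminormed bX)).
exact: nrm_complete.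
Qed.

Lemma translateK a f : translate (- a) (translate a f) = f.
Proof.
elim/L1T_ind: f => f; rewrite !translate_pi; congr L1class.
by apply/val_inj/funext => x /=; rewrite subrK.
Qed.

(** Limits of one sequence in two different norms agree because both norms dominate the L^1 norm,
    which is definite. *)
Lemma L1_limit_unique X (Y : nspace R) (u : nat -> L1T R) f g :
  seminormed X (nrm X) -> seminormed Y (nrm Y) ->
  (forall h, X h -> L1T_norm h <= nrm X h) ->
  (forall h, Y h -> L1T_norm h <= nrm Y h) ->
  (forall e : R, 0 < e -> exists n, [/\ X (u n - f), Y (u n - g),
     nrm X (u n - f) <= e & nrm Y (u n - g) <= e]) -> f = g.
Proof.
move=> sX sY LX LY H; apply/eqP; rewrite -subr_eq0; apply/eqP.
have L := L1T_norm_seminormed R.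
apply: L1T_norm_eq0; apply/eqP; rewrite eq_le (sn_ge0 L)// andbT.
apply/ler_addgt0Pr => e e0; rewrite add0r.
have [|n [Xn Yn Hf Hg]] := H (e / 2); first by rewrite divr_gt0.
have -> : f - g = (u n - g) - (u n - f) by rewrite opprB [RHS]addrC subrKA.
have := snB L (f := u n - g) (g := u n - f) I I.
by have := LX _ Xn; have := LY _ Yn; lra.
Qed.

End subspaces_of_L1.

(** * The K-functional and the space X_0 + X_1 *)

Section K_functional.
Variables (R : realType) (X0 X1 : nspace R).
Hypotheses (h0 : homogeneous X0) (h1 : homogeneous X1).
Implicit Types (f g : L1T R) (t : R).

Let s0 := banach_seminormed (homogeneous_banach h0).
Let s1 := banach_seminormed (homogeneous_banach h1).
Local Notation K := (Kfunctional X0 X1).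
Local Notation Xsum := (sum_space X0 X1).

Lemma K_le t f0 f1 : 0 <= t -> X0 f0 -> X1 f1 ->
  K t (f0 + f1) <= nrm X0 f0 + t * nrm X1 f1.
Proof.
move=> t0 X0f X1f; apply: ge_inf; last by exists f0, f1.
exists 0 => _ [g0 [g1 [Xg0 Xg1 _ ->]]].
by rewrite addr_ge0 ?mulr_ge0 ?(sn_ge0 s0) ?(sn_ge0 s1).
Qed.

Lemma K_adherent t f e : 0 <= t -> 0 < e -> Xsum f ->
  exists f0 f1, [/\ X0 f0, X1 f1, f = f0 + f1 &
    nrm X0 f0 + t * nrm X1 f1 < K t f + e].
Proof.
move=> t0 e0 [g0 [g1 [Xg0 Xg1 fE]]].
have hi : has_inf [set r | exists f0 f1, [/\ X0 f0, X1 f1, f = f0 + f1 &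
                              r = nrm X0 f0 + t * nrm X1 f1]].
  split; first by exists (nrm X0 g0 + t * nrm X1 g1), g0, g1.
  exists 0 => _ [f0 [f1 [Xf0 Xf1 _ ->]]].
  by rewrite addr_ge0 ?mulr_ge0 ?(sn_ge0 s0) ?(sn_ge0 s1).
have [r [f0 [f1 [Xf0 Xf1 fE' ->]]] rlt] := inf_adherent e0 hi.
by exists f0, f1.
Qed.

Lemma K_le_all t f m : 0 <= t -> Xsum f ->
  (forall f0 f1, X0 f0 -> X1 f1 -> f = f0 + f1 -> m <= nrm X0 f0 + t * nrm X1 f1) ->
  m <= K t f.
Proof.
move=> t0 sf H; apply/ler_addgt0Pr => e e0.
have [f0 [f1 [Xf0 Xf1 fE lt]]] := K_adherent t0 e0 sf.
by apply: le_trans (H _ _ Xf0 Xf1 fE) (ltW lt).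
Qed.

Lemma sum_spaceD f g : Xsum f -> Xsum g -> Xsum (f + g).
Proof.
move=> [f0 [f1 [Xf0 Xf1 ->]]] [g0 [g1 [Xg0 Xg1 ->]]].
exists (f0 + g0), (f1 + g1); split; last by rewrite addrACA.
  exact: (sn_carrierD s0).
exact: (sn_carrierD s1).
Qed.

Lemma sum_spaceZ (c : R[i]) f : Xsum f -> Xsum (c *: f).
Proof.
move=> [f0 [f1 [Xf0 Xf1 ->]]]; exists (c *: f0), (c *: f1); rewrite scalerDr; split => //.
  exact: (sn_carrierZ s0).
exact: (sn_carrierZ s1).
Qed.

Lemma sum_space_X0 f : X0 f -> Xsum f.
Proof. by move=> Xf; exists f, 0; rewrite addr0; split => //; exact: (sn_carrier0 s1). Qed.

Lemma K_ge0 t f : 0 <= t -> Xsum f -> 0 <= K t f.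
Proof.
move=> t0 sf; apply: K_le_all => // f0 f1 Xf0 Xf1 _.
by rewrite addr_ge0 ?mulr_ge0 ?(sn_ge0 s0) ?(sn_ge0 s1).
Qed.

Lemma K_seminormed t : 0 <= t -> seminormed Xsum (K t).
Proof.
move=> t0.
(* The reverse inequality follows by applying this one to c^-1 and c f, with c = 0 treated apart. *)
have Kz (c : R[i]) f : Xsum f -> K t (c *: f) <= normc c * K t f.
  move=> sf; have [->|c0] := eqVneq c 0.
    rewrite scale0r normc0 mul0r -[0]addr0.
    apply: le_trans (K_le t0 (sn_carrier0 s0) (sn_carrier0 s1)) _.
    by rewrite (sn0 s0) (sn0 s1) mulr0.
  have nc0 : 0 < normc c by rewrite normc_gt0.
  rewrite mulrC -ler_pdivrMr//; apply: K_le_all => // f0 f1 Xf0 Xf1 ->.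
  rewrite ler_pdivrMr// scalerDr.
  apply: le_trans (K_le t0 (sn_carrierZ s0 c Xf0) (sn_carrierZ s1 c Xf1)) _.
  by rewrite (snZ s0)// (snZ s1)//; lra.
split.
- exact/sum_space_X0/(sn_carrier0 s0).
- exact: sum_spaceD.
- exact: sum_spaceZ.
- move=> f g sf sg; apply/ler_addgt0Pr => e e0.
  have e20 : 0 < e / 2 by rewrite divr_gt0.
  have [f0 [f1 [Xf0 Xf1 -> lf]]] := K_adherent t0 e20 sf.
  have [g0 [g1 [Xg0 Xg1 -> lg]]] := K_adherent t0 e20 sg.
  rewrite addrACA.
  apply: le_trans (K_le t0 (sn_carrierD s0 Xf0 Xg0) (sn_carrierD s1 Xf1 Xg1)) _.
  have := snD s0 Xf0 Xg0.
  have : t * nrm X1 (f1 + g1) <= t * (nrm X1 f1 + nrm X1 g1).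
    by rewrite ler_wpM2l// (snD s1).
  lra.
- move=> c f sf; apply/eqP; rewrite eq_le Kz//=.
  have [->|c0] := eqVneq c 0.
    by rewrite normc0 mul0r K_ge0//; exact: sum_spaceZ.
  have nc0 : 0 < normc c by rewrite normc_gt0.
  have := Kz c^-1 (c *: f) (sum_spaceZ c sf).
  by rewrite scalerA mulVf// scale1r normcV ler_pdivlMl.
Qed.

Lemma K_mono t t' f : 0 <= t -> t <= t' -> Xsum f -> K t f <= K t' f.
Proof.
move=> t0 tt' sf; apply: K_le_all => //; first exact: le_trans tt'.
move=> f0 f1 Xf0 Xf1 ->; apply: le_trans (K_le t0 Xf0 Xf1) _.
by rewrite lerD2l ler_wpM2r// (sn_ge0 s1).
Qed.

(** Turns convergence in X_0 + X_1 into convergence for every single K(t, .). *)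
Lemma K_le_K1 t f : 0 <= t -> Xsum f -> K t f <= (1 + t) * K 1 f.
Proof.
move=> t0 sf; rewrite mulrC -ler_pdivrMr; last lra.
apply: K_le_all => // f0 f1 Xf0 Xf1 ->; rewrite ler_pdivrMr; last lra.
apply: le_trans (K_le t0 Xf0 Xf1) _.
have := sn_ge0 s0 Xf0; have := sn_ge0 s1 Xf1 => p1 p0.
have : 0 <= t * nrm X0 f0 by rewrite mulr_ge0.
lra.
Qed.

Lemma L1_le_K f : Xsum f -> L1T_norm f <= K 1 f.
Proof.
move=> sf; apply: K_le_all => // f0 f1 Xf0 Xf1 ->; rewrite mul1r.
apply: le_trans (snD (L1T_norm_seminormed R) I I) _.
by apply: lerD; exact: homogeneous_L1.
Qed.

Lemma K_le0 t f : 0 <= t -> X0 f -> K t f <= nrm X0 f.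
Proof.
move=> t0 Xf; have := K_le t0 Xf (sn_carrier0 s1).
by rewrite addr0 (sn0 s1) mulr0 addr0.
Qed.

Lemma K_le1 t f : 0 <= t -> X1 f -> K t f <= t * nrm X1 f.
Proof.
move=> t0 Xf; have := K_le t0 (sn_carrier0 s0) Xf.
by rewrite add0r (sn0 s0) add0r.
Qed.

Lemma sum_space_translate a f : Xsum f -> Xsum (translate a f).
Proof.
move=> [f0 [f1 [Xf0 Xf1 ->]]]; exists (translate a f0), (translate a f1).
rewrite translateD; split => //.
  by have [] := homogeneous_translate h0 a Xf0.
by have [] := homogeneous_translate h1 a Xf1.
Qed.

(** Translating a decomposition gives one inequality; the inverse translation gives the other. *)
Lemma K_translate t a f : 0 <= t -> Xsum f -> K t (translate a f) = K t f.
Proof.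
move=> t0; suff H b g : Xsum g -> K t (translate b g) <= K t g.
  move=> sf; apply/eqP; rewrite eq_le H//= -{1}(translateK a f).
  exact/H/sum_space_translate.
move=> sg; apply: K_le_all => // f0 f1 Xf0 Xf1 ->; rewrite translateD.
have [Y0 <-] := homogeneous_translate h0 b Xf0.
have [Y1 <-] := homogeneous_translate h1 b Xf1.
exact: K_le.
Qed.

(** One fixed decomposition f = f0 + f1 suffices: its translates decompose the difference, and
    strong continuity applies to each part. *)
Lemma K_translate_cvg t a f (e : R) : 0 <= t -> Xsum f -> 0 < e ->
  \forall b \near a, K t (translate b f - translate a f) <= e.
Proof.
move=> t0 [f0 [f1 [Xf0 Xf1 ->]]] e0.
have Tr0 b : X0 (translate b f0) by have [] := homogeneous_translate h0 b Xf0.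
have Tr1 b : X1 (translate b f1) by have [] := homogeneous_translate h1 b Xf1.
have pos0 : \forall b \near a, 0 <= nrm X0 (translate b f0 - translate a f0).
  by apply: filterE => b; apply: (sn_ge0 s0); exact: (sn_carrierB s0).
have pos1 : \forall b \near a, 0 <= nrm X1 (translate b f1 - translate a f1).
  by apply: filterE => b; apply: (sn_ge0 s1); exact: (sn_carrierB s1).
have e20 : 0 < e / 2 by rewrite divr_gt0.
have e3 : 0 < e / (2 * (t + 1)) by rewrite divr_gt0// mulr_gt0//; lra.
have near1 := (cvg0_nonneg (FF := nbhs_filter a) pos1).1 (homogeneous_continuous h1 a Xf1) _ e3.
have near0 := (cvg0_nonneg (FF := nbhs_filter a) pos0).1 (homogeneous_continuous h0 a Xf0) _ e20.
near=> b.
have b0 : nrm X0 (translate b f0 - translate a f0) <= e / 2 by near: b.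
have b1 : nrm X1 (translate b f1 - translate a f1) <= e / (2 * (t + 1)) by near: b.
rewrite !translateD opprD addrACA.
apply: le_trans (K_le t0 (sn_carrierB s0 (Tr0 b) (Tr0 a)) (sn_carrierB s1 (Tr1 b) (Tr1 a))) _.
have : t * nrm X1 (translate b f1 - translate a f1) <= (t + 1) * (e / (2 * (t + 1))).
  apply: ler_pM => //; last lra.
  by apply: (sn_ge0 s1); exact: (sn_carrierB s1).
have -> : (t + 1) * (e / (2 * (t + 1))) = e / 2 by field; lra.
lra.
Unshelve. all: by end_near. Qed.

(** Decompose each term optimally up to M 2^-k. The two components form geometric series in X_0 and
    in X_1, and the sums of these add up to the limit. *)
Lemma sum_space_geometric : geometric_complete Xsum (K 1).
Proof.
apply: (geometric_completeI (K_seminormed ler01)) => a M M0 Sa Ka.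
have dec k : exists fg : L1T R * L1T R, [/\ X0 fg.1, X1 fg.2, a k = fg.1 + fg.2 &
    nrm X0 fg.1 + nrm X1 fg.2 <= 2 * M * 2^-1 ^+ k].
  have e0 : 0 < M * 2^-1 ^+ k by rewrite mulr_gt0// exprn_gt0.
  have [f0 [f1 [Xf0 Xf1 fE lt]]] := K_adherent ler01 e0 (Sa k).
  by exists (f0, f1); split => //=; have := Ka k; lra.
have [fg hfg] := choice dec.
have M20 : 0 < 2 * M by rewrite mulr_gt0.
have [||x Xx hx] := banach_geometric (homogeneous_banach h0) (a := fun k => (fg k).1) M20.
- by move=> k; have [] := hfg k.
- by move=> k; have [X0f X1f _] := hfg k; have := sn_ge0 s1 X1f; lra.
have [||y Xy hy] := banach_geometric (homogeneous_banach h1) (a := fun k => (fg k).2) M20.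
- by move=> k; have [] := hfg k.
- by move=> k; have [X0f X1f _] := hfg k; have := sn_ge0 s0 X0f; lra.
exists (x + y); first by exists x, y.
exists (2 * (2 * M) + 2 * (2 * M)) => n.
have -> : \sum_(k < n) a k = \sum_(k < n) (fg k).1 + \sum_(k < n) (fg k).2.
  by rewrite -big_split; apply: eq_bigr => k _; have [] := hfg k.
rewrite opprD addrACA.
have Y0 : X0 (x - \sum_(k < n) (fg k).1).
  by apply: (sn_carrierB s0) => //; apply: (sn_carrier_sum s0) => k _; have [] := hfg k.
have Y1 : X1 (y - \sum_(k < n) (fg k).2).
  by apply: (sn_carrierB s1) => //; apply: (sn_carrier_sum s1) => k _; have [] := hfg k.
apply: le_trans (K_le ler01 Y0 Y1) _.
by rewrite mul1r mulrDl; exact: lerD.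
Qed.

End K_functional.

(** * The real method *)

Section equivalent_homogeneous_norm.
Variables (R : realType) (X : nspace R).

(** The new norm is c times the old one. Translation invariance and completeness survive the
    scaling, and the domination of the L^1 norm supplies both condition (i) and definiteness. *)
Lemma homogeneous_up_to_equivalenceI (c : R) :
  seminormed X (nrm X) -> geometric_complete X (nrm X) ->
  0 < c -> (forall f, X f -> L1T_norm f <= c * nrm X f) ->
  (forall f a, X f -> X (translate a f) /\ nrm X (translate a f) = nrm X f) ->
  (forall f a (e : R), X f -> 0 < e ->
    \forall b \near a, nrm X (translate b f - translate a f) <= e) ->
  homogeneous_up_to_equivalence X.
Proof.
move=> sX gX c0 L1X tX cX.
exists (fun f => c * nrm X f); split; last first.
  by exists c, c; split => // f Xf; rewrite !lexx.
have Xt f a : X f -> X (translate a f) by move=> /(tX _ a)[].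
have CB f g : X f -> X g -> X (f - g) := @sn_carrierB _ _ _ _ sX f g.
split => //=.
- split => /=; try by case: sX.
  + move=> f Xf nf0; apply: L1T_norm_eq0; apply/eqP.
    by rewrite eq_le (sn_ge0 (L1T_norm_seminormed R))// andbT -nf0 L1X.
  + by move=> f g Xf Xg; rewrite -mulrDr ler_pM2l// (snD sX).
  + by move=> k f Xf; rewrite (snZ sX)// mulrCA.
  + move=> u Xu hu.
    have [|f Xf cvg] := geometric_complete_cauchy sX gX Xu.
      move=> e e0; have := hu (c * e) (mulr_gt0 c0 e0).
      by apply: filterS => -[m n] /=; rewrite ltr_pM2l.
    by exists f => //; rewrite -(mulr0 c); exact: cvgMr.
- by move=> f a Xf; have [Xtf ->] := tX f a Xf.
- move=> f a Xf; rewrite -(mulr0 c); apply: cvgMr.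
  apply/cvg0_nonneg; first by apply: filterE => b; apply: (sn_ge0 sX); apply: CB; exact: Xt.
  by move=> e e0; exact: cX.
Qed.

End equivalent_homogeneous_norm.

Section real_method.
Variables (R : realType) (X0 X1 : nspace R).
Hypotheses (h0 : homogeneous X0) (h1 : homogeneous X1).
Variables (theta q : R).
Hypothesis q1 : 1 <= q.
Implicit Types (f g : L1T R) (t : R).
Local Notation mu := (@lebesgue_measure R).
Local Notation K := (Kfunctional X0 X1).
Local Notation Xsum := (sum_space X0 X1).
Local Notation D := (`]0%R, +oo[%classic : set R).
Local Notation I := (real_integral X0 X1 theta q).
Local Notation Xr := (real_interpolation X0 X1 theta q).

Let q0 : 0 < q. Proof. exact: lt_le_trans q1. Qed.
Let qn0 : q != 0. Proof. by rewrite gt_eqF. Qed.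
Let mD : measurable (D : set (measurableTypeR R)). Proof. by []. Qed.
Let Ksn t (t0 : 0 <= t) := K_seminormed h0 h1 t0.
Let sumT := sum_space_translate h0 h1.
Let s01 := Ksn ler01.

(* Normalised so that the integrand of [real_integral] is its q-th power. *)
Definition Kweighted f t := t `^ (- theta - q^-1) * K t f.
Local Notation phi := Kweighted.

Lemma Kweighted_ge0 f t : Xsum f -> 0 <= t -> 0 <= phi f t.
Proof. by move=> sf t0; rewrite mulr_ge0 ?powR_ge0//; exact: (K_ge0 h0 h1). Qed.

Lemma real_integralE f : Xsum f ->
  I f = (\int[mu]_(t in D) (phi f t `^ q)%:E)%E.
Proof.
move=> sf; apply: eq_integral => t; rewrite inE /= in_itv/= andbT => t0.
congr (_%:E); rewrite /Kweighted powRB; last by apply/implyP => _; rewrite gt_eqF.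
have K0 : 0 <= K t f by apply: (K_ge0 h0 h1) => //; exact: ltW.
have -> : t `^ (- theta) / t `^ q^-1 * K t f = t `^ (- theta) * K t f * (t `^ q^-1)^-1.
  by rewrite mulrAC.
rewrite [RHS]powRM ?invr_ge0 ?mulr_ge0 ?powR_ge0//; congr (_ * _).
by rewrite -powRN -powRrM mulNr mulVf// powR_inv1// ltW.
Qed.

(** K(t, f) is nondecreasing in t >= 0, and monotone functions are measurable. *)
Lemma measurable_Kweighted f : Xsum f -> measurable_fun D (phi f).
Proof.
move=> sf; apply: measurable_funM.
  by apply: (measurable_funS _ _ (@measurable_powR R _)).
(* Truncation at 0 gives a function monotone on the whole line; nothing controls K(t, f) for
   negative t. *)
apply: (@eq_measurable_fun _ _ _ _ _ (fun t => K (Num.max t 0) f)).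
  move=> t; rewrite inE /= in_itv/= andbT => t0.
  by rewrite (max_idPl _)// ltW.
apply: nondecreasing_measurable => // s t st.
apply: (K_mono h0 h1) => //; first by rewrite le_max lexx orbT.
by rewrite ge_max !le_max st lexx orbT.
Qed.

Lemma measurable_Kweighted_powR f : Xsum f ->
  measurable_fun D (fun t => (phi f t `^ q)%:E).
Proof.
move=> sf; apply/measurable_EFinP.
apply: (@measurableT_comp _ _ _ _ _ _ (fun x : R => x `^ q)).
  exact: measurable_powR.
exact: measurable_Kweighted.
Qed.

Lemma real_integral_ge0 f : (0 <= I f)%E.
Proof.
apply: integral_ge0 => t; rewrite /= in_itv/= andbT => t0.
by rewrite lee_fin divr_ge0 ?powR_ge0// ltW.
Qed.

Lemma Xr_fin f : Xr f -> (fine (I f))%:E = I f.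
Proof. by move=> [_ fi]; rewrite fineK// ge0_fin_numE// real_integral_ge0. Qed.

(** Prepares Minkowski's inequality, which concerns functions on the whole line: the extension by 0
    adds nothing because 0^q = 0. *)
Lemma Lnorm_Kweighted f : Xsum f ->
  Lnorm mu q%:E (EFin \o (phi f \_ D)) = poweR (I f) q^-1.
Proof.
move=> sf; rewrite unlock (real_integralE sf); congr poweR.
rewrite [RHS]integral_mkcond; apply: eq_integral => t _.
rewrite /patch /=; case: ifPn => [|_].
  rewrite inE /= in_itv/= andbT => t0.
  by rewrite ger0_norm ?Kweighted_ge0 ?ltW.
by rewrite normr0 powR0.
Qed.

Lemma real_nrmE f : Xr f -> (nrm Xr f)%:E = poweR (I f) q^-1.
Proof. by move=> Xf; rewrite -(Xr_fin Xf) poweR_EFin. Qed.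

Lemma real_integral_le f (psi : R -> R) : Xsum f -> measurable_fun D psi ->
  (forall t, 0 < t -> phi f t <= psi t) ->
  (I f <= \int[mu]_(t in D) (psi t `^ q)%:E)%E.
Proof.
move=> sf mpsi le; rewrite (real_integralE sf).
apply: ge0_le_integral => //.
- by move=> t _; rewrite lee_fin powR_ge0.
- exact: measurable_Kweighted_powR.
- apply/measurable_EFinP; apply: (@measurableT_comp _ _ _ _ _ _ (fun x : R => x `^ q)); [exact: measurable_powR|exact: mpsi].
move=> t; rewrite /= in_itv/= andbT => t0; rewrite lee_fin.
have p0 := Kweighted_ge0 sf (ltW t0); have le0 := le _ t0.
by apply: ge0_ler_powR; rewrite ?nnegrE ?(ltW q0)//; exact: le_trans le0.
Qed.

Lemma real_triangle f g : Xr f -> Xr g ->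
  Xr (f + g) /\ nrm Xr (f + g) <= nrm Xr f + nrm Xr g.
Proof.
move=> Xf Xg; have [sf If] := Xf; have [sg Ig] := Xg.
have sfg : Xsum (f + g) := sum_spaceD h0 h1 sf sg.
(* Minkowski's inequality bounds J, and J dominates the integral for f + g; this yields the
   finiteness of that integral together with the triangle inequality. *)
pose J := (\int[mu]_(t in D) ((phi f t + phi g t) `^ q)%:E)%E.
have J0 : (0 <= J)%E by apply: integral_ge0 => t _; rewrite lee_fin powR_ge0.
have mfg : measurable_fun D (fun t => phi f t + phi g t).
  by apply: measurable_funD; exact: measurable_Kweighted.
have IJ : (I (f + g)%R <= J)%E.
  apply: real_integral_le => // t t0; rewrite -mulrDr ler_wpM2l ?powR_ge0//.
  exact: (snD (Ksn (ltW t0))).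
have NJ : Lnorm mu q%:E (EFin \o ((phi f \_ D) \+ (phi g \_ D))) = poweR J q^-1.
  rewrite unlock; congr poweR; rewrite /J [RHS]integral_mkcond; apply: eq_integral => t _.
  rewrite /patch /=; case: ifPn => [|_].
    rewrite inE /= in_itv/= andbT => /ltW t0.
    by rewrite ger0_norm ?addr_ge0 ?Kweighted_ge0.
  by rewrite addr0 normr0 powR0.
have mD0 h : Xsum h -> measurable_fun setT (phi h \_ D).
  by move=> sh; apply/(measurable_restrictT _ mD); exact: measurable_Kweighted.
have le : (poweR J q^-1 <= (nrm Xr f + nrm Xr g)%:E)%E.
  rewrite [X in (_ <= X)%E]EFinD [X in (_ <= X + _)%E](real_nrmE Xf).
  rewrite [X in (_ <= _ + X)%E](real_nrmE Xg) -[X in (X <= _)%E]NJ.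
  rewrite -[X in (_ <= X + _)%E](Lnorm_Kweighted sf).
  rewrite -[X in (_ <= _ + X)%E](Lnorm_Kweighted sg).
  exact: (minkowski_EFin mu (mD0 f sf) (mD0 g sg) q1).
have Jfin : (J < +oo)%E.
  apply: (@lty_poweRy _ _ q^-1); first by rewrite invr_eq0.
  exact: le_lt_trans le (ltry _).
have Jf : (fine J)%:E = J by rewrite fineK// ge0_fin_numE.
have Xfg : Xr (f + g) by split; [exact: sfg|exact: le_lt_trans IJ Jfin].
split; first exact: Xfg.
apply: (@le_trans _ _ (fine J `^ q^-1)).
  apply: ge0_ler_powR; rewrite ?nnegrE.
  - by rewrite invr_ge0 (ltW q0).
  - exact/fine_ge0/real_integral_ge0.
  - exact: fine_ge0.
  - by rewrite -lee_fin Jf (Xr_fin Xfg).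
by rewrite -Jf poweR_EFin lee_fin in le.
Qed.

Lemma real_scale (c : R[i]) f : Xr f ->
  Xr (c *: f) /\ nrm Xr (c *: f) = normc c * nrm Xr f.
Proof.
move=> Xf; have [sf If] := Xf; have scf : Xsum (c *: f) := sum_spaceZ h0 h1 c sf.
have nc0 := normc_ge0 c.
have E : (I (c *: f)%R = (normc c `^ q)%:E * I f)%E.
  rewrite !real_integralE// -ge0_integralZl//; last 3 first.
  - exact: measurable_Kweighted_powR.
  - by move=> t _; rewrite lee_fin powR_ge0.
  - by rewrite lee_fin powR_ge0.
  apply: eq_integral => t; rewrite inE /= in_itv/= andbT => /ltW t0.
  rewrite -EFinM -powRM ?Kweighted_ge0//; congr (_ `^ _)%:E.
  by rewrite /Kweighted (snZ (Ksn t0))// mulrCA.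
split; first by split; [exact: scf|rewrite E -(Xr_fin Xf) -EFinM ltry].
rewrite /= E -(Xr_fin Xf) -EFinM /= powRM ?powR_ge0 ?fine_ge0 ?real_integral_ge0//.
by rewrite -powRrM divff// powRr1.
Qed.

Lemma real_seminormed : seminormed Xr (nrm Xr).
Proof.
split.
- have s00 : Xsum 0 := sn_carrier0 s01.
  split => //; rewrite real_integralE// integral0_eq// => t.
  rewrite /= in_itv/= andbT => /ltW t0.
  by rewrite /Kweighted (sn0 (Ksn t0)) mulr0 powR0.
- by move=> f g Xf Xg; have [] := real_triangle Xf Xg.
- by move=> c f Xf; have [] := real_scale c Xf.
- by move=> f g Xf Xg; have [] := real_triangle Xf Xg.
- by move=> c f Xf; have [] := real_scale c Xf.
Qed.

Lemma real_translate f a : Xr f ->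
  Xr (translate a f) /\ nrm Xr (translate a f) = nrm Xr f.
Proof.
move=> [sf If]; have E : I (translate a f) = I f.
  rewrite (real_integralE sf) (real_integralE (sumT a sf)).
  apply: eq_integral => t; rewrite inE /= in_itv/= andbT => /ltW t0.
  by rewrite /Kweighted (K_translate h0 h1).
split; last by rewrite /= E.
by split; [exact: sumT|rewrite E].
Qed.

(* The constant comes from integrating over [1, 2] only. *)
Definition real_K1_const : R := 2 `^ theta * 2 `^ q^-1.

Lemma K1_le_real f : Xr f -> 0 < theta -> K 1 f <= real_K1_const * nrm Xr f.
Proof.
move=> Xf th0; have [sf _] := Xf.
have k0 : 0 <= K 1 f by exact: (K_ge0 h0 h1).
(* A lower bound for the weighted K-functional on [1, 2]: the power of t is smallest at 2 and K(t,
   f) at 1. The interval has length 1. *)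
pose c := 2 `^ (- theta - q^-1) * K 1 f.
have c0 : 0 <= c by rewrite mulr_ge0 ?powR_ge0.
have I12 : ((c `^ q)%:E <= I f)%E.
  rewrite (real_integralE sf).
  apply: (@le_trans _ _ (\int[mu]_(t in `[1%R, 2%R]) (phi f t `^ q)%:E)%E); last first.
    apply: ge0_subset_integral => //.
    - exact: measurable_Kweighted_powR.
    - by move=> t _; rewrite lee_fin powR_ge0.
    - by move=> t /=; rewrite !in_itv/= andbT => /andP[t1 _]; exact: lt_le_trans t1.
  apply: (@le_trans _ _ (\int[mu]_(t in `[1%R, 2%R]) (cst (c `^ q)%:E t))%E).
    rewrite integral_cst//= lebesgue_measure_itv/= lte_fin ltr1n/=.
    by rewrite -EFinD -EFinM lee_fin (_ : 2 - 1 = 1)// ?mulr1//; lra.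
  apply: ge0_le_integral => //.
  - by move=> t _; rewrite lee_fin powR_ge0.
  - apply: measurable_funS (measurable_Kweighted_powR sf) => //.
    by move=> t /=; rewrite !in_itv/= andbT => /andP[t1 _]; exact: lt_le_trans t1.
  move=> t /=; rewrite in_itv/= => /andP[t1 t2]; rewrite lee_fin.
  have t0 : 0 < t by lra.
  apply: ge0_ler_powR; rewrite ?nnegrE ?(ltW q0)//; first exact/Kweighted_ge0/ltW.
  apply: ler_pM => //.
    rewrite -opprD !powRN lef_pV2 ?posrE ?powR_gt0//.
    by apply: ge0_ler_powR; rewrite ?nnegrE ?addr_ge0 ?invr_ge0 ?(ltW th0) ?(ltW q0) ?(ltW t0).
  by apply: (K_mono h0 h1).
have : c <= nrm Xr f.
  rewrite -(@powRr1 _ c)// -(divff qn0) powRrM /=.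
  apply: ge0_ler_powR; rewrite ?nnegrE ?invr_ge0 ?powR_ge0 ?(ltW q0) ?fine_ge0 ?real_integral_ge0//.
  by rewrite -lee_fin Xr_fin.
rewrite /c /real_K1_const -opprD powRN ler_pdivrMl ?powR_gt0// powRD//.
by rewrite gt_eqF// addr_gt0// invr_gt0.
Qed.

End real_method.

Section powR_limits.
Variable R : realType.

(** Differentiability of the power gives continuity at positive x; x = 0 is done by hand. *)
Lemma cvg_powR (u : nat -> R) (x q : R) : 0 < q -> (forall n, 0 <= u n) ->
  u n @[n --> \oo] --> x -> u n `^ q @[n --> \oo] --> x `^ q.
Proof.
move=> q0 u0 ux; have x0 : 0 <= x.
  by rewrite -(cvg_lim _ ux)//; apply: limr_ge; [apply/cvg_ex; exists x|exact: nearW].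
move: x0; rewrite le_eqVlt => /predU1P[x0|x0]; last first.
  apply: (@cvg_comp _ _ _ u (fun y => y `^ q) _ (nbhs x)) => //.
  have xpos : x \in `]0, +oo[%R by rewrite in_itv/= x0.
  have /derivable1_diffP/differentiable_continuous := @derivable_powR R 1 q x xpos.
  exact.
rewrite -x0 powR0 ?gt_eqF//; apply/cvg0_nonneg; first by apply: nearW => n; exact: powR_ge0.
rewrite -x0 in ux; move=> e e0.
have [N _ hN] := (cvg0_nonneg (nearW _ u0)).1 ux (e `^ q^-1) (powR_gt0 _ e0).
exists N => // n /hN /= un.
rewrite -[leRHS](powRr1 (ltW e0)) -(@mulVf _ q) ?gt_eqF// powRrM.
by apply: ge0_ler_powR; rewrite ?nnegrE ?powR_ge0 ?(ltW q0).
Qed.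

End powR_limits.

(** * Homogeneity of the real interpolation space *)

Section real_method_homogeneous.
Variables (R : realType) (X0 X1 : nspace R).
Hypotheses (h0 : homogeneous X0) (h1 : homogeneous X1).
Variables (theta q : R).
Hypotheses (theta0 : 0 < theta) (q1 : 1 <= q).
Implicit Types (f g : L1T R) (t : R).
Local Notation mu := (@lebesgue_measure R).
Local Notation K := (Kfunctional X0 X1).
Local Notation Xsum := (sum_space X0 X1).
Local Notation D := (`]0%R, +oo[%classic : set R).
Local Notation I := (real_integral X0 X1 theta q).
Local Notation Xr := (real_interpolation X0 X1 theta q).
Local Notation phi := (Kweighted X0 X1 theta q).

Let q0 : 0 < q. Proof. exact: lt_le_trans q1. Qed.
Let qn0 : q != 0. Proof. by rewrite gt_eqF. Qed.
Let mD : measurable (D : set (measurableTypeR R)). Proof. by []. Qed.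
Let Ksn t (t0 : 0 <= t) := K_seminormed h0 h1 t0.
Let s01 := Ksn ler01.
Let Xrsn := real_seminormed h0 h1 theta q1.

Lemma Kweighted_cvg (u : nat -> L1T R) f t : 0 <= t -> Xsum f ->
  (forall n, Xsum (u n)) ->
  (forall e : R, 0 < e -> \forall n \near \oo, K t (f - u n) <= e) ->
  phi (u n) t `^ q @[n --> \oo] --> phi f t `^ q.
Proof.
move=> t0 sf su cu; apply: cvg_powR => //; first by move=> n; exact: (Kweighted_ge0 h0 h1).
apply: cvgMr; apply/cvgrPdist_le => e /cu; apply: filterS => n; apply: le_trans.
have := sn_leB (Ksn t0) sf (su n); have := sn_leB (Ksn t0) (su n) sf.
rewrite (snBC (Ksn t0) (su n) sf) ler_norml => *; apply/andP; split; lra.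
Qed.

(** Closed balls of the interpolation space are closed under convergence in X_0 + X_1: by [K_le_K1]
    the integrands converge pointwise, and Fatou's lemma bounds the integral of the limit. *)
Lemma real_fatou (u : nat -> L1T R) f (B : R) : 0 <= B -> Xsum f ->
  (forall n, Xr (u n)) -> (forall n, nrm Xr (u n) <= B) ->
  (forall e : R, 0 < e -> \forall n \near \oo, K 1 (f - u n) <= e) ->
  Xr f /\ nrm Xr f <= B.
Proof.
move=> B0 sf Xu uB cu.
have su n : Xsum (u n) by case: (Xu n).
have If : (I f <= (B `^ q)%:E)%E.
  rewrite (real_integralE h0 h1 theta q1 sf).
  have -> : (\int[mu]_(t in D) (phi f t `^ q)%:E)%E =
      (\int[mu]_(t in D) limn_einf (fun n => (phi (u n) t `^ q)%:E))%E.
    apply: eq_integral => t; rewrite inE /= in_itv/= andbT => t0.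
    suff : ((phi (u n) t `^ q)%:E @[n --> \oo] --> (phi f t `^ q)%:E)%E.
      by move=> /cvg_limn_einf_sup[-> _].
    apply: cvg_EFin; first exact: nearW.
    apply: Kweighted_cvg => //; first exact: ltW.
    move=> e e0; have t1 : 0 < 1 + t by lra.
    apply: filterS (cu _ (divr_gt0 e0 t1)) => n le.
    have sfu : Xsum (f - u n) by exact: (sn_carrierB s01).
    apply: le_trans (K_le_K1 h0 h1 (ltW t0) sfu) _.
    by rewrite mulrC -ler_pdivlMr.
  apply: le_trans (fatou mu mD _ _) _.
  - by move=> n; exact: measurable_Kweighted_powR.
  - by move=> n t _; rewrite lee_fin powR_ge0.
  rewrite limn_einf_lim; apply: lime_le; first exact: is_cvg_einfs.
  apply: nearW => n; apply: (@le_trans _ _ (\int[mu]_(t in D) (phi (u n) t `^ q)%:E)%E).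
    by apply: ereal_inf_lbound; exists n => /=.
  rewrite -(real_integralE h0 h1 theta q1 (su n)) -(Xr_fin (Xu n)) lee_fin.
  have <- : nrm Xr (u n) `^ q = fine (I (u n)).
    by rewrite /= -powRrM mulVf// powRr1// fine_ge0// real_integral_ge0.
  by apply: ge0_ler_powR; rewrite ?nnegrE ?(ltW q0)// (sn_ge0 Xrsn).
have Xf : Xr f by split; [exact: sf|exact: le_lt_trans If (ltry _)].
split; first exact: Xf.
rewrite -[leRHS](powRr1 B0) -(divff qn0) powRrM /=.
apply: ge0_ler_powR; rewrite ?nnegrE.
- by rewrite invr_ge0 (ltW q0).
- exact/fine_ge0/real_integral_ge0.
- exact: powR_ge0.
- by rewrite -lee_fin (Xr_fin Xf).
Qed.

(** The sum exists in X_0 + X_1 by [K1_le_real]. Its remainder after n terms is the limit there of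
    the differences S (n + m) - S n, bounded uniformly in m by [geometric_tail], so [real_fatou]
    puts it in the space with the right bound. *)
Lemma real_geometric : geometric_complete Xr (nrm Xr).
Proof.
move=> a M M0 Xa na.
have sa k : Xsum (a k) by case: (Xa k).
pose c := real_K1_const theta q.
have c0 : 0 < c by rewrite mulr_gt0 ?powR_gt0.
have [|k|s ss hs] := sum_space_geometric h0 h1 (a := a) (mulr_gt0 c0 M0).
- exact: sa.
- apply: le_trans (K1_le_real h0 h1 q1 (Xa k) theta0) _.
  by rewrite -/c -(mulrA c M) (ler_pM2l c0).
pose S n := \sum_(k < n) a k.
have XS n : Xr (S n) by apply: (sn_carrier_sum Xrsn).
have sS n : Xsum (S n) by case: (XS n).
have key n : Xr (s - S n) /\ nrm Xr (s - S n) <= 2 * M * 2^-1 ^+ n.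
  apply: (@real_fatou (fun m => S (n + m)%N - S n)).
  - by rewrite !mulr_ge0 ?exprn_ge0 ?(ltW M0).
  - exact: (sn_carrierB s01).
  - by move=> m; exact: (sn_carrierB Xrsn).
  - move=> m; apply: le_trans (geometric_tail Xrsn n m Xa na) _.
    by rewrite lerBlDr lerDl !mulr_ge0 ?exprn_ge0 ?(ltW M0).
  move=> e e0; have cM0 : 0 < 2 * (c * M) by rewrite !mulr_gt0.
  have [N hN] := half_expr_lt (divr_gt0 e0 cM0).
  exists N => // m /= Nm; rewrite opprB addrA subrK.
  apply: le_trans (hs (n + m)%N) _.
  rewrite mulrC -ler_pdivlMr//; apply: le_trans (ltW hN).
  by apply: half_expr_le; rewrite (leq_trans Nm)// leq_addl.
exists s; last by move=> n; have [] := key n.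
by have [] := key 0%N; rewrite /S big_ord0 subr0.
Qed.

Lemma real_translate_cvg f a (e : R) : Xr f -> 0 < e ->
  \forall b \near a, nrm Xr (translate b f - translate a f) <= e.
Proof.
(* Dominated convergence is about sequences, so a failure of continuity is first turned into a
   sequence tending to a. *)
move=> Xf e0; apply: contrapT => nnear.
have [b hb] : exists b : nat -> R, forall n, `|a - b n| < n.+1%:R^-1 /\
    ~ nrm Xr (translate (b n) f - translate a f) <= e.
  suff H n : exists b, `|a - b| < n.+1%:R^-1 /\
      ~ nrm Xr (translate b f - translate a f) <= e.
    by have [b hb] := choice H; exists b.
  apply: contrapT => nb; apply: nnear; apply/nbhs_ballP.
  exists n.+1%:R^-1; first by rewrite /= invr_gt0.
  move=> b ab; apply: contrapT => ne; by apply: nb; exists b.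
have ba : b n @[n --> \oo] --> a.
  apply/cvgrPdist_lt => d d0; have [N hN] : exists N : nat, d^-1 < N%:R.
    by exists (Num.bound d^-1); apply: archi_boundP; rewrite invr_ge0 ltW.
  exists N => // n /= Nn; have [abn _] := hb n; apply: (lt_trans abn).
  rewrite invf_plt ?posrE//; apply: (lt_le_trans hN).
  by rewrite ler_nat (leq_trans Nn).
have Xt c : Xr (translate c f) by have [] := real_translate h0 h1 q1 c Xf.
pose u n := translate (b n) f - translate a f.
have Xu n : Xr (u n) := sn_carrierB Xrsn (Xt (b n)) (Xt a).
have su n : Xsum (u n) := (Xu n).1.
have sf : Xsum f := Xf.1.
have X2f : Xr (2 *: f) := sn_carrierZ Xrsn 2 Xf.
have s2f : Xsum (2 *: f) := X2f.1.
have dom n t : 0 < t -> phi (u n) t `^ q <= phi (2 *: f) t `^ q.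
  move=> /ltW t0; apply: ge0_ler_powR; rewrite ?nnegrE ?(ltW q0) ?(Kweighted_ge0 h0 h1)//.
  rewrite ler_wpM2l ?powR_ge0//.
  have st c : Xsum (translate c f) by exact: sum_space_translate.
  apply: le_trans (snB (Ksn t0) (st _) (st _)) _.
  by rewrite !(K_translate h0 h1)// (snZ (Ksn t0))// normc_nat; lra.
have [|||||_ _ hI] := @dominated_convergence _ _ _ mu D mD
  (fun n t => (phi (u n) t `^ q)%:E) (cst 0%E) (fun t => (phi (2 *: f) t `^ q)%:E).
- by move=> n; exact: measurable_Kweighted_powR.
- exact: measurable_cst.
- apply: aeW => t; rewrite /= in_itv/= andbT => t0.
  apply: cvg_EFin; first exact: nearW.
  (* The limit is displayed as the integrand of the zero function, to which [Kweighted_cvg]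
     applies. *)
  have -> : 0 = phi 0 t `^ q by rewrite /Kweighted (sn0 (Ksn (ltW t0))) mulr0 powR0.
  apply: Kweighted_cvg => //; [exact: ltW|exact: (sn_carrier0 s01)|].
  move=> d d0; have near_u : \forall n \near \oo, K t (u n) <= d.
    exact: ba _ (K_translate_cvg h0 h1 a (ltW t0) sf d0).
  by apply: filterS near_u => n; rewrite sub0r (snN (Ksn (ltW t0))).
- apply/integrableP; split; first exact: measurable_Kweighted_powR.
  have [_] := X2f; rewrite (real_integralE h0 h1 theta q1 s2f).
  congr (_ < _)%E; apply: eq_integral => t _ /=.
  by rewrite ger0_norm ?powR_ge0.
- apply: aeW => t n; rewrite /= in_itv/= andbT => t0.
  by rewrite lee_fin ger0_norm ?powR_ge0// dom.
rewrite integral0 in hI.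
have /fine_cvgP[_] := hI; move/cvgr0Pnorm_lt => /(_ (e `^ q) (powR_gt0 _ e0))[N _ hN].
have [_] := hb N; apply.
rewrite /= (real_integralE h0 h1 theta q1 (su N)).
have := hN N (leqnn N); rewrite /= => lt.
rewrite -[leRHS](powRr1 (ltW e0)) -(divff qn0) powRrM.
apply: ge0_ler_powR; rewrite ?nnegrE ?invr_ge0 ?(ltW q0) ?powR_ge0//.
  by apply: fine_ge0; apply: integral_ge0 => t _; rewrite lee_fin powR_ge0.
exact: le_trans (ler_norm _) (ltW lt).
Qed.

Lemma real_homogeneous : homogeneous_up_to_equivalence Xr.
Proof.
apply: (homogeneous_up_to_equivalenceI Xrsn real_geometric (c := real_K1_const theta q)).
- by rewrite mulr_gt0 ?powR_gt0.
- move=> f Xf; have [sf _] := Xf; apply: le_trans (L1_le_K h0 h1 sf) _.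
  exact: K1_le_real.
- by move=> f a Xf; exact: real_translate.
- exact: real_translate_cvg.
Qed.

End real_method_homogeneous.

(** * The complex method *)

Section bounded_continuity.
Variables (R : realType) (Y : nspace R).
Hypothesis sY : seminormed Y (nrm Y).

Lemma bounded_continuousP (T : topologicalType) (A : set T) (g : T -> L1T R) :
  bounded_continuous_in Y A g <->
  [/\ forall x, A x -> Y (g x),
      exists M : R, forall x, A x -> nrm Y (g x) <= M &
      forall x, A x -> forall e : R, 0 < e ->
        \forall y \near x, A y -> nrm Y (g y - g x) <= e].
Proof.
have pos x : A x -> (forall y, A y -> Y (g y)) ->
    \forall y \near within A (nbhs x), 0 <= nrm Y (g y - g x).
  move=> Ax Yg; rewrite near_withinE; apply: filterE => y Ay.
  by apply: (sn_ge0 sY); apply: (sn_carrierB sY); exact: Yg.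
split=> -[Yg Mg cg]; split => // x Ax.
  move=> e e0; have := (cvg0_nonneg (FF := within_filter A (nbhs_filter x)) (pos x Ax Yg)).1 (cg x Ax) e e0.
  by rewrite near_withinE.
have [_] := cvg0_nonneg (pos x Ax Yg); apply => e e0.
by rewrite near_withinE; exact: (cg x Ax e e0).
Qed.

Lemma bounded_continuousD (T : topologicalType) (A : set T) (f g : T -> L1T R) :
  bounded_continuous_in Y A f -> bounded_continuous_in Y A g ->
  bounded_continuous_in Y A (fun x => f x + g x).
Proof.
move=> /bounded_continuousP[Yf [Mf fM] cf] /bounded_continuousP[Yg [Mg gM] cg].
apply/bounded_continuousP; split.
- by move=> x Ax; apply: (sn_carrierD sY); [exact: Yf|exact: Yg].
- exists (Mf + Mg) => x Ax; apply: le_trans (snD sY (Yf x Ax) (Yg x Ax)) _.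
  by apply: lerD; [exact: fM|exact: gM].
- move=> x Ax e e0; have e20 : 0 < e / 2 by rewrite divr_gt0.
  apply: filterS2 (cf x Ax _ e20) (cg x Ax _ e20) => y fy gy Ay.
  have := fy Ay; have := gy Ay; rewrite opprD addrACA.
  have := snD sY (sn_carrierB sY (Yf y Ay) (Yf x Ax)) (sn_carrierB sY (Yg y Ay) (Yg x Ax)).
  lra.
Qed.

Lemma bounded_continuousZ (T : topologicalType) (A : set T) (k : T -> R[i])
    (g : T -> L1T R) (m : R) :
  (forall x, A x -> normc (k x) <= m) ->
  (forall x, A x -> forall e : R, 0 < e ->
     \forall y \near x, A y -> normc (k y - k x) <= e) ->
  bounded_continuous_in Y A g ->
  bounded_continuous_in Y A (fun x => k x *: g x).
Proof.
move=> km ck /bounded_continuousP[Yg [Mg gM] cg].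
apply/bounded_continuousP; split.
- by move=> x Ax; apply: (sn_carrierZ sY); exact: Yg.
- exists (m * Mg) => x Ax; rewrite (snZ sY); last exact: Yg.
  by apply: ler_pM; [exact: normc_ge0|apply: (sn_ge0 sY); exact: Yg|exact: km|exact: gM].
- move=> x Ax e e0.
  have m0 : 0 <= m by apply: (le_trans _ (km x Ax)); exact: normc_ge0.
  have p0 := sn_ge0 sY (Yg x Ax).
  have e1 : 0 < e / (2 * (m + 1)) by rewrite divr_gt0// mulr_gt0//; lra.
  have e2 : 0 < e / (2 * (nrm Y (g x) + 1)) by rewrite divr_gt0// mulr_gt0//; lra.
  apply: filterS2 (cg x Ax _ e1) (ck x Ax _ e2) => y gy ky Ay.
  have {}gy := gy Ay; have {}ky := ky Ay.
  apply: le_trans (sn_scaleB sY _ _ (Yg y Ay) (Yg x Ax)) _.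
  have : normc (k y) * nrm Y (g y - g x) <= (m + 1) * (e / (2 * (m + 1))).
    apply: ler_pM => //; [exact: normc_ge0| |have := km y Ay; lra].
    by apply: (sn_ge0 sY); apply: (sn_carrierB sY); exact: Yg.
  have : normc (k y - k x) * nrm Y (g x) <=
      e / (2 * (nrm Y (g x) + 1)) * (nrm Y (g x) + 1).
    by apply: ler_pM => //; [exact: normc_ge0|lra].
  have -> : (m + 1) * (e / (2 * (m + 1))) = e / 2 by field; lra.
  have -> : e / (2 * (nrm Y (g x) + 1)) * (nrm Y (g x) + 1) = e / 2 by field; lra.
  lra.
Qed.

Lemma bounded_continuous0 (T : topologicalType) (A : set T) :
  bounded_continuous_in Y A (fun=> 0).
Proof.
apply/bounded_continuousP; split; first by move=> x _; exact: (sn_carrier0 sY).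
  by exists 0 => x _; rewrite (sn0 sY).
by move=> x _ e e0; apply: filterE => y _; rewrite subrr (sn0 sY) ltW.
Qed.

Lemma bounded_continuous_translate (T : topologicalType) (A : set T) a
    (g : T -> L1T R) :
  (forall f, Y f -> Y (translate a f) /\ nrm Y (translate a f) = nrm Y f) ->
  bounded_continuous_in Y A g ->
  bounded_continuous_in Y A (fun x => translate a (g x)).
Proof.
move=> tY /bounded_continuousP[Yg [Mg gM] cg].
apply/bounded_continuousP; split.
- by move=> x Ax; have [] := tY _ (Yg x Ax).
- by exists Mg => x Ax; have [_ ->] := tY _ (Yg x Ax); exact: gM.
- move=> x Ax e e0; apply: filterS (cg x Ax _ e0) => y gy Ay.
  rewrite -translateB.
  by have [_ ->] := tY _ (sn_carrierB sY (Yg y Ay) (Yg x Ax)); exact: gy.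
Qed.

Lemma bounded_continuous_limit (T : topologicalType) (A : set T)
    (g : nat -> T -> L1T R) (h : T -> L1T R) :
  (forall n, bounded_continuous_in Y A (g n)) ->
  (forall x, A x -> Y (h x)) ->
  (forall e : R, 0 < e -> exists n, forall x, A x -> nrm Y (h x - g n x) <= e) ->
  bounded_continuous_in Y A h.
Proof.
move=> bg Yh hg; apply/bounded_continuousP; split => //.
  have [n hn] := hg 1 ltr01; have /bounded_continuousP[Yg [M gM] _] := bg n.
  exists (M + 1) => x Ax; have := sn_leB sY (Yh x Ax) (Yg x Ax).
  have := gM x Ax; have := hn x Ax; lra.
move=> x Ax e e0; have [|n hn] := hg (e / 3); first by rewrite divr_gt0.
have /bounded_continuousP[Yg _ cg] := bg n.
have e30 : 0 < e / 3 by rewrite divr_gt0.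
apply: filterS (cg x Ax _ e30) => y /[swap] Ay /(_ Ay) gy.
have Yx := Yh x Ax; have Yy := Yh y Ay; have Gx := Yg x Ax; have Gy := Yg y Ay.
have := snBD sY Yy Gy Yx; have := snBD sY Gy Gx Yx.
have := hn y Ay; have := hn x Ax; rewrite (snBC sY Yx Gx); lra.
Qed.

End bounded_continuity.

Section strip_truncation.
Variables (R : realType) (Y : nspace R).
Hypothesis sY : seminormed Y (nrm Y).
Implicit Types (F : R[i] -> L1T R) (z w : R[i]).

Lemma open_strip_near z : open_strip z ->
  exists2 r : R, 0 < r & forall w, `|complex.Re (w - z)| < r -> open_strip w.
Proof.
case: z => x y /andP[/= x0 x1]; exists (Num.min x (1 - x)).
  by rewrite lt_min x0 subr_gt0.
move=> [u v] /=; rewrite lt_min !ltr_norml => /andP[/andP[u1 u2] /andP[u3 u4]].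
by apply/andP => /=; split; lra.
Qed.

Lemma open_strip_sub z : open_strip z -> strip z.
Proof. by move=> /andP[? ?]; apply/andP; split; exact: ltW. Qed.

(* Functions of [calderon] are unconstrained outside the strip; this extension
   has values in the carrier everywhere. *)
Definition strip_ext F z : L1T R := if pselect (strip z) then F z else 0.

Lemma strip_extE F z : strip z -> strip_ext F z = F z.
Proof. by rewrite /strip_ext; case: pselect. Qed.

Lemma strip_ext_carrier F : (forall z, strip z -> Y (F z)) ->
  forall z, Y (strip_ext F z).
Proof.
move=> YF z; rewrite /strip_ext; case: pselect => sz /=; first exact: YF.
exact: (sn_carrier0 sY).
Qed.

(** Links the difference quotients of the definition to [has_cderiv] for an extension with values in
    the carrier everywhere, as the Cauchy theory requires. Around a point of the open strip the
    extension and F agree on a disc. *)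
Lemma analytic_in_stripP F : (forall z, strip z -> Y (F z)) ->
  analytic_in Y (@open_strip R) F <->
  forall z, open_strip z ->
    exists2 D, Y D & has_cderiv (nrm Y) (strip_ext F) z D.
Proof.
move=> YF; split => H z oz; have [r r0 rz] := open_strip_near oz.
all: have rz' w : normc (w - z) < r -> strip w
  by move=> wr; exact/open_strip_sub/rz/(le_lt_trans (normRe_le _) wr).
all: have sz := open_strip_sub oz.
all: have pos D : Y D ->
  \forall w \near z^', 0 <= nrm Y ((w - z)^-1 *: (F w - F z) - D).
all: try by move=> YD; rewrite near_withinE; apply/nbhs_normcP; exists r => // w /rz' sw _;
  apply: (sn_ge0 sY); apply: (sn_carrierB sY) => //; apply: (sn_carrierZ sY);
  apply: (sn_carrierB sY); exact: YF.
- have [D YD hD] := H z oz; exists D => // e e0.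
  have := (cvg0_nonneg (FF := within_filter _ (nbhs_filter z)) (pos D YD)).1 hD e e0.
  rewrite near_withinE => /nbhs_normcP[d d0 hd].
  exists (Num.min d r); first by rewrite lt_min d0.
  move=> w; rewrite lt_min => /andP[wd wr]; have sw := rz' w wr.
  rewrite !strip_extE//; have [->|wz] := eqVneq w z.
    by rewrite !subrr scale0r subrr (sn0 sY) normc0 mulr0.
  have YB : Y (F w - F z) by apply: (sn_carrierB sY); exact: YF.
  have -> : F w - F z - (w - z) *: D = (w - z) *: ((w - z)^-1 *: (F w - F z) - D).
    by rewrite scalerBr scalerA divff ?subr_eq0// scale1r.
  rewrite (snZ sY); last by apply: (sn_carrierB sY) => //; exact: (sn_carrierZ sY).
  by rewrite mulrC ler_wpM2r ?normc_ge0//; exact: hd.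
- have [D YD hD] := H z oz; exists D => //.
  have [_] := cvg0_nonneg (pos D YD); apply => e e0; have [d d0 hd] := hD e e0.
  rewrite near_withinE; apply/nbhs_normcP; exists (Num.min d r).
    by rewrite lt_min d0.
  move=> w; rewrite lt_min => /andP[wd wr] wz; have sw := rz' w wr.
  have := hd w wd; rewrite !strip_extE//.
  have YB : Y (F w - F z) by apply: (sn_carrierB sY); exact: YF.
  have wz0 : w - z != 0 by rewrite subr_eq0.
  have -> : F w - F z - (w - z) *: D = (w - z) *: ((w - z)^-1 *: (F w - F z) - D).
    by rewrite scalerBr scalerA divff// scale1r.
  rewrite (snZ sY); last by apply: (sn_carrierB sY) => //; exact: (sn_carrierZ sY).
  by rewrite mulrC ler_pM2r// normc_gt0.
Qed.

End strip_truncation.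

(** * Calculus of admissible functions on the strip *)

Section complex_method.
Variables (R : realType) (X0 X1 : nspace R).
Hypotheses (h0 : homogeneous X0) (h1 : homogeneous X1).
Implicit Types (f g : L1T R) (F G : R[i] -> L1T R).
Local Notation K := (Kfunctional X0 X1).
Local Notation Xsum := (sum_space X0 X1).
Local Notation calderon := (calderon X0 X1).
Local Notation calderon_norm := (calderon_norm X0 X1).

Let s0 := banach_seminormed (homogeneous_banach h0).
Let s1 := banach_seminormed (homogeneous_banach h1).
Let s01 : seminormed Xsum (nrm Xsum) := K_seminormed h0 h1 ler01.

Lemma line0_strip (t : R) : strip (0 +i* t).
Proof. by rewrite /strip /= lexx ler01. Qed.

Lemma line1_strip (t : R) : strip (1 +i* t).
Proof. by rewrite /strip /= lexx ler01. Qed.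

Section calderon_facts.
Variable F : R[i] -> L1T R.
Hypothesis cF : calderon F.

Lemma calderon_carrier z : strip z -> Xsum (F z).
Proof. by case: cF => -[YF _ _] _ _ _; exact: YF. Qed.

Lemma calderon_carrier0 (t : R) : X0 (F (0 +i* t)).
Proof. by case: cF => _ _ [X0F _ _] _; exact: X0F. Qed.

Lemma calderon_carrier1 (t : R) : X1 (F (1 +i* t)).
Proof. by case: cF => _ _ _ [X1F _ _]; exact: X1F. Qed.

Lemma calderon_has_cderiv z : open_strip z ->
  exists2 D, Xsum D & has_cderiv (nrm Xsum) (strip_ext F) z D.
Proof.
by case: cF => -[YF _ _] aF _ _; exact: (analytic_in_stripP s01 YF).1.
Qed.

Lemma calderon_norm_line0 (t : R) : nrm X0 (F (0 +i* t)) <= calderon_norm F.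
Proof.
rewrite le_max; apply/orP; left; apply: ub_le_sup; last by exists t.
by case: cF => _ _ [_ [M FM] _] _; exists M => _ [u _ <-]; exact: FM.
Qed.

Lemma calderon_norm_line1 (t : R) : nrm X1 (F (1 +i* t)) <= calderon_norm F.
Proof.
rewrite le_max; apply/orP; right; apply: ub_le_sup; last by exists t.
by case: cF => _ _ _ [_ [M FM] _]; exists M => _ [u _ <-]; exact: FM.
Qed.

Lemma calderon_norm_ge0 : 0 <= calderon_norm F.
Proof.
by apply: le_trans (calderon_norm_line0 0); apply: (sn_ge0 s0); exact: calderon_carrier0.
Qed.

(** K(1, .) is at most the norm of X_0 on X_0 and that of X_1 on X_1, so the boundary values of K(1,
    F) are at most the Calderon norm; the maximum principle on the strip does the rest. *)
Lemma calderon_strip_le z : strip z -> K 1 (F z) <= calderon_norm F.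
Proof.
move=> sz; rewrite -(strip_extE F sz).
have Yext := strip_ext_carrier s01 calderon_carrier.
have [_ [B FB] cont] := (bounded_continuousP s01 _ _).1 (calderon_strip cF).
apply: (strip_maximum_principle s01 Yext (B := B)) sz.
- move=> w sw e e0; have /nbhs_normcP[d d0 hd] := cont w sw e e0.
  by exists d => // u su /hd; rewrite !strip_extE//; exact.
- exact: calderon_has_cderiv.
- by move=> w sw; rewrite strip_extE//; exact: FB.
- move=> t; rewrite strip_extE; last exact: line0_strip.
  apply: le_trans (calderon_norm_line0 t).
  exact: (K_le0 h0 h1 ler01 (calderon_carrier0 t)).
- move=> t; rewrite strip_extE; last exact: line1_strip.
  apply: le_trans (calderon_norm_line1 t); rewrite -[leRHS]mul1r.
  exact: (K_le1 h0 h1 ler01 (calderon_carrier1 t)).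
Qed.

End calderon_facts.

Lemma calderon_norm_le F (M : R) : (forall t : R, nrm X0 (F (0 +i* t)) <= M) ->
  (forall t : R, nrm X1 (F (1 +i* t)) <= M) -> calderon_norm F <= M.
Proof.
move=> F0 F1; rewrite ge_max; apply/andP; split; apply: ge_sup.
- by exists (nrm X0 (F (0 +i* 0))), 0.
- by move=> _ [t _ <-].
- by exists (nrm X1 (F (1 +i* 0))), 0.
- by move=> _ [t _ <-].
Qed.

Lemma calderonI F :
  bounded_continuous_in Xsum (@strip R) F ->
  (forall z, open_strip z ->
    exists2 D, Xsum D & has_cderiv (nrm Xsum) (strip_ext F) z D) ->
  bounded_continuous_in X0 [set: R] (fun t : R => F (0 +i* t)) ->
  bounded_continuous_in X1 [set: R] (fun t : R => F (1 +i* t)) ->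
  calderon F.
Proof.
move=> bF aF F0 F1; split => //; have [YF _ _] := bF.
exact/(analytic_in_stripP s01 YF).
Qed.

Lemma calderon0 : calderon (fun=> 0).
Proof.
apply: calderonI; try exact: bounded_continuous0.
move=> z oz; exists 0; first exact: (sn_carrier0 s01).
move=> e e0; exists 1 => // w _.
have E u : strip_ext (fun=> 0 : L1T R) u = 0 by rewrite /strip_ext; case: pselect.
by rewrite !E scaler0 !subr0 (sn0 s01) mulr_ge0 ?normc_ge0 ?ltW.
Qed.

Lemma calderonD F G : calderon F -> calderon G -> calderon (fun z => F z + G z).
Proof.
move=> cF cG; apply: calderonI.
- exact: (bounded_continuousD s01 (calderon_strip cF) (calderon_strip cG)).
- move=> z oz; have [D YD hD] := calderon_has_cderiv cF oz.
  have [E YE hE] := calderon_has_cderiv cG oz.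
  exists (D + E); first exact: (sn_carrierD s01).
  have -> : strip_ext (fun z => F z + G z) =
      fun z => strip_ext F z + strip_ext G z.
    by apply/funext => u; rewrite /strip_ext; case: pselect => //= _; rewrite addr0.
  apply: (has_cderivD s01) => //; apply: (strip_ext_carrier s01);
    exact: calderon_carrier.
- exact: (bounded_continuousD s0 (calderon_line0 cF) (calderon_line0 cG)).
- exact: (bounded_continuousD s1 (calderon_line1 cF) (calderon_line1 cG)).
Qed.

(** Differentiability of [k] is asked on the closed strip, boundary included, so that it also gives
    the continuity of [k] required on the strip and along the two lines. *)
Lemma calderonZ (k : R[i] -> R[i]) (m : R) F :
  (forall z, strip z -> normc (k z) <= m) ->
  (forall z, strip z -> exists d, has_scalar_cderiv k z d) ->
  calderon F -> calderon (fun z => k z *: F z).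
Proof.
move=> km dk cF.
have ck z : strip z -> forall e : R, 0 < e ->
    exists2 d : R, 0 < d & forall w, normc (w - z) < d -> normc (k w - k z) <= e.
  move=> /dk[d /has_scalar_cderiv_lipschitz[dl dl0 hdl]] e e0.
  have d0 := normc_ge0 d.
  exists (Num.min dl (e / (normc d + 1))); first by rewrite lt_min dl0 divr_gt0//; lra.
  move=> w; rewrite lt_min => /andP[/hdl wd]; rewrite ltr_pdivlMr; last lra.
  by rewrite mulrC => /ltW; exact: le_trans.
have line (j : R) : (forall t : R, strip (j +i* t)) ->
    forall t : R, [set: R] t -> forall e : R, 0 < e ->
    \forall u \near t, [set: R] u -> normc (k (j +i* u) - k (j +i* t)) <= e.
  move=> sj t _ e e0; have [d d0 hd] := ck _ (sj t) e e0.
  apply/nbhs_ballP; exists d => //= u; rewrite -ball_normE /= distrC => ut _.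
  apply: hd; rewrite (_ : _ - _ = 0 +i* (u - t)) ?normc_Im//.
  by apply/eqP; rewrite eq_complex /= subrr !eqxx.
apply: calderonI.
- apply: (bounded_continuousZ s01 km) (calderon_strip cF).
  move=> z sz e e0; have [d d0 hd] := ck z sz e e0.
  by apply/nbhs_normcP; exists d => // w /hd.
- move=> z oz; have [D YD hD] := calderon_has_cderiv cF oz.
  have [d hd] := dk z (open_strip_sub oz).
  have Yext := strip_ext_carrier s01 (calderon_carrier cF).
  exists (k z *: D + d *: strip_ext F z).
    by apply: (sn_carrierD s01); apply: (sn_carrierZ s01).
  have -> : strip_ext (fun z => k z *: F z) = fun z => k z *: strip_ext F z.
    by apply/funext => u; rewrite /strip_ext; case: pselect => //= _; rewrite scaler0.
  exact: (has_cderivZ s01).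
- apply: (bounded_continuousZ s0 _ _ (calderon_line0 cF)) => [t _|].
    exact/km/line0_strip.
  exact/line/line0_strip.
- apply: (bounded_continuousZ s1 _ _ (calderon_line1 cF)) => [t _|].
    exact/km/line1_strip.
  exact/line/line1_strip.
Qed.

Lemma calderon_cstZ (c : R[i]) F : calderon F -> calderon (fun z => c *: F z).
Proof.
apply: (@calderonZ (fun=> c) (normc c)) => // z _; exists 0 => e e0.
by exists 1 => // w _; rewrite subrr mulr0 subr0 normc0 mulr_ge0 ?normc_ge0 ?ltW.
Qed.

Lemma calderonB F G : calderon F -> calderon G -> calderon (fun z => F z - G z).
Proof.
move=> cF cG.
have -> : (fun z => F z - G z) = (fun z => F z + (-1) *: G z).
  by apply/funext => z; rewrite scaleN1r.
by apply: calderonD => //; exact: calderon_cstZ.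
Qed.

Lemma calderon_sum n (F : nat -> R[i] -> L1T R) : (forall k, calderon (F k)) ->
  calderon (fun z => \sum_(k < n) F k z).
Proof.
move=> cF; elim: n => [|n ih].
  have -> : (fun z => \sum_(k < 0) F k z) = (fun=> 0).
    by apply/funext => z; rewrite big_ord0.
  exact: calderon0.
have -> : (fun z => \sum_(k < n.+1) F k z) = (fun z => \sum_(k < n) F k z + F n z).
  by apply/funext => z; rewrite big_ord_recr.
exact: calderonD.
Qed.

Lemma calderon_translate a F : calderon F -> calderon (fun z => translate a (F z)).
Proof.
move=> cF.
have tsum f : Xsum f -> Xsum (translate a f) /\ nrm Xsum (translate a f) = nrm Xsum f.
  by move=> sf; split; [exact: sum_space_translate|exact: (K_translate h0 h1)].
apply: calderonI.
- by apply: (bounded_continuous_translate s01 tsum); exact: calderon_strip.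
- move=> z oz; have [D YD hD] := calderon_has_cderiv cF oz.
  have Yext := strip_ext_carrier s01 (calderon_carrier cF).
  exists (translate a D); first by have [] := tsum D YD.
  move=> e /hD[d d0 hd]; exists d => // w /hd.
  have t0 : translate a 0 = 0 :> L1T R.
    by rewrite -[X in translate a X](scale0r (0 : L1T R)) translateZ scale0r.
  have E u : strip_ext (fun z => translate a (F z)) u = translate a (strip_ext F u).
    by rewrite /strip_ext; case: pselect => //= _; rewrite t0.
  rewrite !E -translateB -translateZ -translateB.
  have [|_ ->//] := tsum (strip_ext F w - strip_ext F z - (w - z) *: D).
  by apply: (sn_carrierB s01); [exact: (sn_carrierB s01)|exact: (sn_carrierZ s01)].
- apply: (bounded_continuous_translate s0) (calderon_line0 cF) => f Xf.
  exact: (homogeneous_translate h0).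
- apply: (bounded_continuous_translate s1) (calderon_line1 cF) => f Xf.
  exact: (homogeneous_translate h1).
Qed.

Lemma calderon_normD F G : calderon F -> calderon G ->
  calderon_norm (fun z => F z + G z) <= calderon_norm F + calderon_norm G.
Proof.
move=> cF cG; apply: calderon_norm_le => t.
  apply: le_trans (snD s0 (calderon_carrier0 cF t) (calderon_carrier0 cG t)) _.
  by apply: lerD; exact: calderon_norm_line0.
apply: le_trans (snD s1 (calderon_carrier1 cF t) (calderon_carrier1 cG t)) _.
by apply: lerD; exact: calderon_norm_line1.
Qed.

Lemma calderon_normZ (c : R[i]) F : calderon F ->
  calderon_norm (fun z => c *: F z) <= normc c * calderon_norm F.
Proof.
move=> cF; apply: calderon_norm_le => t.
  rewrite (snZ s0 _ (calderon_carrier0 cF t)) ler_wpM2l ?normc_ge0//.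
  exact: calderon_norm_line0.
rewrite (snZ s1 _ (calderon_carrier1 cF t)) ler_wpM2l ?normc_ge0//.
exact: calderon_norm_line1.
Qed.

End complex_method.

(** * Series of admissible functions *)

Section calderon_series.
Variables (R : realType) (X0 X1 : nspace R).
Hypotheses (h0 : homogeneous X0) (h1 : homogeneous X1).
Local Notation K := (Kfunctional X0 X1).
Local Notation Xsum := (sum_space X0 X1).
Local Notation calderon := (calderon X0 X1).
Local Notation calderon_norm := (calderon_norm X0 X1).

Let s0 := banach_seminormed (homogeneous_banach h0).
Let s1 := banach_seminormed (homogeneous_banach h1).
Let s01 : seminormed Xsum (nrm Xsum) := K_seminormed h0 h1 ler01.

(** Identifies a sum computed in X_0 or X_1 on a boundary line with the sum computed in X_0 + X_1,
    and also two sums computed in X_0 + X_1. *)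
Lemma sum_space_limit_unique (X : nspace R) (u : nat -> L1T R) f g (B : R) :
  seminormed X (nrm X) -> (forall h, X h -> L1T_norm h <= nrm X h) ->
  X f -> Xsum g -> (forall n, X (u n)) -> (forall n, Xsum (u n)) ->
  (forall n, nrm X (f - u n) <= B * 2^-1 ^+ n) ->
  (forall n, K 1 (g - u n) <= B * 2^-1 ^+ n) -> f = g.
Proof.
move=> sX LX Xf Yg Xu Yu hf hg.
have B0 : 0 <= B.
  have := hf 0%N; rewrite expr0 mulr1; apply: le_trans.
  by apply: (sn_ge0 sX); exact: (sn_carrierB sX).
apply: (L1_limit_unique (u := u) sX s01 LX (L1_le_K h0 h1)) => e e0.
have [|n hn] := @half_expr_lt _ (e / (B + 1)); first by rewrite divr_gt0//; lra.
have Bn : B * 2^-1 ^+ n <= e.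
  apply: (@le_trans _ _ ((B + 1) * 2^-1 ^+ n)).
    by rewrite ler_wpM2r ?exprn_ge0//; lra.
  by rewrite mulrC -ler_pdivlMr ?ltW//; lra.
exists n; split.
- exact: (sn_carrierB sX).
- exact: (sn_carrierB s01).
- by rewrite (snBC sX)//; exact: le_trans (hf n) Bn.
- by rewrite (snBC s01)//; exact: le_trans (hg n) Bn.
Qed.

Variables (F : nat -> R[i] -> L1T R) (M : R).
Hypotheses (M0 : 0 < M) (cF : forall k, calderon (F k)).
Hypothesis FM : forall k, calderon_norm (F k) <= M * 2^-1 ^+ k.

Let S n z := \sum_(k < n) F k z.

Let YF k z (sz : strip z) : Xsum (F k z) := calderon_carrier (cF k) sz.

Let YS n z : strip z -> Xsum (S n z).
Proof. by move=> sz; apply: (sn_carrier_sum s01) => k _; exact: YF. Qed.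

Let X0S n (t : R) : X0 (S n (0 +i* t)).
Proof. by apply: (sn_carrier_sum s0) => k _; exact: calderon_carrier0. Qed.

Let X1S n (t : R) : X1 (S n (1 +i* t)).
Proof. by apply: (sn_carrier_sum s1) => k _; exact: calderon_carrier1. Qed.

Let KF k z : strip z -> K 1 (F k z) <= M * 2^-1 ^+ k.
Proof. by move=> sz; apply: le_trans (calderon_strip_le h0 h1 (cF k) sz) _. Qed.

(** The pointwise sum of the series in X_0 + X_1, chosen in [complex_geometric]. *)
Variable H : R[i] -> L1T R.
Hypothesis YH : forall z, strip z -> Xsum (H z).
Hypothesis HS : forall z, strip z ->
  forall n, K 1 (H z - S n z) <= 2 * M * 2^-1 ^+ n.

(** On this line the terms are geometrically small in X_0 itself, so the series converges there too,
    and its sum can only be the value of H. *)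
Lemma series_line0 (t : R) : X0 (H (0 +i* t)) /\
  forall n, nrm X0 (H (0 +i* t) - S n (0 +i* t)) <= 2 * M * 2^-1 ^+ n.
Proof.
have sz := line0_strip t.
have [||x Xx hx] := banach_geometric (homogeneous_banach h0)
  (a := fun k => F k (0 +i* t)) M0.
- by move=> k; exact: calderon_carrier0.
- by move=> k; exact: le_trans (calderon_norm_line0 (cF k) t) (FM k).
suff <- : x = H (0 +i* t) by [].
exact: (sum_space_limit_unique s0 (homogeneous_L1 h0) Xx (YH sz) (fun n => X0S n t)
  (fun n => YS n sz) hx (HS sz)).
Qed.

Lemma series_line1 (t : R) : X1 (H (1 +i* t)) /\
  forall n, nrm X1 (H (1 +i* t) - S n (1 +i* t)) <= 2 * M * 2^-1 ^+ n.
Proof.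
have sz := line1_strip t.
have [||x Xx hx] := banach_geometric (homogeneous_banach h1)
  (a := fun k => F k (1 +i* t)) M0.
- by move=> k; exact: calderon_carrier1.
- by move=> k; exact: le_trans (calderon_norm_line1 (cF k) t) (FM k).
suff <- : x = H (1 +i* t) by [].
exact: (sum_space_limit_unique s1 (homogeneous_L1 h1) Xx (YH sz) (fun n => X1S n t)
  (fun n => YS n sz) hx (HS sz)).
Qed.

Let S_uniform (e : R) : 0 < e -> exists n, 2 * M * 2^-1 ^+ n <= e.
Proof.
move=> e0; have M20 : 0 < 2 * M by rewrite mulr_gt0.
have [n hn] := half_expr_lt (divr_gt0 e0 M20); exists n.
by rewrite mulrC -ler_pdivlMr// ltW.
Qed.

(* The difference quotients of the partial sums converge geometrically, by the
   Cauchy estimate [difference_quotient_le]. *)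
Lemma series_has_cderiv z : open_strip z ->
  exists2 D, Xsum D & has_cderiv (nrm Xsum) (strip_ext H) z D.
Proof.
move=> oz; have sz := open_strip_sub oz.
have [r0 r00 hr0] := open_strip_near oz.
pose r := r0 / 2; have r_gt0 : 0 < r by rewrite divr_gt0.
have rz w : `|complex.Re (w - z)| <= r -> open_strip w.
  by move=> wr; apply: hr0; apply: le_lt_trans wr _; rewrite /r; lra.
have nrz w : normc (w - z) < r -> strip w.
  by move=> wr; apply/open_strip_sub/rz; exact: le_trans (normRe_le _) (ltW wr).
pose E k := strip_ext (F k).
have YE k w : Xsum (E k w) by exact: (strip_ext_carrier s01 (fun z => @YF k z)).
have [D hD] : {D : nat -> L1T R &
    forall k, Xsum (D k) /\ has_cderiv (nrm Xsum) (E k) z (D k)}.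
  apply: (@choice _ _ (fun k D => Xsum D /\ has_cderiv (nrm Xsum) (E k) z D)) => k.
  by have [D YD dD] := calderon_has_cderiv h0 h1 (cF k) oz; exists D.
have YD k : Xsum (D k) := (hD k).1.
have est k : nrm Xsum (D k) <= 2 * (M * 2^-1 ^+ k) / r /\
    forall w, normc (w - z) < r ->
    nrm Xsum (E k w - E k z) <= 2 * (M * 2^-1 ^+ k) / r * normc (w - z).
  apply: (difference_quotient_le s01 (YE k) r_gt0 (YD k) (hD k).2).
  move=> w wr _; have ow := rz w wr; split.
    by rewrite /E (strip_extE _ (open_strip_sub ow)); exact/KF/open_strip_sub.
  exact: (calderon_has_cderiv h0 h1 (cF k) ow).
have c0 : 0 < 2 * M / r by rewrite divr_gt0// mulr_gt0.
have [||D' YD' hD'] := sum_space_geometric h0 h1 (a := D) c0.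
- exact: YD.
- by move=> k; have [le _] := est k; apply: le_trans le _; rewrite mulrA mulrAC.
exists D' => // e e0.
(* Both the tail of the increments and the tail of the derivatives are at most this multiple of |w -
   z|, uniformly on the disc of radius r. Hence n is fixed before the radius [d] that serves the
   n-th partial sum. *)
have [n hn] : exists n, 2 * (2 * M / r) * 2^-1 ^+ n <= e / 3.
  have c20 : 0 < 2 * (2 * M / r) by rewrite mulr_gt0.
  have e30 : 0 < e / 3 by rewrite divr_gt0.
  have [n hn] := half_expr_lt (divr_gt0 e30 c20); exists n.
  by rewrite mulrC -ler_pdivlMr// ltW.
have dS m : has_cderiv (nrm Xsum) (fun w => \sum_(k < m) E k w) z (\sum_(k < m) D k).
  elim: m => [|m ih].
    move=> e1 e10; exists 1 => // w _; rewrite !big_ord0 scaler0 !subr0 (sn0 s01).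
    by rewrite mulr_ge0 ?normc_ge0 ?ltW.
  rewrite big_ord_recr /=.
  have -> : (fun w => \sum_(k < m.+1) E k w) = fun w => \sum_(k < m) E k w + E m w.
    by apply/funext => w; rewrite big_ord_recr.
  apply: (has_cderivD s01) => //; last exact: (hD m).2.
    by move=> w; apply: (sn_carrier_sum s01) => k _; exact: YE.
  by apply: (sn_carrier_sum s01) => k _; exact: YD.
have [d d0 hd] := dS n _ (divr_gt0 e0 (@ltr0n R 3)).
exists (Num.min d r); first by rewrite lt_min d0.
move=> w; rewrite lt_min => /andP[wd wr]; have sw := nrz w wr.
rewrite !strip_extE//; have [->|wz] := eqVneq w z.
  by rewrite !subrr scale0r subrr (sn0 s01) normc0 mulr0.
set N := normc (w - z) in wd wr *.
have N0 : 0 < N by rewrite normc_gt0 subr_eq0.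
pose a k := F k w - F k z.
have Ya k : Xsum (a k) by apply: (sn_carrierB s01); exact: YF.
have sumaE m : \sum_(k < m) a k = S m w - S m z by rewrite sumrB.
have [||x Yx hx] := sum_space_geometric h0 h1 (a := a) (K := 2 * M / r * N) (mulr_gt0 c0 N0).
- exact: Ya.
- move=> k; have [_ /(_ w wr)] := est k; rewrite /E !strip_extE// -/N.
  by rewrite /a /=; lra.
have xE : x = H w - H z.
  have Yu m : Xsum (\sum_(k < m) a k) by apply: (sn_carrier_sum s01).
  have YHw := sn_carrierB s01 (YH sw) (YH sz).
  (* A common bound for two remainders: the first summand is that of the series for x, and 4 M adds
     the remainders 2 M of H at w and at z. *)
  apply: (sum_space_limit_unique (B := 2 * (2 * M / r * N) + 4 * M) s01 (L1_le_K h0 h1) Yx YHw Yu Yu) => m.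
    apply: le_trans (hx m) _; by rewrite ler_wpM2r ?exprn_ge0// lerDl mulr_ge0 ?(ltW M0).
  have -> : H w - H z - \sum_(k < m) a k = (H w - S m w) - (H z - S m z).
    by rewrite sumaE !opprD !opprK addrACA.
  apply: le_trans (snB s01 (sn_carrierB s01 (YH sw) (YS m sw))
    (sn_carrierB s01 (YH sz) (YS m sz))) _.
  have := HS sw m; have := HS sz m.
  have : 0 <= 2 * (2 * M / r * N) * 2^-1 ^+ m.
    by rewrite !mulr_ge0 ?invr_ge0 ?exprn_ge0 ?(ltW N0) ?(ltW M0) ?(ltW r_gt0).
  rewrite /=; lra.
have Ysa : Xsum (\sum_(k < n) a k) by apply: (sn_carrier_sum s01).
have YsD : Xsum (\sum_(k < n) D k) by apply: (sn_carrier_sum s01).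
have Y1 : Xsum (x - \sum_(k < n) a k) by exact: (sn_carrierB s01).
have Y2 : Xsum (\sum_(k < n) a k - (w - z) *: \sum_(k < n) D k).
  by apply: (sn_carrierB s01) => //; exact: (sn_carrierZ s01).
have Y3' : Xsum (D' - \sum_(k < n) D k) by exact: (sn_carrierB s01).
have Y3 := sn_carrierZ s01 (w - z) Y3'.
have -> : H w - H z - (w - z) *: D' = (x - \sum_(k < n) a k) +
    (\sum_(k < n) a k - (w - z) *: \sum_(k < n) D k) -
    (w - z) *: (D' - \sum_(k < n) D k).
  by rewrite -xE subrKA scalerBr opprB addrA subrK.
apply: le_trans (snB s01 (sn_carrierD s01 Y1 Y2) Y3) _.
have := snD s01 Y1 Y2; rewrite (snZ s01 _ Y3') -/N.
have t1 : nrm Xsum (x - \sum_(k < n) a k) <= e / 3 * N.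
  apply: le_trans (hx n) _; apply: (@le_trans _ _ (2 * (2 * M / r) * 2^-1 ^+ n * N)).
    by rewrite le_eqVlt; apply/orP; left; apply/eqP; ring.
  by rewrite ler_pM2r.
have t2 : nrm Xsum (\sum_(k < n) a k - (w - z) *: \sum_(k < n) D k) <= e / 3 * N.
  apply: le_trans (hd w wd); rewrite le_eqVlt; apply/orP; left; apply/eqP.
  congr (nrm Xsum (_ - _)); rewrite -sumrB; apply: eq_bigr => k _.
  by rewrite /E !strip_extE.
have t3 : N * nrm Xsum (D' - \sum_(k < n) D k) <= e / 3 * N.
  rewrite mulrC ler_pM2r//; exact: le_trans (hD' n) hn.
lra.
Qed.

Lemma series_calderon : calderon H /\
  forall n, calderon_norm (fun z => H z - S n z) <= 2 * M * 2^-1 ^+ n.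
Proof.
have cS n : calderon (S n) by exact: calderon_sum.
split; last first.
  move=> n; apply: calderon_norm_le => t; first by have [_] := series_line0 t; apply.
  by have [_] := series_line1 t; apply.
apply: (calderonI h0 h1).
- apply: (bounded_continuous_limit s01 (g := S)) => //.
    by move=> n; exact: calderon_strip.
  move=> e /S_uniform[n hn]; exists n => z sz; exact: le_trans (HS sz n) hn.
- exact: series_has_cderiv.
- apply: (bounded_continuous_limit s0 (g := fun n (t : R) => S n (0 +i* t)) (h := fun t : R => H (0 +i* t))).
  + by move=> n; exact: (calderon_line0 (cS n)).
  + by move=> t _; have [] := series_line0 t.
  + move=> e /S_uniform[n hn]; exists n => t _.
    by have [_ /(_ n)/le_trans] := series_line0 t; apply.
- apply: (bounded_continuous_limit s1 (g := fun n (t : R) => S n (1 +i* t)) (h := fun t : R => H (1 +i* t))).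
  + by move=> n; exact: (calderon_line1 (cS n)).
  + by move=> t _; have [] := series_line1 t.
  + move=> e /S_uniform[n hn]; exists n => t _.
    by have [_ /(_ n)/le_trans] := series_line1 t; apply.
Qed.

End calderon_series.

Section translation_equicontinuity.
Variables (R : realType) (X : nspace R).
Hypothesis hX : homogeneous X.

(* Translations are isometries of X, hence strongly continuous uniformly on
   compact sets. *)
Lemma translate_cvg_compact (g : R -> L1T R) (T a e : R) :
  bounded_continuous_in X [set: R] g -> 0 < e ->
  \forall b \near a, forall t, `[- T, T]%classic t ->
    nrm X (translate b (g t) - translate a (g t)) <= e.
Proof.
move=> bg e0; have sX := banach_seminormed (homogeneous_banach hX).
have [Xg _ cg] := (bounded_continuousP sX _ _).1 bg.
have tX b f : X f -> X (translate b f) by move=> /(homogeneous_translate hX b)[].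
have nX b f : X f -> nrm X (translate b f) = nrm X f.
  by move=> /(homogeneous_translate hX b)[].
have e30 : 0 < e / 3 by rewrite divr_gt0.
(* By compactness it is enough to treat u near each t together with b near a. There g u is replaced
   by g t twice, at a cost of e / 3 each because translations are isometries, and strong continuity
   at g t costs the last third. *)
have := (compact_near_coveringP _).1 (@segment_compact R (- T) T).
move=> /(_ R (nbhs a) (fun b t => nrm X (translate b (g t) - translate a (g t)) <= e)).
apply => t _.
have nt := cg t I _ e30.
have posb : \forall b \near a, 0 <= nrm X (translate b (g t) - translate a (g t)).
  apply: filterE => b; apply: (sn_ge0 sX); apply: (sn_carrierB sX); exact/tX/Xg.
have nb := (cvg0_nonneg (FF := nbhs_filter a) posb).1
  (homogeneous_continuous hX a (Xg t I)) _ e30.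
near=> u b.
have gu : nrm X (g u - g t) <= e / 3.
  by have := I; near: u.
have bt : nrm X (translate b (g t) - translate a (g t)) <= e / 3 by near: b.
have Xgu := Xg u I; have Xgt := Xg t I.
have := snBD sX (tX b _ Xgu) (tX b _ Xgt) (tX a _ Xgu).
have := snBD sX (tX b _ Xgt) (tX a _ Xgt) (tX a _ Xgu).
rewrite -!translateB (nX b (g u - g t)); last exact: (sn_carrierB sX).
rewrite (nX a (g t - g u)); last exact: (sn_carrierB sX).
rewrite (snBC sX Xgt Xgu); lra.
Unshelve. all: by end_near. Qed.

End translation_equicontinuity.

(** * Homogeneity of the complex interpolation space *)

Section complex_method_homogeneous.
Variables (R : realType) (X0 X1 : nspace R).
Hypotheses (h0 : homogeneous X0) (h1 : homogeneous X1).
Variable theta : R.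
Hypotheses (theta0 : 0 < theta) (theta1 : theta < 1).
Implicit Types (f g : L1T R) (F G : R[i] -> L1T R).
Local Notation K := (Kfunctional X0 X1).
Local Notation Xsum := (sum_space X0 X1).
Local Notation calderon := (calderon X0 X1).
Local Notation calderon_norm := (calderon_norm X0 X1).
Local Notation Xc := (complex_interpolation X0 X1 theta).

Let s0 := banach_seminormed (homogeneous_banach h0).
Let s1 := banach_seminormed (homogeneous_banach h1).
Let s01 : seminormed Xsum (nrm Xsum) := K_seminormed h0 h1 ler01.

Let theta_strip : strip theta%:C.
Proof. by rewrite /strip /= !ltW. Qed.

Lemma complex_nrm_le F f : calderon F -> F theta%:C = f ->
  nrm Xc f <= calderon_norm F.
Proof.
move=> cF Ff; apply: ge_inf; last by exists F.
by exists 0 => _ [G [cG _] <-]; exact: calderon_norm_ge0.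
Qed.

Lemma complex_adherent f (e : R) : Xc f -> 0 < e ->
  exists F, [/\ calderon F, F theta%:C = f & calderon_norm F < nrm Xc f + e].
Proof.
move=> [F0 cF0 F0f] e0.
have hi : has_inf [set calderon_norm F | F in [set F | calderon F /\ F theta%:C = f]].
  split; first by exists (calderon_norm F0), F0.
  by exists 0 => _ [G [cG _] <-]; exact: calderon_norm_ge0.
have [_ [F [cF Ff] <-] lt] := inf_adherent e0 hi.
by exists F.
Qed.

Lemma complex_le_all f (m : R) : Xc f ->
  (forall F, calderon F -> F theta%:C = f -> m <= calderon_norm F) -> m <= nrm Xc f.
Proof.
move=> Xf H; apply/ler_addgt0Pr => e e0.
have [F [cF Ff lt]] := complex_adherent Xf e0.
exact: le_trans (H F cF Ff) (ltW lt).
Qed.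

Lemma complex_seminormed : seminormed Xc (nrm Xc).
Proof.
have XD f g : Xc f -> Xc g -> Xc (f + g).
  move=> [F cF <-] [G cG <-]; exists (fun z => F z + G z) => //; exact: calderonD.
have XZ (c : R[i]) f : Xc f -> Xc (c *: f).
  by move=> [F cF <-]; exists (fun z => c *: F z) => //; exact: calderon_cstZ.
have Xc0 : Xc 0 by exists (fun=> 0) => //; exact: calderon0.
have nZ (c : R[i]) f : Xc f -> nrm Xc (c *: f) <= normc c * nrm Xc f.
  move=> Xf; have [->|c0] := eqVneq c 0.
    rewrite scale0r normc0 mul0r.
    apply: le_trans (@complex_nrm_le (fun=> 0) 0 (calderon0 h0 h1) (erefl _)) _.
    by apply: calderon_norm_le => t; rewrite ?(sn0 s0) ?(sn0 s1).
  have nc0 : 0 < normc c by rewrite normc_gt0.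
  rewrite mulrC -ler_pdivrMr//; apply: complex_le_all => // F cF Ff.
  rewrite ler_pdivrMr// mulrC.
  apply: le_trans (calderon_normZ h0 h1 c cF).
  by apply: complex_nrm_le; [exact: calderon_cstZ|rewrite Ff].
split => //.
- move=> f g Xf Xg; apply/ler_addgt0Pr => e e0; have e20 : 0 < e / 2 by rewrite divr_gt0.
  have [F [cF Ff ltF]] := complex_adherent Xf e20.
  have [G [cG Gg ltG]] := complex_adherent Xg e20.
  have := @complex_nrm_le (fun z => F z + G z) (f + g) (calderonD h0 h1 cF cG).
  rewrite Ff Gg => /(_ erefl); have := calderon_normD h0 h1 cF cG; lra.
- move=> c f Xf; apply/eqP; rewrite eq_le nZ//=.
  have [->|c0] := eqVneq c 0.
    rewrite normc0 mul0r; apply: complex_le_all; first exact: XZ.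
    by move=> F cF _; exact: calderon_norm_ge0.
  have nc0 : 0 < normc c by rewrite normc_gt0.
  have := nZ c^-1 (c *: f) (XZ c f Xf).
  by rewrite scalerA mulVf// scale1r normcV ler_pdivlMl.
Qed.

Lemma complex_L1 f : Xc f -> L1T_norm f <= 1 * nrm Xc f.
Proof.
move=> Xf; rewrite mul1r; apply: complex_le_all => // F cF Ff.
have sf : Xsum f by rewrite -Ff; exact: (calderon_carrier cF).
apply: le_trans (L1_le_K h0 h1 sf) _; rewrite -Ff.
exact: (calderon_strip_le h0 h1 cF).
Qed.

(** Choose for each term a competitor that is optimal up to M 2^-k. The competitors sum to an
    admissible function, and its remainder after n terms is a competitor for the remainder of the
    original series. *)
Lemma complex_geometric : geometric_complete Xc (nrm Xc).
Proof.
apply: (geometric_completeI complex_seminormed) => a M M0 Xa na.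
have dec k : exists F, [/\ calderon F, F theta%:C = a k &
    calderon_norm F <= 2 * M * 2^-1 ^+ k].
  have e0 : 0 < M * 2^-1 ^+ k by rewrite mulr_gt0// exprn_gt0.
  have [F [cF Fa lt]] := complex_adherent (Xa k) e0.
  by exists F; split => //; have := na k; lra.
have [F hF] := choice dec.
have cF k : calderon (F k) by have [] := hF k.
have FM k : calderon_norm (F k) <= 2 * M * 2^-1 ^+ k by have [] := hF k.
have M20 : 0 < 2 * M by rewrite mulr_gt0.
have [H hH] : {H : R[i] -> L1T R & forall z, strip z -> Xsum (H z) /\
    forall n, K 1 (H z - \sum_(k < n) F k z) <= 2 * (2 * M) * 2^-1 ^+ n}.
  apply: (@choice _ _ (fun z x => strip z -> Xsum x /\
    forall n, K 1 (x - \sum_(k < n) F k z) <= 2 * (2 * M) * 2^-1 ^+ n)) => z.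
  have [sz|nsz] := pselect (strip z); last by exists 0.
  have [||x Yx hx] := sum_space_geometric h0 h1 (a := fun k => F k z) M20.
  - by move=> k; exact: (calderon_carrier (cF k)).
  - by move=> k; apply: le_trans (calderon_strip_le h0 h1 (cF k) sz) _.
  by exists x.
have [cH nH] := series_calderon h0 h1 M20 cF FM
  (fun z sz => (hH z sz).1) (fun z sz => (hH z sz).2).
exists (H theta%:C); first by exists H.
exists (2 * (2 * M)) => n; apply: le_trans (nH n).
apply: complex_nrm_le.
  by apply: calderonB => //; exact: calderon_sum.
by congr (_ - _); apply: eq_bigr => k _; have [] := hF k.
Qed.

Lemma complex_translate f a : Xc f ->
  Xc (translate a f) /\ nrm Xc (translate a f) = nrm Xc f.
Proof.
have tX b g : Xc g -> Xc (translate b g).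
  by move=> [F cF <-]; exists (fun z => translate b (F z)) => //; exact: calderon_translate.
have le b g : Xc g -> nrm Xc (translate b g) <= nrm Xc g.
  move=> Xg; apply: complex_le_all => // F cF Fg.
  apply: (@le_trans _ _ (calderon_norm (fun z => translate b (F z)))).
    by apply: complex_nrm_le; [exact: calderon_translate|rewrite Fg].
  apply: calderon_norm_le => t.
    have [_ ->] := homogeneous_translate h0 b (calderon_carrier0 cF t).
    exact: (calderon_norm_line0 cF).
  have [_ ->] := homogeneous_translate h1 b (calderon_carrier1 cF t).
  exact: (calderon_norm_line1 cF).
move=> Xf; split; first exact: tX.
apply/eqP; rewrite eq_le le//= -{1}(translateK a f).
exact/le/tX.
Qed.

(* The damping factor (1 + theta) / (1 + z) makes the boundary values of the
   competitor for f(. + b) - f(. + a) small near infinity; on a compact part of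
   the boundary they are small by equicontinuity of the translations. *)
Lemma complex_translate_cvg f a (e : R) : Xc f -> 0 < e ->
  \forall b \near a, nrm Xc (translate b f - translate a f) <= e.
Proof.
move=> [F cF Ff] e0.
have t_gt0 := theta0; have t_lt1 := theta1.
pose k (z : R[i]) : R[i] := (1 + theta)%:C * (1 * z + 1)^-1.
have k_theta : k theta%:C = 1.
  have -> : k theta%:C = (1 + theta)%:C / (1 + theta)%:C.
    by rewrite /k mul1r rmorphD rmorph1 addrC.
  by rewrite divff// -normc_gt0 normc_real normr_gt0 gt_eqF// addr_gt0.
have Re1 (z : R[i]) : strip z -> 1 <= normc (1 * z + 1) /\ `|complex.Im z| <= normc (1 * z + 1).
  move=> /andP[z0 z1]; rewrite mul1r; split.
    apply: (le_trans _ (normRe_le _)); case: (z) z0 z1 => x y /= x0 x1.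
    by rewrite ger0_norm; lra.
  by apply: (le_trans _ (normIm_le _)); case: (z) => x y /=; rewrite addr0.
have ne0 (z : R[i]) : strip z -> 1 * z + 1 != 0.
  by move=> /Re1[z1 _]; rewrite -normc_gt0; lra.
have kE z : normc (k z) = (1 + theta) / normc (1 * z + 1).
  by rewrite /k normcM normc_real normcV ger0_norm//; lra.
have k2 z : strip z -> normc (k z) <= 2.
  move=> sz; have [z1 _] := Re1 z sz; rewrite kE ler_pdivrMr; lra.
have dk z : strip z -> exists d, has_scalar_cderiv k z d.
  move=> /ne0 nz; exists ((1 + theta)%:C * - (1 / (1 * z + 1) ^+ 2)) => e1 e10.
  have t0 : 0 < 1 + theta by lra.
  have [d d0 hd] := has_scalar_cderivV nz (divr_gt0 e10 t0).
  exists d => // w /hd {}hd.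
  have -> : k w - k z - (w - z) * ((1 + theta)%:C * - (1 / (1 * z + 1) ^+ 2)) =
    (1 + theta)%:C * ((1 * w + 1)^-1 - (1 * z + 1)^-1
      - (w - z) * - (1 / (1 * z + 1) ^+ 2)).
    by rewrite /k; ring.
  rewrite normcM normc_real gtr0_norm//.
  apply: le_trans (ler_wpM2l (ltW t0) hd) _.
  by rewrite mulrA (mulrC (1 + theta)) divfK// gt_eqF.
pose M := calderon_norm F; have M0 : 0 <= M := calderon_norm_ge0 h0 cF.
(* Beyond height T the factor [k] is at most 2 / T and the difference of translates at most 2 M, so
   the product is at most 4 M / T <= e. Below T the bounds are 2 and e / 2. *)
pose T := 4 * M / e + 1.
have T0 : 0 < T by rewrite /T ltr_wpDl// divr_ge0 ?mulr_ge0 ?(ltW e0).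
have e20 : 0 < e / 2 by rewrite divr_gt0.
have n0 := translate_cvg_compact h0 T a (calderon_line0 cF) e20.
have n1 := translate_cvg_compact h1 T a (calderon_line1 cF) e20.
have bound (X : nspace R) (g : L1T R) (j t b : R) : homogeneous X -> X g ->
    strip (j +i* t) -> nrm X g <= M ->
    (`[- T, T]%classic t -> nrm X (translate b g - translate a g) <= e / 2) ->
    nrm X (k (j +i* t) *: (translate b g - translate a g)) <= e.
  move=> hX Xg sj gM small; have sX := banach_seminormed (homogeneous_banach hX).
  have [Xb nb] := homogeneous_translate hX b Xg.
  have [Xa na] := homogeneous_translate hX a Xg.
  have XB := sn_carrierB sX Xb Xa.
  have pos := sn_ge0 sX XB; have posk := normc_ge0 (k (j +i* t)).
  rewrite (snZ sX _ XB); have [tT|tT] := leP `|t| T.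
    have /small le : `[- T, T]%classic t by rewrite /= in_itv/= -ler_norml.
    have : normc (k (j +i* t)) * nrm X (translate b g - translate a g) <= 2 * (e / 2).
      by apply: ler_pM => //; exact: k2.
    by rewrite mulrCA divff// mulr1.
  have le : nrm X (translate b g - translate a g) <= 2 * M.
    by apply: le_trans (snB sX Xb Xa) _; rewrite nb na; lra.
  have kT : normc (k (j +i* t)) <= 2 / T.
    have [z1 zt] := Re1 _ sj; rewrite kE; apply: ler_pM => //; try lra.
      by rewrite invr_ge0; lra.
    by rewrite lef_pV2 ?posrE//; [apply: le_trans zt; exact: ltW|lra].
  apply: (@le_trans _ _ (2 / T * (2 * M))); first exact: ler_pM.
  rewrite mulrAC ler_pdivrMr// /T.
  have -> : e * (4 * M / e + 1) = 4 * M + e by field; rewrite gt_eqF.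
  lra.
near=> b.
have b0 : forall t, `[- T, T]%classic t ->
    nrm X0 (translate b (F (0 +i* t)) - translate a (F (0 +i* t))) <= e / 2.
  by near: b.
have b1 : forall t, `[- T, T]%classic t ->
    nrm X1 (translate b (F (1 +i* t)) - translate a (F (1 +i* t))) <= e / 2.
  by near: b.
apply: (@le_trans _ _ (calderon_norm
    (fun z => k z *: (translate b (F z) - translate a (F z))))).
  apply: complex_nrm_le; last by rewrite k_theta scale1r Ff.
  apply: (calderonZ h0 h1 k2 dk).
  by apply: (calderonB h0 h1); exact: calderon_translate.
apply: calderon_norm_le => t; apply: bound => //.
- exact: (calderon_carrier0 cF).
- exact: line0_strip.
- exact: (calderon_norm_line0 cF).
- exact: b0.
- exact: (calderon_carrier1 cF).
- exact: line1_strip.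
- exact: (calderon_norm_line1 cF).
- exact: b1.
Unshelve. all: by end_near. Qed.

Lemma complex_homogeneous : homogeneous_up_to_equivalence Xc.
Proof.
apply: (homogeneous_up_to_equivalenceI complex_seminormed complex_geometric ltr01).
- exact: complex_L1.
- exact: complex_translate.
- exact: complex_translate_cvg.
Qed.

End complex_method_homogeneous.

Theorem theorem3p3 (R : realType) (X0 X1 : nspace R)
    (hX0 : homogeneous X0) (hX1 : homogeneous X1)
    (theta q : R) (theta_gt0 : 0 < theta) (theta_lt1 : theta < 1)
    (q_ge1 : 1 <= q) :
  homogeneous_up_to_equivalence (real_interpolation X0 X1 theta q) /\
  homogeneous_up_to_equivalence (complex_interpolation X0 X1 theta).
Proof.
split; first exact: (real_homogeneous hX0 hX1 theta_gt0 q_ge1).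
exact: (complex_homogeneous hX0 hX1 theta_gt0 theta_lt1).
Qed.
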